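(* Let $N\ge3$, let $\lambda_1,\dots,\lambda_N>0$ with $\sum_{i=1}^N\lambda_i=1$, let $S,Y\subseteq\mathbb R^n$ be compact, let $\Omega=\overline{\operatorname{conv}(S\cup Y)}$, let $U\supseteq\Omega$ be open, and let $h\in C^2(U)$ satisfy, as quadratic forms on $U$, $-\tau_hI\le D^2h\le-\kappa_hI$ for some constants $0<\kappa_h\le\tau_h<\infty$. Let $\rho\in\mathcal P_{\mathrm{ac}}(S)\cap L^\infty(S)$ and let $$c_h(x_1,\dots,x_N)=h\Big(\sum_{i=1}^N\lambda_ix_i\Big).$$ Then there exists a constant $C>0$, depending only on $\lambda_1$, $N$, $\operatorname{diam}(S\cup Y)$, $\kappa_h$, $\tau_h$, $n$ and $\|\rho\|_{L^\infty}$, such that for any $\mu_2,\dots,\mu_N\in\mathcal P(Y)$ and $\tilde\mu_2,\dots,\tilde\mu_N\in\mathcal P(Y)$, $$\sum_{i=2}^N\lambda_i\|T_i^h-\tilde T_i^h\|_{L^2(\rho)}\le C\Big(\sum_{i=2}^N\lambda_iW_1(\mu_i,\tilde\mu_i)\Big)^{1/4},$$ where $(T_2^h,\dots,T_N^h)$ and $(\tilde T_2^h,\dots,\tilde T_N^h)$ are the unique multi-marginal optimal transport maps for the cost $c_h$ associated with $(\rho,\mu_2,\dots,\mu_N)$ and $(\rho,\tilde\mu_2,\dots,\tilde\mu_N)$, respectively.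
   Context: $\mathcal P(E)$ is the set of Borel probability measures on $E$; $\mathcal P_{\mathrm{ac}}(S)$ is the set of probability measures on $S$ absolutely continuous with respect to Lebesgue measure; $\rho\in L^\infty(S)$ means that its density is essentially bounded, with $\|\rho\|_{L^\infty}$ the essential supremum of the density. $W_1$ is the 1-Wasserstein distance for the Euclidean distance. Multi-marginal optimal transport maps for the cost $c_h$ associated with $(\rho,\mu_2,\dots,\mu_N)$: the ($\rho$-a.e. unique; existence and uniqueness follow from a theorem of Kim and Pass) minimizers of $\int_Sc_h(x_1,T_2(x_1),\dots,T_N(x_1))\,d\rho(x_1)$ among maps $T_i:S\to Y$ with $(T_i)_\#\rho=\mu_i$, $i=2,\dots,N$. *)

(* Defs.v *)
From HB Require Import structures.
From mathcomp Require Import all_boot all_order all_algebra.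
From mathcomp Require Import all_classical all_reals all_analysis.
From mathcomp Require Import measurable_realfun.

Set Implicit Arguments.
Unset Strict Implicit.
Unset Printing Implicit Defensive.

Import Order.TTheory GRing.Theory Num.Theory.
Import numFieldNormedType.Exports.

Local Open Scope classical_set_scope.
Local Open Scope ring_scope.

(* Borel sigma-algebra of a space of matrices (in particular of R^n = 'rV_n).
   The library norm on matrices is the sup norm, which induces the usual
   topology. *)
Definition borel_display : measure_display.
Proof. exact: default_measure_display. Qed.

Section borel_matrix_structure.
Context (R : realType) (m n : nat).

Definition borel_mx : set (set 'M[R]_(m, n)) := <<s @open 'M[R]_(m, n) >>.

HB.instance Definition _ := @isMeasurable.Build borel_display 'M[R]_(m, n)
  borel_mx (@sigma_algebra0 _ _ _) (@sigma_algebraC _ _)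
  (@sigma_algebra_bigcup _ _ _).

End borel_matrix_structure.

Section borel_matrix.
Context {R : realType}.
Implicit Types m n : nat.

Lemma measurable_coord m n (i : 'I_m) (j : 'I_n) :
  measurable_fun setT (fun A : 'M[R]_(m, n) => A i j : measurableTypeR R).
Proof.
apply: (measurability _ (RGenOpens.measurableE R)).
move=> _ [_ [a [b ->]] <-]; rewrite setTI; apply: sub_sigma_algebra.
apply: open_comp; last exact: interval_open.
by move=> A _; exact: coord_continuous.
Qed.

Lemma open_bigcup_ball m n (U : set 'M[R]_(m, n)) : open U ->
  U = \bigcup_(qk : 'M[rat]_(m, n) * nat)
      if `[< ball (map_mx ratr qk.1 : 'M[R]_(m, n)) qk.2.+1%:R^-1 `<=` U >]
      then ball (map_mx ratr qk.1 : 'M[R]_(m, n)) qk.2.+1%:R^-1 else set0.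
Proof.
move=> oU; apply/seteqP; split => [x Ux|x [qk _]]; last first.
  by case: ifPn => //= /asboolP; exact.
have /nbhs_ballP[e /= e0 xeU] : nbhs x U by exact: open_nbhs_nbhs.
have e20 : 0 < e / 2 by rewrite divr_gt0.
have [k _ /(_ k (leqnn k))/= ke] := near_infty_natSinv_lt (PosNum e20).
have k0 : 0 < (k.+1%:R^-1 : R) by rewrite invr_gt0.
have H (i : 'I_m) (j : 'I_n) :
    exists q : rat, ball (x i j) (k.+1%:R^-1 : R) (ratr q).
  have [|q qk] := @rat_in_itvoo R (x i j - k.+1%:R^-1) (x i j + k.+1%:R^-1).
    by rewrite ltrBlDr -addrA ltrDl addr_gt0.
  by exists q; rewrite -ball_normE /= ltr_distlC; rewrite in_itv in qk.
pose q : 'M[rat]_(m, n) := \matrix_(i, j) sval (cid (H i j)).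
have xq : ball x (k.+1%:R^-1 : R) (map_mx ratr q).
  by split => // i j; rewrite !mxE; exact: (svalP (cid (H i j))).
exists (q, k) => //=; case: ifPn => [_|/asboolP]; first exact: ball_sym.
case=> y qy; apply: xeU; rewrite [e]splitr.
by apply: (ball_triangle (le_ball (ltW ke) xq)); exact: le_ball (ltW ke) _ qy.
Qed.

Lemma measurable_ballM m n (A : 'M[R]_(m, n)) (e : R) d (T : measurableType d)
    (f : T -> 'M[R]_(m, n)) :
  (forall i j, measurable_fun setT (fun x => f x i j : measurableTypeR R)) ->
  measurable (f @^-1` ball A e).
Proof.
move=> mf; have [e0|e0] := ltP 0 e; last first.
  rewrite (_ : _ @^-1` _ = set0)//; apply/seteqP; split => // x [].
  by rewrite ltNge e0.
rewrite (_ : _ @^-1` _ = \bigcap_(ij : 'I_m * 'I_n)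
    ((fun x => f x ij.1 ij.2) @^-1` ball (A ij.1 ij.2) e)); last first.
  apply/seteqP; split => [x [_ fx] ij _|x fx]; first exact: fx.
  by split => // i j; exact: (fx (i, j)).
apply: fin_bigcap_measurable => [|i _]; first exact: finite_finset.
rewrite -[X in measurable X]setTI; apply: mf => //.
exact: measurable_ball.
Qed.

Lemma measurable_funM m n d (T : measurableType d) (f : T -> 'M[R]_(m, n)) :
  (forall i j, measurable_fun setT (fun x => f x i j : measurableTypeR R)) ->
  measurable_fun setT f.
Proof.
move=> mf; apply: (@measurability _ _ _ _ _ f (@open 'M[R]_(m, n))) => //.
move=> _ [U oU <-]; rewrite setTI (open_bigcup_ball oU) preimage_bigcup.
apply: countable_bigcupT_measurable => // i.
by case: ifPn => _; [exact: measurable_ballM|rewrite preimage_set0].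
Qed.

End borel_matrix.

(* the family (x, f 0, ..., f (n - 1)) *)
Definition fcons (T : Type) (n : nat) (x : T) (f : 'I_n -> T) : 'I_n.+1 -> T :=
  fun i => oapp f x (unlift ord0 i).

Section lebesgue_rV.
Context {R : realType}.
Implicit Types n : nat.

Definition consrV n (z : 'rV[R]_n * measurableTypeR R) : 'rV[R]_n.+1 :=
  \row_i fcons z.2 (z.1 0) i.

Definition unconsrV n (x : 'rV[R]_n.+1) : 'rV[R]_n * measurableTypeR R :=
  (\row_i x 0 (lift ord0 i), x 0 ord0).

Lemma consrVK n : cancel (@consrV n) (@unconsrV n).
Proof.
move=> [v t]; congr pair; last by rewrite mxE /fcons unlift_none.
by apply/rowP => i; rewrite !mxE /fcons liftK.
Qed.

Lemma measurable_consrV n : measurable_fun setT (@consrV n).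
Proof.
apply: measurable_funM => i j; rewrite /consrV.
under eq_fun do rewrite mxE /fcons; case: unliftP => [k|] _ /=.
  by apply: (measurableT_comp (measurable_coord 0 k)); exact: measurable_fst.
exact: measurable_snd.
Qed.

Lemma measurable_unconsrV n : measurable_fun setT (@unconsrV n).
Proof.
apply: measurable_fun_pair; last exact: measurable_coord.
apply: measurable_funM => i j; under eq_fun do rewrite mxE.
exact: measurable_coord.
Qed.

Section step.
Variables (n : nat) (mu : {sigma_finite_measure set 'rV[R]_n -> \bar R}).

Definition lebesgue_step : set 'rV[R]_n.+1 -> \bar R :=
  pushforward (mu \x @lebesgue_measure R)%E (@consrV n).

Let mcons := @measurable_consrV n.

Let step0 : lebesgue_step set0 = 0%E.
Proof. exact: measure0. Qed.

Let step_ge0 A : (0 <= lebesgue_step A)%E.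
Proof. exact: measure_ge0. Qed.

Let step_sigma_additive : semi_sigma_additive lebesgue_step.
Proof. by apply: measure_semi_sigma_additive. Qed.

HB.instance Definition _ := isMeasure.Build _ _ _ lebesgue_step
  step0 step_ge0 step_sigma_additive.

Let step_sigma_finite : sigma_finite setT lebesgue_step.
Proof.
have /sigma_finiteP[F [TF ndF Foo]] := sigma_finiteT mu.
have /sigma_finiteP[G [TG ndG Goo]] := sigma_finiteT (@lebesgue_measure R).
exists (fun k => @unconsrV n @^-1` (F k `*` G k)).
  apply/esym/seteqP; split => // x _.
  have [i _ Fx] : (\bigcup_i F i) (unconsrV x).1 by rewrite -TF.
  have [j _ Gx] : (\bigcup_i G i) (unconsrV x).2 by rewrite -TG.
  exists (maxn i j) => //; split.
  - by move: Fx; exact/subsetPset/ndF/leq_maxl.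
  - by move: Gx; exact/subsetPset/ndG/leq_maxr.
move=> k; have [mF Fk] := Foo k; have [mG Gk] := Goo k; split.
  rewrite -[X in measurable X]setTI.
  by apply: measurable_unconsrV => //; exact: measurableX.
rewrite /lebesgue_step /pushforward -comp_preimage.
rewrite (_ : _ \o _ = id); last by rewrite funeqE => z /=; rewrite consrVK.
rewrite preimage_id product_measure1E// lte_mul_pinfty//.
by rewrite ge0_fin_numE.
Qed.

HB.instance Definition _ := Measure_isSigmaFinite.Build _ _ _ lebesgue_step
  step_sigma_finite.

End step.

(* n-dimensional Lebesgue measure on the Borel sets, as an iterated product *)
Fixpoint lebesgue_rV n : {sigma_finite_measure set 'rV[R]_n -> \bar R} :=
  match n with
  | 0 => \d_(0 : 'rV[R]_0)
  | n'.+1 => lebesgue_step (lebesgue_rV n')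
  end.

Lemma lebesgue_rV_box n (a b : 'rV[R]_n) : (forall i, a 0 i <= b 0 i) ->
  lebesgue_rV n [set x | forall i, x 0 i \in `[a 0 i, b 0 i]] =
  (\prod_(i < n) (b 0 i - a 0 i))%:E.
Proof.
elim: n a b => [|n IHn] a b ab.
  by rewrite big_ord0 /= diracE mem_set// => -[].
pose a' := (unconsrV a).1; pose b' := (unconsrV b).1.
pose B : set 'rV[R]_n := [set x | forall i, x 0 i \in `[a' 0 i, b' 0 i]].
have mB : measurable B.
  rewrite (_ : B = \bigcap_(i : 'I_n) ((fun x : 'rV[R]_n => x 0 i) @^-1`
      `[a' 0 i, b' 0 i])); last first.
    by apply/seteqP; split => x Bx i => [_|]; exact: Bx.
  apply: fin_bigcap_measurable => [|i _]; first exact: finite_finset.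
  rewrite -[X in measurable X]setTI.
  exact: measurable_coord.
transitivity ((lebesgue_rV n \x @lebesgue_measure R)%E
    (B `*` `[a 0 ord0, b 0 ord0])).
  rewrite /= /lebesgue_step /pushforward; congr (product_measure1 _ _ _).
  apply/seteqP; split => [[v t] /= H|[v t] /= [Bv ti] i].
    split => [i|]; last by have := H ord0; rewrite mxE /fcons unlift_none.
    by have := H (lift ord0 i); rewrite !mxE /fcons liftK.
  rewrite mxE /fcons; case: unliftP => [j ->|->] //=.
  by have := Bv j; rewrite !mxE.
rewrite product_measure1E//= IHn => [|i]; last by rewrite !mxE.
rewrite lebesgue_measure_itv/= lte_fin big_ord_recl mulrC EFinM.
congr (_ * _)%E; last first.
  have := ab ord0; rewrite le_eqVlt => /predU1P[->|->//].
  by rewrite ltxx subrr.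
by congr EFin; apply: eq_bigr => i _; rewrite !mxE.
Qed.

End lebesgue_rV.

Section euclidean.
Context {R : realType} {n : nat}.
Implicit Types (v : 'rV[R]_n) (A : set 'rV[R]_n).

Definition enorm v : R := Num.sqrt (\sum_i v 0 i ^+ 2).

Definition diam A : R := sup [set enorm (x - y) | x in A & y in A].

Definition conv_hull A : set 'rV[R]_n := smallest (@convex_set R 'rV[R]_n) A.

Definition partial (i : 'I_n) (f : 'rV[R]_n -> R) (x : 'rV[R]_n) : R :=
  'D_(delta_mx 0 i) (f : 'rV[R]_n -> R^o) x.

Definition hessian (f : 'rV[R]_n -> R) (x : 'rV[R]_n) : 'M[R]_n :=
  \matrix_(i, j) partial i (partial j f) x.

(* f is of class C^2 on the open set U: all partial derivatives of order at
   most two exist and are continuous on U *)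
Definition C2_on (U : set 'rV[R]_n) (f : 'rV[R]_n -> R) : Prop :=
  forall x, U x ->
  [/\ {for x, continuous f},
      forall i, derivable (f : 'rV[R]_n -> R^o) x (delta_mx 0 i) /\
                {for x, continuous (partial i f)} &
      forall i j,
        derivable (partial j f : 'rV[R]_n -> R^o) x (delta_mx 0 i) /\
        {for x, continuous (partial i (partial j f))}].

(* A <= B as quadratic forms *)
Definition form_le (A B : 'M[R]_n) : Prop :=
  forall v, (v *m A *m v^T) 0 0 <= (v *m B *m v^T) 0 0.

End euclidean.

Section transport.
Context {R : realType} {n : nat}.
Local Open Scope ereal_scope.
Implicit Types (rho mu nu : probability 'rV[R]_n R) (S Y : set 'rV[R]_n).

(* density of rho with respect to the Lebesgue measure, meaningful when
   rho `<< lebesgue_rV n *)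
Definition density rho : 'rV[R]_n -> \bar R :=
  Radon_Nikodym_SigmaFinite.f rho (lebesgue_rV n).

Definition couplings mu nu : set (probability ('rV[R]_n * 'rV[R]_n)%type R) :=
  [set gamma | forall A, measurable A ->
     gamma (A `*` setT) = mu A /\ gamma (setT `*` A) = nu A].

Definition W1 mu nu : \bar R :=
  ereal_inf [set \int[gamma]_z (enorm (z.1 - z.2))%:E
            | gamma in couplings mu nu].

Definition L2norm rho S (f : 'rV[R]_n -> 'rV[R]_n) : \bar R :=
  (\int[rho]_(x in S) (enorm (f x) ^+ 2)%:E) `^ 2^-1.

Section multimarginal.
Variable m : nat.
Implicit Types (T : 'I_m -> 'rV[R]_n -> 'rV[R]_n)
  (c : ('I_m.+1 -> 'rV[R]_n) -> R).

Definition transport_maps rho S Y (mu : 'I_m -> probability 'rV[R]_n R) T :=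
  forall i, [/\ measurable_fun S (T i), (forall x, S x -> Y (T i x)) &
    forall A, measurable A -> rho (S `&` T i @^-1` A) = mu i A].

Definition mm_objective rho S c T : \bar R :=
  \int[rho]_(x in S) (c (fcons x (T ^~ x)))%:E.

(* T = (T_2, ..., T_N), with N = m.+1, minimizes the cost c among the families
   of maps from S to Y which transport rho to the mu_i *)
Definition mm_optimal_maps rho S Y (mu : 'I_m -> probability 'rV[R]_n R) c T
    : Prop :=
  transport_maps rho S Y mu T /\
  forall T', transport_maps rho S Y mu T' ->
    mm_objective rho S c T <= mm_objective rho S c T'.

Definition bary_cost (lam : 'I_m.+1 -> R) (h : 'rV[R]_n -> R) :
    ('I_m.+1 -> 'rV[R]_n) -> R :=
  fun x => h (\sum_i lam i *: x i)%R.

End multimarginal.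
End transport.

(* Main.v *)
Require Import Defs.
From HB Require Import structures.
From mathcomp Require Import all_boot all_order all_algebra.
From mathcomp Require Import all_classical all_reals all_analysis.
From mathcomp Require Import measurable_realfun ess_sup_inf ring lra.
Set Implicit Arguments.
Unset Strict Implicit.
Unset Printing Implicit Defensive.
Import Order.TTheory GRing.Theory Num.Theory.
Import numFieldNormedType.Exports.
Local Open Scope classical_set_scope.
Local Open Scope ring_scope.

(** A linear term in the cost has the same mean for all transport maps. Up to
    such a term, [- h] extends from the convex hull of [S `|` Y] to a convex
    Lipschitz function [c] on the whole space, whose constants are controlled
    by [tau] and the diameter ([extended_cost]); the optimal maps maximise the
    mean of [c (average x (T ^~ x))]. Given potentials [u] on [Y], the function
    [conjugate u] is convex and Lipschitz, and [gap u x y], which is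
    nonnegative, tells how far the tuple [y] is from realising the supremum
    that defines [conjugate u x].

    Two pointwise estimates compare tuples [y] and [y'] with small gaps at [x].
    The gradients of [c] at the two averages are approximate subgradients of
    [conjugate u] at [x], so they differ by at most a second difference of
    [conjugate u] plus the gaps, divided by the step [r]; uniform convexity of
    [c] turns this into a bound on the distance of the averages
    ([average_stability]). Exchanging one entry of [y] with the same entry of
    [y'] leaves the sum of the potentials unchanged, and uniform convexity then
    bounds the distance of the entries by that of the averages
    ([coordinate_stability]).

    A second difference with step [r] of an [L]-Lipschitz function on the line
    has integral [O(L r^2)], since it is the derivative of a second difference
    of a primitive. Tonelli's theorem and the density bound give the same for
    the mean of the second differences of [conjugate u]
    ([integral_second_difference_density]), whatever the potentials are. The
    mean distance of the averages is therefore [O(r + g / r)], where [g] is the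
    mean of the gaps, and [r = g^(1/2)] makes it [O(g^(1/2))]. The square of the
    weighted distance of the maps in [L^2] is then [O(g^(1/2))] as well.

    It remains to find potentials for which the gaps are small along both
    optimal maps. The dual functional has a Lipschitz minimiser [u]
    ([dual_minimizer]). By the second difference estimate, at almost every
    point the slopes of [conjugate u] from both sides agree, so the maximising
    tuple is unique there by the two pointwise estimates; the vanishing
    derivative of the dual functional says that it defines transport maps.
    Strong duality thus holds for maps ([strong_duality]), and the gaps vanish
    along optimal maps for the marginals [mu]. Along optimal maps for [mu'],
    their mean is bounded by the change of the dual functional when [mu] is
    replaced by [mu'], which is controlled by the Wasserstein distances
    ([almost_optimal_potential]). *)

(** * Euclidean geometry *)

Section euclidean_geometry.
Context {R : realType} {n : nat}.
Implicit Types (v w x y z : 'rV[R]_n).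

Definition dot v w : R := \sum_i v 0 i * w 0 i.

Lemma dotC v w : dot v w = dot w v.
Proof. by apply: eq_bigr => i _; rewrite mulrC. Qed.

Lemma dotDl v w z : dot (v + w) z = dot v z + dot w z.
Proof. by rewrite -big_split; apply: eq_bigr => i _; rewrite mxE mulrDl. Qed.

Lemma dotZl a v w : dot (a *: v) w = a * dot v w.
Proof. by rewrite mulr_sumr; apply: eq_bigr => i _; rewrite mxE mulrA. Qed.

Lemma dotDr v w z : dot z (v + w) = dot z v + dot z w.
Proof. by rewrite dotC dotDl !(dotC z). Qed.

Lemma dotZr a v w : dot w (a *: v) = a * dot w v.
Proof. by rewrite dotC dotZl dotC. Qed.

Lemma dotNl v w : dot (- v) w = - dot v w.
Proof. by rewrite -scaleN1r dotZl mulN1r. Qed.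

Lemma dotNr v w : dot w (- v) = - dot w v.
Proof. by rewrite dotC dotNl dotC. Qed.

Lemma dotBl v w z : dot (v - w) z = dot v z - dot w z.
Proof. by rewrite dotDl dotNl. Qed.

Lemma dotBr v w z : dot z (v - w) = dot z v - dot z w.
Proof. by rewrite dotDr dotNr. Qed.

Lemma dot_sumr (I : finType) (F : I -> 'rV[R]_n) v :
  dot v (\sum_i F i) = \sum_i dot v (F i).
Proof.
rewrite /dot exchange_big; apply: eq_bigr => i _.
by rewrite summxE mulr_sumr.
Qed.

Lemma dot_delta v j : dot v (delta_mx 0 j) = v 0 j.
Proof.
rewrite /dot (bigD1 j)//= mxE !eqxx mulr1 big1 ?addr0// => i ij.
by rewrite mxE (negbTE ij) mulr0.
Qed.

Lemma dotvv_ge0 v : 0 <= dot v v.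
Proof. by apply: sumr_ge0 => i _; rewrite -expr2 sqr_ge0. Qed.

Lemma enormE v : enorm v = Num.sqrt (dot v v).
Proof. by congr Num.sqrt; apply: eq_bigr => i _; rewrite expr2. Qed.

Lemma enorm_ge0 v : 0 <= enorm v.
Proof. exact: sqrtr_ge0. Qed.
#[local] Hint Resolve enorm_ge0 : core.

Lemma sqr_enorm v : enorm v ^+ 2 = dot v v.
Proof. by rewrite enormE sqr_sqrtr// dotvv_ge0. Qed.

Lemma enorm0 : enorm (0 : 'rV[R]_n) = 0.
Proof.
by rewrite enormE /dot big1 ?sqrtr0// => i _; rewrite !mxE mul0r.
Qed.

Lemma enormZ a v : enorm (a *: v) = `|a| * enorm v.
Proof.
by rewrite enormE dotZl dotZr mulrA -expr2 sqrtrM ?sqr_ge0// sqrtr_sqr enormE.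
Qed.

Lemma enormN v : enorm (- v) = enorm v.
Proof. by rewrite -scaleN1r enormZ normrN1 mul1r. Qed.

Lemma enormB v w : enorm (v - w) = enorm (w - v).
Proof. by rewrite -opprB enormN. Qed.

Lemma le_coord_enorm v i : `|v 0 i| <= enorm v.
Proof.
rewrite -sqrtr_sqr; apply: ler_wsqrtr.
by rewrite (bigD1 i)//= lerDl; apply: sumr_ge0 => j _; exact: sqr_ge0.
Qed.

Lemma enorm_eq0 v : enorm v = 0 -> v = 0.
Proof.
move=> v0; apply/rowP => i; rewrite mxE; apply/eqP.
by rewrite -normr_le0 -v0 le_coord_enorm.
Qed.

(** The vector [|w| v - |v| w] has a nonnegative square. *)
Lemma cauchy_schwarz v w : dot v w <= enorm v * enorm w.
Proof.
have [/enorm_eq0 ->|w0] := eqVneq (enorm w) 0.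
  rewrite -(scale0r (0 : 'rV[R]_n)) dotZr mul0r.
  by rewrite mulr_ge0.
have w1 : 0 < enorm w by rewrite lt_def w0 enorm_ge0.
have [/enorm_eq0 ->|v0] := eqVneq (enorm v) 0.
  rewrite -(scale0r (0 : 'rV[R]_n)) dotZl mul0r.
  by rewrite mulr_ge0.
have v1 : 0 < enorm v by rewrite lt_def v0 enorm_ge0.
have := dotvv_ge0 (enorm w *: v - enorm v *: w).
rewrite dotBl !dotBr !dotZl !dotZr -!sqr_enorm (dotC w v) => H.
have {H} : 0 <= 2 * (enorm v * enorm w) * (enorm v * enorm w - dot v w).
  by apply: le_trans H _; rewrite le_eqVlt; apply/orP; left; apply/eqP; ring.
rewrite pmulr_rge0 ?subr_ge0//.
by rewrite !mulr_gt0.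
Qed.

Lemma normr_dot v w : `|dot v w| <= enorm v * enorm w.
Proof.
rewrite ler_norml cauchy_schwarz andbT lerNl -dotNl.
by rewrite (le_trans (cauchy_schwarz _ _))// enormN.
Qed.

Lemma ler_enormD v w : enorm (v + w) <= enorm v + enorm w.
Proof.
rewrite -(@ler_pXn2r _ 2%N)// ?nnegrE ?addr_ge0//.
rewrite sqr_enorm dotDl !dotDr (dotC w v) sqrrD !sqr_enorm.
by have := cauchy_schwarz v w; lra.
Qed.

Lemma ler_enormB x y z : enorm (x - z) <= enorm (x - y) + enorm (y - z).
Proof. by rewrite (le_trans _ (ler_enormD _ _))// addrA subrK. Qed.

Lemma ler_dist_enorm v w : `|enorm v - enorm w| <= enorm (v - w).
Proof.
have H (a b : 'rV[R]_n) : enorm a <= enorm b + enorm (a - b).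
  by have := ler_enormD (a - b) b; rewrite subrK addrC.
by rewrite ler_distl H andbT lerBlDr enormB H.
Qed.

Lemma ler_enorm_sum (I : finType) (F : I -> 'rV[R]_n) :
  enorm (\sum_i F i) <= \sum_i enorm (F i).
Proof.
elim/big_ind2: _ => [|a x b y xa yb|//]; first by rewrite enorm0.
by rewrite (le_trans (ler_enormD _ _))// lerD.
Qed.

Lemma row_decomp v : v = \sum_i v 0 i *: delta_mx 0 i.
Proof. exact: row_sum_delta. Qed.

Lemma enorm_delta i : enorm (delta_mx 0 i : 'rV[R]_n) = 1.
Proof. by rewrite enormE dot_delta mxE !eqxx sqrtr1. Qed.

Lemma enorm_le_sum v : enorm v <= \sum_i `|v 0 i|.
Proof.
rewrite {1}(row_decomp v) (le_trans (ler_enorm_sum _))//.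
by apply: ler_sum => i _; rewrite enormZ enorm_delta mulr1.
Qed.

Lemma le_coord_normr v i : `|v 0 i| <= `|v|.
Proof.
by rewrite [leRHS]/Num.norm /= mx_normrE; exact: (le_bigmax _ _ (0, i)).
Qed.

Lemma normr_le_enorm v : `|v| <= enorm v.
Proof.
rewrite [leLHS]/Num.norm /= mx_normrE; apply/bigmax_leP; split=> // -[i j] _ /=.
by rewrite (ord1 i) le_coord_enorm.
Qed.

Lemma enorm_le_normr v : enorm v <= n%:R * `|v|.
Proof.
rewrite (le_trans (enorm_le_sum v))//.
rewrite (le_trans (ler_sum _ (fun i _ => le_coord_normr v i)))//.
by rewrite sumr_const card_ord mulr_natl.
Qed.

End euclidean_geometry.
#[global] Hint Extern 0 (is_true (0 <= enorm _)) => solve [apply: enorm_ge0] : core.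

(** * Strict directional derivatives *)

Section enorm_topology.
Context {R : realType} {n : nat}.
Implicit Types (x y : 'rV[R]_n).

Lemma nbhs_enormP x (P : set 'rV[R]_n) :
  nbhs x P <-> exists2 d : R, 0 < d & forall y, enorm (y - x) < d -> P y.
Proof.
split=> [/nbhs_ballP[e /= e0 eP]|[d d0 dP]].
  exists e => // y ye; apply: eP; rewrite -ball_normE /= distrC.
  exact: le_lt_trans (normr_le_enorm _) ye.
apply/nbhs_ballP; exists (d / n.+1%:R) => [/=|y]; first by rewrite divr_gt0.
rewrite -ball_normE /= distrC ltr_pdivlMr// mulrC => yd; apply: dP.
rewrite (le_lt_trans (enorm_le_normr _))// (le_lt_trans _ yd)//.
by rewrite ler_wpM2r// ler_nat.
Qed.

Lemma continuous_enormP (f : 'rV[R]_n -> R) x : {for x, continuous f} <->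
  forall e, 0 < e -> exists2 d : R, 0 < d &
    forall y, enorm (y - x) < d -> `|f y - f x| < e.
Proof.
have [P Q] := @cvgrPdist_lt R R _ (nbhs x) _ f (f x).
split=> [/P{}P e e0|H].
  suff /nbhs_enormP : \forall y \near x, `|f y - f x| < e by [].
  by near=> y; rewrite distrC; near: y; exact: P.
apply: Q => e /H cf.
suff : \forall y \near x, `|f y - f x| < e.
  by move=> ?; near=> y; rewrite distrC; near: y.
exact/nbhs_enormP.
Unshelve. all: by end_near. Qed.

End enorm_topology.

Section line_calculus.
Context {R : realType} {n : nat}.
Implicit Types (f : 'rV[R]_n -> R) (a v w x : 'rV[R]_n).

Lemma is_derive_line f a v (t d : R) :
  is_derive (a + t *: v) v (f : 'rV[R]_n -> R^o) d ->
  is_derive t 1 (fun s : R => f (a + s *: v) : R^o) d.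
Proof.
have E : (fun h : R => h^-1 *: (((fun s : R => f (a + s *: v) : R^o)
      \o shift t) (h *: 1) - f (a + t *: v))) =
    (fun h : R => h^-1 *: (((f : 'rV[R]_n -> R^o) \o shift (a + t *: v)) (h *: v)
      - f (a + t *: v))).
  apply/funext => h /=; congr (_ *: (f _ - _)).
  by rewrite scalerDl [h *: 1]mulr1 addrCA.
by move=> [df dd]; split; [rewrite /derivable E|rewrite -dd /derive E].
Qed.

Lemma mean_value (f df : R -> R) (a b : R) : a < b ->
  (forall t, a <= t <= b -> is_derive t 1 (f : R -> R^o) (df t)) ->
  exists2 c, a < c < b & f b - f a = df c * (b - a).
Proof.
move=> ab fdf; have [||c] := @MVT _ f df a b ab.
- by move=> t /[!in_itv]/= /andP[at_ tb]; apply: fdf; rewrite !ltW.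
- by apply: derivable_within_continuous => t /[!in_itv]/= /fdf[].
- by rewrite in_itv /= => cab fc; exists c.
Qed.

(** Difference quotients along [v] based at points tending to [x], and not
    only at [x], tend to [d].  Contrary to plain directional derivatives, these
    are additive in the direction, so that they need only be checked along the
    coordinate axes. *)
Definition strict_derive f x v (d : R) := forall e : R, 0 < e ->
  exists2 r : R, 0 < r & forall y t, enorm (y - x) < r -> `|t| < r ->
    `|f (y + t *: v) - f y - t * d| <= e * `|t|.

Lemma strict_derive0 f x : strict_derive f x 0 0.
Proof.
move=> e e0; exists 1 => // y t _ _.
by rewrite scaler0 addr0 subrr mulr0 subr0 normr0 mulr_ge0// ltW.
Qed.

Lemma strict_deriveZ f x v d c :
  strict_derive f x v d -> strict_derive f x (c *: v) (c * d).
Proof.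
move=> fvd e e0; have c1 : 0 < `|c| + 1 by rewrite ltr_pwDr.
have [|r r0 fr] := fvd (e / (`|c| + 1)); first by rewrite divr_gt0.
exists (Num.min (r / (`|c| + 1)) r) => [|y t].
  by rewrite lt_min r0 divr_gt0.
rewrite !lt_min => /andP[_ yr] /andP[tr _].
rewrite scalerA mulrA (le_trans (fr _ _ yr _))//.
  rewrite normrM; move: tr; rewrite ltr_pdivlMr// => /(le_lt_trans _); apply.
  by rewrite ler_wpM2l// lerDl.
rewrite normrM -mulrA ler_pM2l// mulrC ler_pdivrMr//.
by rewrite ler_wpM2l// lerDl.
Qed.

Lemma strict_deriveD f x v w d d' :
  strict_derive f x v d -> strict_derive f x w d' ->
  strict_derive f x (v + w) (d + d').
Proof.
move=> fv fw e e0; have e2 : 0 < e / 2 by rewrite divr_gt0.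
have [r r0 fr] := fv _ e2; have [s s0 fs] := fw _ e2.
have w1 : 0 < enorm w + 1 by rewrite ltr_pwDr ?enorm_ge0.
pose q := Num.min (Num.min (r / 2) s) (r / 2 / (enorm w + 1)).
have q0 : 0 < q by rewrite /q !lt_min s0 !(divr_gt0, r0, w1).
exists q => // y t; rewrite /q !lt_min.
move=> /andP[/andP[yr ys] _] /andP[/andP[tr ts] tw].
have yr' : enorm (y + t *: w - x) < r.
  rewrite -addrA addrCA [X in X < _](_ : _ = enorm (t *: w + (y - x))); last first.
    by rewrite addrCA.
  rewrite (le_lt_trans (ler_enormD _ _))// [ltRHS]splitr ltrD// enormZ.
  move: tw; rewrite ltr_pdivlMr// => /(le_lt_trans _); apply.
  by rewrite ler_wpM2l// lerDl.
have tr' : `|t| < r by rewrite (lt_trans tr)// ltr_pdivrMr// ltr_pMr// ltr1n.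
have H1 := fr _ _ yr' tr'; have H2 := fs _ _ ys ts.
rewrite (_ : y + t *: (v + w) = y + t *: w + t *: v); last first.
  by rewrite scalerDr [t *: v + _]addrC addrA.
rewrite (_ : _ - _ = (f (y + t *: w + t *: v) - f (y + t *: w) - t * d) +
  (f (y + t *: w) - f y - t * d')); last by ring.
rewrite (le_trans (ler_normD _ _))// (le_trans (lerD H1 H2))//.
by rewrite -mulrDl -splitr.
Qed.

Lemma strict_derive_sum f x (I : finType) (v : I -> 'rV[R]_n) (d : I -> R) :
  (forall i, strict_derive f x (v i) (d i)) ->
  strict_derive f x (\sum_i v i) (\sum_i d i).
Proof.
move=> fvd; elim/big_ind2: _ => //; first exact: strict_derive0.
by move=> *; exact: strict_deriveD.
Qed.

Lemma strict_derive_is_derive f x v d :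
  strict_derive f x v d -> is_derive x v (f : 'rV[R]_n -> R^o) d.
Proof.
move=> fvd.
suff H : h^-1 *: (((f : 'rV[R]_n -> R^o) \o shift x) (h *: v) - f x)
    @[h --> 0^'] --> (d : R^o).
  split; first by apply/cvg_ex; exists d.
  by apply/cvg_lim => //; exact: Rhausdorff.
apply/cvgrPdist_le => e e0; have [r r0 fr] := fvd _ e0.
near=> h.
have h0 : h != 0 by near: h; exact: nbhs_dnbhs_neq.
have hr : `|h| < r.
  by near: h; apply: dnbhs0_lt.
have := fr x h; rewrite subrr enorm0 => /(_ r0 hr).
rewrite /= [h *: v + x]addrC => H.
rewrite -[d in d - _](mulKf h0) -[_ *: _]/(_ * _) -mulrBr normrM normfV.
by rewrite ler_pdivrMl ?normr_gt0// distrC [leRHS]mulrC.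
Unshelve. all: by end_near. Qed.

(** By the mean value theorem on the segment from [y] to [y + t e_i]. *)
Lemma strict_derive_partial (U : set 'rV[R]_n) f x i : open U -> U x ->
  (forall y, U y -> derivable (f : 'rV[R]_n -> R^o) y (delta_mx 0 i)) ->
  {for x, continuous (partial i f)} ->
  strict_derive f x (delta_mx 0 i) (partial i f x).
Proof.
move=> oU Ux df /continuous_enormP cf e e0.
have [s s0 cs] := cf _ e0.
have /nbhs_enormP[r r0 rU] : nbhs x U by exact: open_nbhs_nbhs.
pose q := Num.min s r; have q0 : 0 < q by rewrite lt_min s0.
pose E : 'rV[R]_n := delta_mx 0 i.
have main y t : enorm (y - x) + t < q -> 0 < t ->
    `|f (y + t *: E) - f y - t * partial i f x| <= e * t.
  move=> ytq t0.
  have near_x c : 0 <= c <= t -> enorm (y + c *: E - x) < q.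
    move=> /andP[c0 ct]; rewrite addrAC (le_lt_trans (ler_enormD _ _))//.
    by rewrite enormZ enorm_delta mulr1 ger0_norm// (le_lt_trans _ ytq)// lerD2l.
  have [|c /andP[c0 ct]] := @mean_value (fun c => f (y + c *: E))
      (fun c => partial i f (y + c *: E)) 0 t t0.
    move=> c ct; apply: is_derive_line; apply: derivableP; apply: df.
    by apply: rU; have := near_x _ ct; rewrite /q lt_min => /andP[].
  rewrite scale0r addr0 subr0 => ->; rewrite [t * _]mulrC -mulrBl normrM (gtr0_norm t0).
  rewrite ler_pM2r//; apply/ltW/cs.
  by have := near_x c; rewrite !ltW// => /(_ isT); rewrite /q lt_min => /andP[].
exists (q / 3); first by rewrite divr_gt0.
move=> y t yq tq; have [t0|t0|->] := ltgtP t 0; last first.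
- by rewrite scale0r addr0 subrr mul0r subr0 normr0 mulr0.
- rewrite (gtr0_norm t0); apply: main => //.
  by move: tq; rewrite gtr0_norm//; lra.
- rewrite (ltr0_norm t0); have := main (y + t *: E) (- t).
  rewrite scaleNr addrK mulNr opprK => H.
  rewrite -normrN (_ : - (_ - _ - _) = f y - f (y + t *: E) + t * partial i f x); last by ring.
  apply: H; last by rewrite oppr_gt0.
  rewrite addrAC (le_lt_trans (lerD (ler_enormD _ _) (lexx _)))//.
  rewrite enormZ enorm_delta mulr1 (ltr0_norm t0).
  by move: tq; rewrite ltr0_norm//; lra.
Qed.

End line_calculus.

(** * Functions with bounded Hessian *)

Section second_order.
Context {R : realType} {n : nat}.
Implicit Types (f : 'rV[R]_n -> R) (v w x z : 'rV[R]_n) (A B : 'M[R]_n).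

Definition grad f x : 'rV[R]_n := \row_i partial i f x.

Definition bilin A v w : R := (v *m A *m w^T) 0 0.

Lemma bilinE A v w : bilin A v w = \sum_j \sum_i v 0 i * A i j * w 0 j.
Proof.
rewrite /bilin mxE; apply: eq_bigr => j _.
by rewrite !mxE mulr_suml.
Qed.

Lemma bilinDl A v v' w : bilin A (v + v') w = bilin A v w + bilin A v' w.
Proof. by rewrite /bilin !mulmxDl mxE. Qed.

Lemma bilinDr A v v' w : bilin A w (v + v') = bilin A w v + bilin A w v'.
Proof. by rewrite /bilin linearD /= mulmxDr mxE. Qed.

Lemma bilinZl A a v w : bilin A (a *: v) w = a * bilin A v w.
Proof. by rewrite /bilin -!scalemxAl mxE. Qed.

Lemma bilinZr A a v w : bilin A v (a *: w) = a * bilin A v w.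
Proof. by rewrite /bilin linearZ /= -!scalemxAr mxE. Qed.

Lemma bilinN A v w : bilin (- A) v w = - bilin A v w.
Proof. by rewrite /bilin mulmxN mulNmx mxE. Qed.

Lemma bilin_scalar a v w : bilin a%:M v w = a * dot v w.
Proof.
rewrite /bilin mul_mx_scalar -scalemxAl mxE; congr (_ * _).
by rewrite mxE; apply: eq_bigr => i _; rewrite mxE.
Qed.

Lemma bilinC A v w : A^T = A -> bilin A v w = bilin A w v.
Proof.
move=> AT; rewrite /bilin -[LHS]/((v *m A *m w^T) 0 0).
by rewrite -[v *m A *m w^T]trmxK mxE !trmx_mul trmxK AT mulmxA.
Qed.

(** Polarisation of a symmetric form, applied to vectors of equal length. *)
Lemma normr_bilin A (tau : R) v w : A^T = A ->
  (forall x, 0 <= bilin A x x <= tau * dot x x) ->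
  `|bilin A v w| <= tau * (enorm v * enorm w).
Proof.
move=> AT A0; have [v0|v0] := eqVneq (enorm v) 0.
  rewrite v0 mul0r mulr0 (enorm_eq0 v0) -(scale0r (0 : 'rV[R]_n)) bilinZl.
  by rewrite mul0r normr0.
have [w0|w0] := eqVneq (enorm w) 0.
  rewrite w0 !mulr0 (enorm_eq0 w0) -(scale0r (0 : 'rV[R]_n)) bilinZr.
  by rewrite mul0r normr0.
have v1 : 0 < enorm v by rewrite lt_def v0 enorm_ge0.
have w1 : 0 < enorm w by rewrite lt_def w0 enorm_ge0.
pose a := enorm w *: v; pose b := enorm v *: w.
have ab : bilin A a b = enorm v * enorm w * bilin A v w.
  by rewrite bilinZl bilinZr; ring.
have tau0 : 0 <= tau.
  have /andP[p q] := A0 v; have := le_trans p q.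
  by rewrite pmulr_lge0// -sqr_enorm exprn_gt0.
have sq x y : enorm x = enorm v * enorm w -> enorm y = enorm v * enorm w ->
    dot (x + y) (x + y) <= 4 * (enorm v * enorm w) ^+ 2.
  move=> Ex Ey; rewrite -sqr_enorm.
  have -> : 4 * (enorm v * enorm w) ^+ 2 = (2 * (enorm v * enorm w)) ^+ 2.
    by ring.
  rewrite lerXn2r ?nnegrE ?mulr_ge0//.
  by rewrite (le_trans (ler_enormD _ _))// Ex Ey; lra.
have Ea : enorm a = enorm v * enorm w.
  by rewrite enormZ ger0_norm// mulrC.
have Eb : enorm b = enorm v * enorm w by rewrite enormZ ger0_norm.
clearbody a b.
have Eb' : enorm (-1 *: b) = enorm v * enorm w.
  by rewrite enormZ normrN1 mul1r.
have /andP[P1 P2] := A0 (a + b); have /andP[Q1 Q2] := A0 (a + -1 *: b).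
have {P2}P2 := le_trans P2 (ler_wpM2l tau0 (sq _ _ Ea Eb)).
have {Q2}Q2 := le_trans Q2 (ler_wpM2l tau0 (sq _ _ Ea Eb')).
move: P1 P2 Q1 Q2.
rewrite !bilinDl !bilinDr !bilinZl !bilinZr (bilinC b a AT) ab => P1 P2 Q1 Q2.
have vw : 0 < enorm v * enorm w by rewrite mulr_gt0.
rewrite -(@ler_pM2l _ (4 * (enorm v * enorm w))) ?mulr_gt0//.
rewrite -[X in X * `|_|]ger0_norm ?(ltW (mulr_gt0 _ vw))// -normrM ler_norml.
move: P1 P2 Q1 Q2; set c := enorm v * enorm w; set d := bilin A v w.
set p := bilin A a a; set q := bilin A b b.
by move=> P1 P2 Q1 Q2; apply/andP; split; nra.
Qed.

(** Strict derivatives are additive in the direction, and along the axes they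
    come from the continuity of the partial derivatives. *)
Lemma C1_strict_derive (U : set 'rV[R]_n) f x v : open U -> U x ->
  (forall i y, U y -> derivable (f : 'rV[R]_n -> R^o) y (delta_mx 0 i)) ->
  (forall i, {for x, continuous (partial i f)}) ->
  strict_derive f x v (\sum_i v 0 i * partial i f x).
Proof.
move=> oU Ux df cf; rewrite {1}(row_decomp v).
apply: strict_derive_sum => i; apply: strict_deriveZ.
by apply: (strict_derive_partial oU Ux) => // y; exact: df.
Qed.

Section C2.
Variables (U : set 'rV[R]_n) (h : 'rV[R]_n -> R).
Hypotheses (oU : open U) (C2h : C2_on U h).

Lemma C2_strict_derive x v : U x -> strict_derive h x v (dot (grad h x) v).
Proof.
move=> Ux; rewrite (_ : dot _ _ = \sum_i v 0 i * partial i h x); last first.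
  by apply: eq_bigr => i _; rewrite mxE mulrC.
apply: (C1_strict_derive _ oU) => //.
- by move=> i y /C2h[_ /(_ i)[]].
- by move=> i; have [_ /(_ i)[]] := C2h Ux.
Qed.

Lemma C2_strict_derive_partial x v j : U x ->
  strict_derive (partial j h) x v (\sum_i v 0 i * partial i (partial j h) x).
Proof.
move=> Ux; apply: (C1_strict_derive _ oU) => //.
- by move=> i y /C2h[_ _ /(_ i j)[]].
- by move=> i; have [_ _ /(_ i j)[]] := C2h Ux.
Qed.

Lemma is_derive_line_grad a v (t : R) : U (a + t *: v) ->
  is_derive t 1 (fun s : R => h (a + s *: v) : R^o) (dot (grad h (a + t *: v)) v).
Proof.
move=> Ux; apply: is_derive_line; apply: strict_derive_is_derive.
exact: C2_strict_derive.
Qed.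

Lemma is_derive_line_hessian a v w (t : R) : U (a + t *: v) ->
  is_derive t 1 (fun s : R => dot (grad h (a + s *: v)) w : R^o)
    (bilin (hessian h (a + t *: v)) v w).
Proof.
move=> Ux.
have -> : (fun s : R => dot (grad h (a + s *: v)) w : R^o) =
    \sum_j (w 0 j \*: ((fun s => partial j h (a + s *: v)) : R -> R^o)).
  apply/funext => s; rewrite fct_sumE; apply: eq_bigr => j _.
  by rewrite mxE mulrC.
rewrite bilinE (_ : \sum_j _ = \sum_j w 0 j *:
    ((\sum_i v 0 i * partial i (partial j h) (a + t *: v)) : R^o)); last first.
  apply: eq_bigr => j _; rewrite -mulr_suml mulrC; congr (_ * _).
  by apply: eq_bigr => i _; rewrite mxE.
apply: is_derive_sum => j; apply: is_deriveZ.
apply: is_derive_line; apply: strict_derive_is_derive.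
exact: C2_strict_derive_partial.
Qed.

(** The mean value theorem turns the second difference over the square with
    side [s] into a difference of a first partial derivative. *)
Lemma second_difference x i j e : U x -> 0 < e -> exists2 r, 0 < r &
  forall s, 0 < s < r ->
  `|h (x + s *: delta_mx 0 i + s *: delta_mx 0 j) - h (x + s *: delta_mx 0 i)
    - h (x + s *: delta_mx 0 j) + h x
    - s ^+ 2 * partial j (partial i h) x| <= e * s ^+ 2.
Proof.
move=> Ux e0; pose ei : 'rV[R]_n := delta_mx 0 i; pose ej : 'rV[R]_n := delta_mx 0 j.
have [r r0 hr] : exists2 r : R, 0 < r & forall y t, enorm (y - x) < r ->
    `|t| < r -> `|partial i h (y + t *: ej) - partial i h y
       - t * partial j (partial i h) x| <= e * `|t|.
  have H := C2_strict_derive_partial ej i Ux; have := H e e0.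
  rewrite (_ : \sum_k _ = partial j (partial i h) x)//.
  rewrite (bigD1 j)//= mxE !eqxx mul1r big1 ?addr0// => k kj.
  by rewrite mxE (negbTE kj) mul0r.
have /nbhs_enormP[q q0 qU] : nbhs x U by exact: open_nbhs_nbhs.
have m0 : 0 < Num.min r (q / 2) by rewrite lt_min r0 divr_gt0.
exists (Num.min r (q / 2)) => // s /andP[s0]; rewrite lt_min => /andP[sr sq].
have Uc c d : 0 <= c <= s -> 0 <= d <= s -> U (x + c *: ei + d *: ej).
  move=> /andP[c0 cs] /andP[d0 ds]; apply: qU.
  rewrite -(addrA x (c *: ei)) addrC addrK (le_lt_trans (ler_enormD _ _))//.
  rewrite !enormZ !enorm_delta !mulr1 !ger0_norm//.
  by rewrite (le_lt_trans (lerD cs ds))//; lra.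
have [|c /andP[c0 cs] E] := @mean_value R
   (fun c => h ((x + s *: ej) + c *: ei) - h (x + c *: ei))
   (fun c => partial i h ((x + s *: ej) + c *: ei) - partial i h (x + c *: ei))
   0 s s0.
  move=> t ts; apply: is_deriveB; apply: is_derive_line; apply: derivableP.
    have [|_ /(_ i)[] //] := C2h (_ : U (x + s *: ej + t *: ei)).
    by rewrite addrAC; apply: Uc => //; rewrite lexx ltW.
  have [|_ /(_ i)[] //] := C2h (_ : U (x + t *: ei)).
  by have := @Uc t 0 ts; rewrite scale0r addr0; apply; rewrite lexx ltW.
have xc : enorm (x + c *: ei - x) < r.
  by rewrite [x + _]addrC addrK enormZ enorm_delta mulr1 gtr0_norm// (lt_trans cs).
have sr' : `|s| < r by rewrite gtr0_norm.
have H := hr _ _ xc sr'; rewrite (gtr0_norm s0) in H.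
rewrite (_ : _ - s ^+ 2 * _ = (partial i h (x + c *: ei + s *: ej)
  - partial i h (x + c *: ei) - s * partial j (partial i h) x) * s).
  by rewrite normrM (gtr0_norm s0) expr2 mulrA ler_pM2r.
move: E; rewrite scale0r !addr0 subr0 (addrAC x (s *: ej) (c *: ei)).
rewrite (addrAC x (s *: ej) (s *: ei)) -/ei -/ej => E.
rewrite mulrBl -{}E expr2.
move: (h _) (h _) (h _) (h _) (partial j _ _) => a b d1 d2 d3.
by ring.
Qed.

(** Schwarz's theorem: both mixed derivatives approximate the second difference
    over the same small square. *)
Lemma hessian_sym x : U x -> (hessian h x)^T = hessian h x.
Proof.
move=> Ux; apply/matrixP => i j; rewrite !mxE.
apply/eqP; rewrite -subr_eq0 -normr_le0; apply/ler_addgt0Pl => e e0.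
rewrite addr0; have e2 : 0 < e / 2 by rewrite divr_gt0.
have [r r0 Hr] := second_difference i j Ux e2.
have [q q0 Hq] := second_difference j i Ux e2.
pose s := Num.min r q / 2.
have m0 : 0 < Num.min r q by rewrite lt_min r0.
have s0 : 0 < s by rewrite divr_gt0.
have sm : s < Num.min r q by rewrite ltr_pdivrMr// ltr_pMr// ltr1n.
have [sr sq] : s < r /\ s < q by move: sm; rewrite lt_min => /andP.
have {Hr} := Hr s; rewrite s0 sr => /(_ isT) H1.
have {Hq} := Hq s; rewrite s0 sq => /(_ isT) H2.
rewrite -(@ler_pM2r _ (s ^+ 2)) ?exprn_gt0//.
rewrite -[X in _ * X <= _]ger0_norm ?sqr_ge0// -normrM.
have {H1 H2} := lerD H1 H2; rewrite -mulrDl -splitr; apply: le_trans.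
rewrite -[X in _ <= X + _]normrN (le_trans _ (ler_normD _ _))//.
rewrite (addrAC x _ (s *: delta_mx 0 i)).
move: (h _) (h _) (h _) (h _) (partial i _ _) (partial j _ _) => a b c d d1 d2.
by rewrite le_eqVlt; apply/orP; left; apply/eqP; congr (`| _ |); ring.
Qed.

Lemma gradient_increment z d w : (forall t : R, 0 <= t <= 1 -> U (z + t *: d)) ->
  forall c, 0 < c <= 1 -> exists2 b, U (z + b *: d) &
    dot (grad h (z + c *: d)) w - dot (grad h z) w =
    c * bilin (hessian h (z + b *: d)) d w.
Proof.
move=> zU c /andP[c0 c1].
have [|b /andP[b0 bc]] := @mean_value R (fun t => dot (grad h (z + t *: d)) w)
    (fun t => bilin (hessian h (z + t *: d)) d w) 0 c c0.
  move=> t /andP[t0 tc]; apply: is_derive_line_hessian.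
  by apply: zU; rewrite t0 (le_trans tc).
rewrite scale0r addr0 subr0 mulrC => E; exists b => //.
by apply: zU; rewrite ltW//= (le_trans (ltW bc)).
Qed.

Section semiconcave.
Variables (kappa tau : R).
Hypotheses (kappa0 : 0 <= kappa) (hessianP : forall x v, U x ->
  - (tau * dot v v) <= bilin (hessian h x) v v <= - (kappa * dot v v)).

(** The derivative of [h] along the segment moves away from its initial value at
    a rate between [kappa] and [tau]. For the lower bound a quadratic polynomial
    with matching derivative is added to [h]; in the upper bound the intermediate
    point is replaced by the end point. *)
Lemma quadratic_bounds z d : (forall t : R, 0 <= t <= 1 -> U (z + t *: d)) ->
  kappa / 2 * dot d d <= - (h (z + d) - h z - dot (grad h z) d) <=
  tau * dot d d.
Proof.
move=> zU; pose k := kappa / 2 * dot d d.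
have slope c : 0 < c <= 1 ->
    c * (2 * k) <= dot (grad h z) d - dot (grad h (z + c *: d)) d <=
    c * (tau * dot d d).
  move=> c01; have /andP[c0 c1] := c01.
  have [b Ub E] := gradient_increment d zU c01.
  have /andP[E1 E2] := hessianP d Ub.
  rewrite -[X in _ <= X <= _]opprB E -mulrN !ler_pM2l// lerNr lerNl E1 andbT.
  by rewrite (le_trans E2)// lerN2 /k; lra.
apply/andP; split.
- have [|c /andP[c0 c1]] := @mean_value R (fun t => h (z + t *: d) + k * (t * t))
      (fun t => dot (grad h (z + t *: d)) d + k * (t * 1 + t * 1)) 0 1 ltr01.
    move=> t t01; have H1 := is_derive_line_grad (zU t t01).
    have H2 := is_derive_id (t : R^o) (1 : R^o).
    exact: (is_deriveD H1 (is_deriveZ k (is_deriveM H2 H2))).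
  rewrite scale0r scale1r addr0 !subr0 !mulr1 !mulr0 addr0.
  have c01 : 0 < c <= 1 by rewrite c0 ltW.
  have /andP[+ _] := slope c c01.
  by rewrite -/k => P Q; lra.
- have [|c /andP[c0 c1]] := @mean_value R (fun t => h (z + t *: d))
      (fun t => dot (grad h (z + t *: d)) d) 0 1 ltr01.
    by move=> t t01; apply/is_derive_line_grad/zU.
  rewrite scale0r scale1r addr0 !subr0 !mulr1 => ->.
  have c01 : 0 < c <= 1 by rewrite c0 ltW.
  have /andP[_ H] := slope c c01.
  rewrite opprB (le_trans H)// ler_piMl//; last exact: ltW.
have := slope 1; rewrite ltr01 lexx => /(_ isT)/andP[P Q].
rewrite -[leRHS]mul1r (le_trans _ (le_trans P Q))// mul1r.
by rewrite mulr_ge0// /k mulr_ge0 ?dotvv_ge0// divr_ge0.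
Qed.

(** The increment [v] of the gradient is tested against itself: the mean value
    theorem makes [dot v v] a value of the Hessian form on [w - z] and [v]. *)
Lemma grad_lipschitz z w : (forall t : R, 0 <= t <= 1 -> U (z + t *: (w - z))) ->
  enorm (grad h w - grad h z) <= tau * enorm (w - z).
Proof.
move=> zU; set d := w - z; set v := grad h w - grad h z.
have c01 : 0 < (1 : R) <= 1 by rewrite ltr01 lexx.
have [b Ub] := gradient_increment v zU c01.
have zd : z + d = w by rewrite addrC subrK.
rewrite scale1r zd mul1r -dotBl -/v -sqr_enorm => E.
have symN : (- hessian h (z + b *: d))^T = - hessian h (z + b *: d).
  by rewrite linearN /= (hessian_sym Ub).
have [|v0] := eqVneq (enorm v) 0.
  move=> ->; have /andP[] := hessianP d Ub.
  have [->|d0] := eqVneq (enorm d) 0; first by rewrite mulr0.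
  move=> /le_trans/[apply]; rewrite lerN2 -sqr_enorm ler_pM2r.
    by move=> kt; rewrite mulr_ge0// (le_trans kappa0).
  by rewrite exprn_gt0// lt_def d0 enorm_ge0.
have v1 : 0 < enorm v by rewrite lt_def v0 enorm_ge0.
rewrite -(ler_pM2r v1) -expr2 E -mulrA (le_trans (ler_norm _))//.
rewrite -normrN -bilinN; apply: normr_bilin => // x.
have /andP[P Q] := hessianP x Ub.
rewrite bilinN lerNl P oppr_ge0 (le_trans Q)// oppr_le0.
by rewrite mulr_ge0 ?dotvv_ge0.
Qed.

End semiconcave.
End C2.
End second_order.

(** * Convex hulls and convex extension *)

Section convex_hull.
Context {R : realType} {n : nat}.
Implicit Types (A : set 'rV[R]_n) (x z w : 'rV[R]_n).

Lemma conv_hull_sub A : A `<=` conv_hull A.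
Proof. exact: sub_gen_smallest. Qed.

Lemma conv_hull_segment A z w (t : R) : conv_hull A z -> conv_hull A w ->
  0 <= t <= 1 -> conv_hull A (z + t *: (w - z)).
Proof.
move=> Az Aw /andP[t0 t1] B [cB AB].
have Bz : B z by exact: Az.
have Bw : B w by exact: Aw.
have t01 : Itv.spec (Itv.num_sem (R := R)) (Itv.Real `[0%Z, 1%Z]) t.
  rewrite /= /Itv.num_sem /= in_itv /= t0 t1 andbT.
  by rewrite realE t0.
have := cB w z (Itv.mk t01) (mem_set Bw) (mem_set Bz).
rewrite inE; congr (B _).
rewrite /conv /= /unstable.onem scalerBl scalerBr scale1r.
by rewrite addrCA.
Qed.

Lemma conv_hull_ball A x D : (forall a, A a -> enorm (a - x) <= D) ->
  forall z, conv_hull A z -> enorm (z - x) <= D.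
Proof.
move=> AD z Az; apply: (Az [set w | enorm (w - x) <= D]); split=> // y w t.
move=> /set_mem yD /set_mem wD; apply/mem_set => /=.
rewrite /conv /= /unstable.onem.
have t0 : 0 <= t%:num by []; have t1 : t%:num <= 1 by [].
rewrite (_ : _ - x = t%:num *: (y - x) + (1 - t%:num) *: (w - x)); last first.
  rewrite !scalerBr addrACA -opprD -scalerDl; congr (_ - _).
  by rewrite addrC subrK scale1r.
rewrite (le_trans (ler_enormD _ _))// !enormZ !ger0_norm ?subr_ge0//.
rewrite (le_trans (lerD (ler_wpM2l t0 yD) (ler_wpM2l _ wD)))// ?subr_ge0//.
by rewrite -mulrDl addrC subrK mul1r.
Qed.

Lemma conv_hull_sum A (m : nat) (l : 'I_m.+1 -> R) (x : 'I_m.+1 -> 'rV[R]_n) :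
  (forall i, 0 < l i) -> (forall i, A (x i)) -> \sum_i l i = 1 ->
  conv_hull A (\sum_i l i *: x i).
Proof.
(* normalised weights make the claim stable under dropping a point *)
move=> l0 Ax l1; rewrite -[X in conv_hull A X]scale1r -[X in X *: _]invr1 -l1 => {l1}.
elim: m l x l0 Ax => [|m IH] l x l0 Ax.
  by rewrite !big_ord1 scalerA mulVf ?gt_eqF// scale1r; exact: conv_hull_sub.
have IH' := IH (fun i => l (lift ord0 i)) (fun i => x (lift ord0 i))
  (fun i => l0 _) (fun i => Ax _).
rewrite 2!(big_ord_recl m.+1); set s := \sum_(i < m.+1) _ in IH' *.
set v := \sum_(i < m.+1) _ in IH' *.
have s0 : 0 < s.
  rewrite /s big_ord_recl ltr_pwDl//; apply: sumr_ge0 => i _; exact: ltW.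
have ls0 : 0 < l ord0 + s by rewrite addr_gt0.
rewrite (_ : _ *: _ = x ord0 + (s / (l ord0 + s)) *: (s^-1 *: v - x ord0)).
  apply: conv_hull_segment => //; first exact: conv_hull_sub.
  by apply/andP; split; [rewrite divr_ge0 ?ltW|rewrite ler_pdivrMr// mul1r lerDr ltW].
rewrite scalerBr scalerA mulrAC divff ?gt_eqF// mul1r addrCA.
rewrite scalerDr scalerA [LHS]addrC; congr (_ + _).
rewrite -[X in X - _]scale1r -scalerBl; congr (_ *: _).
by field; rewrite gt_eqF.
Qed.

End convex_hull.

Section sup_image.
Context {R : realType} {T : Type}.
Variables (A : set T) (f : T -> R) (a0 : T) (K : R).
Hypotheses (Aa0 : A a0) (fK : forall a, A a -> f a <= K).

Lemma sup_image_ub a : A a -> f a <= sup [set f a | a in A].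
Proof.
move=> Aa; apply: sup_ubound; last by exists a.
by exists K => _ [b Ab <-]; exact: fK.
Qed.

Lemma sup_image_le c : (forall a, A a -> f a <= c) -> sup [set f a | a in A] <= c.
Proof.
move=> fc; apply: sup_le_ub; first by exists (f a0), a0.
by move=> _ [b Ab <-]; exact: fc.
Qed.

Lemma sup_image_adherent e : 0 < e ->
  exists2 a, A a & sup [set f a | a in A] - e < f a.
Proof.
move=> e0; have [|_ [a Aa <-] H] := @sup_adherent _ [set f a | a in A] e e0.
  split; first by exists (f a0), a0.
  by exists K => _ [b Ab <-]; exact: fK.
by exists a.
Qed.

End sup_image.

(** The least convex function on the whole space with the values [g] and the
    gradients [p] on [Z]. As a supremum of affine functions it is convex, and
    Lipschitz with the bound of [p], on the whole space. *)
Section tangent_extension.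
Context {R : realType} {n : nat}.
Variables (Z : set 'rV[R]_n) (g : 'rV[R]_n -> R) (p : 'rV[R]_n -> 'rV[R]_n).
Variables (z0 : 'rV[R]_n) (G : R).
Hypotheses (Zz0 : Z z0) (pG : forall z, Z z -> enorm (p z) <= G).
Hypothesis tangent : forall z w, Z z -> Z w -> g z + dot (p z) (w - z) <= g w.
Implicit Types z w v : 'rV[R]_n.

Definition tangent_sup w : R := sup [set g z + dot (p z) (w - z) | z in Z].

Let tangent_bound w z : Z z ->
  g z + dot (p z) (w - z) <= g z0 + G * enorm (w - z0).
Proof.
move=> Zz; rewrite (_ : w - z = (z0 - z) + (w - z0)); last first.
  by rewrite [RHS]addrC addrA subrK.
rewrite dotDr addrA lerD ?tangent// (le_trans (cauchy_schwarz _ _))//.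
by rewrite ler_wpM2r ?pG.
Qed.

Lemma tangent_sup_ub w z : Z z -> g z + dot (p z) (w - z) <= tangent_sup w.
Proof.
move=> Zz; apply: (sup_image_ub (f := fun z => g z + dot (p z) (w - z)) _ Zz).
by move=> a; exact: tangent_bound.
Qed.

Lemma tangent_sup_le w c :
  (forall z, Z z -> g z + dot (p z) (w - z) <= c) -> tangent_sup w <= c.
Proof. by move=> H; exact: (sup_image_le Zz0). Qed.

Lemma tangent_supE w : Z w -> tangent_sup w = g w.
Proof.
move=> Zw; apply/eqP; rewrite eq_le; apply/andP; split.
  by apply: tangent_sup_le => z Zz; exact: tangent.
have := tangent_sup_ub w Zw.
by rewrite subrr -(scale0r (0 : 'rV[R]_n)) dotZr mul0r addr0.
Qed.

Lemma tangent_sup_lipschitz z w :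
  `|tangent_sup z - tangent_sup w| <= G * enorm (z - w).
Proof.
have H a b : tangent_sup a <= tangent_sup b + G * enorm (a - b).
  apply: tangent_sup_le => y Zy.
  rewrite (_ : a - y = (b - y) + (a - b)); last by rewrite [RHS]addrC addrA subrK.
  rewrite dotDr addrA lerD ?tangent_sup_ub//.
  by rewrite (le_trans (cauchy_schwarz _ _))// ler_wpM2r ?pG.
by rewrite ler_distl H andbT lerBlDr (enormB z) H.
Qed.

Lemma tangent_sup_midpoint z v :
  2 * tangent_sup z <= tangent_sup (z + v) + tangent_sup (z - v).
Proof.
rewrite mulrC -ler_pdivlMr//; apply: tangent_sup_le => y Zy.
rewrite ler_pdivlMr//.
have := lerD (tangent_sup_ub (z + v) Zy) (tangent_sup_ub (z - v) Zy).
apply: le_trans; rewrite (addrAC z v) (addrAC z (- v)) !dotDr !dotNr; lra.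
Qed.

End tangent_extension.

(** * Integrals of second differences *)

Section second_difference_line.
Context {R : realType}.
Local Notation leb := (@lebesgue_measure R).
Implicit Types (f : R -> R).

Lemma is_derive_shift f (t r d : R) : is_derive (t + r) 1 (f : R -> R^o) d ->
  is_derive t 1 (fun s : R => f (s + r) : R^o) d.
Proof.
have E : (fun h : R => h^-1 *: (((fun s : R => f (s + r) : R^o)
      \o shift t) (h *: 1) - f (t + r))) =
    (fun h : R => h^-1 *: (((f : R -> R^o) \o shift (t + r)) (h *: 1)
      - f (t + r))).
  by apply/funext => h /=; rewrite addrA.
by move=> [df dd]; split; [rewrite /derivable E|rewrite -dd /derive E].
Qed.

Lemma lipschitz_continuous f (L : R) :
  (forall s t, `|f s - f t| <= L * `|s - t|) -> continuous f.
Proof.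
move=> fL x; apply/cvgrPdist_lt => e e0.
have L1 : 0 < `|L| + 1 by rewrite ltr_pwDr.
near=> y; rewrite (le_lt_trans (fL _ _))//.
rewrite (@le_lt_trans _ _ ((`|L| + 1) * `|x - y|))//.
  by rewrite ler_wpM2r// (le_trans (ler_norm _))// lerDl.
rewrite -ltr_pdivlMl//; near: y; apply: cvgr_dist_lt => //.
by rewrite mulr_gt0// invr_gt0.
Unshelve. all: by end_near. Qed.

(** The integrand is the derivative of the second difference of a primitive of
    [f], which is at most [2 L r^2] at both ends of the interval. *)
Lemma integral_second_difference_line f (L r a b : R) : 0 < r -> a < b ->
  (forall s t, `|f s - f t| <= L * `|s - t|) ->
  (\int[leb]_(t in `[a, b]) (f (t + r) + f (t - r) - 2 * f t)%:E
    <= (4 * L * r ^+ 2)%:E)%E.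
Proof.
move=> r0 ab fL; pose c := a - r - 1.
have cf := lipschitz_continuous fL.
pose P x := \int[leb]_(t in `[c, x]) f t.
have dP x : c < x -> is_derive x 1 (P : R -> R^o) (f x).
  move=> cx.
  have [||dx Px] := @continuous_FTC1_closed R f c x (x + 1) _ _ cx (cf x).
  - by rewrite ltrDl.
  - apply: continuous_compact_integrable; first exact: segment_compact.
    exact: continuous_subspaceT.
  - by split; rewrite -?Px ?derive1E.
pose Q t := P (t + r) + P (t + (- r)) - 2 * P t.
have dQ t : a <= t -> is_derive t 1 (Q : R -> R^o) (f (t + r) + f (t - r) - 2 * f t).
  move=> at_.
  have H1 : is_derive t 1 (fun s : R => P (s + r) : R^o) (f (t + r)).
    by apply: is_derive_shift; apply: dP; rewrite /c; lra.
  have H2 : is_derive t 1 (fun s : R => P (s + - r) : R^o) (f (t + - r)).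
    by apply: is_derive_shift; apply: dP; rewrite /c; lra.
  have H3 : is_derive t 1 (P : R -> R^o) (f t) by apply: dP; rewrite /c; lra.
  exact: (is_deriveB (is_deriveD H1 H2) (is_deriveZ 2 H3)).
have Qle x : a <= x -> `|Q x| <= 2 * L * r ^+ 2.
  move=> ax.
  have [||s /andP[s1 s2] Es] := @mean_value R P f x (x + r).
  - by rewrite ltrDl.
  - by move=> t /andP[xt _]; apply: dP; rewrite /c; lra.
  have [||u /andP[u1 u2] Eu] := @mean_value R P f (x - r) x.
  - by rewrite gtrDl oppr_lt0.
  - by move=> t /andP[xt _]; apply: dP; rewrite /c; lra.
  rewrite (_ : Q x = r * (f s - f u)); last first.
    move: Es Eu; rewrite /Q (_ : x + r - x = r); last by ring.
    by rewrite (_ : x - (x - r) = r); [lra|ring].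
  rewrite normrM gtr0_norm// (_ : 2 * L * r ^+ 2 = r * (L * (2 * r))); last by ring.
  rewrite (ler_wpM2l (ltW r0))// (le_trans (fL _ _))//.
  have L0 : 0 <= L.
    by have := fL 1 0; rewrite subr0 normr1 mulr1; apply: le_trans.
  by rewrite ler_wpM2l// ger0_norm; lra.
have cont_Q x : a <= x -> {for x, continuous Q}.
  move=> ax; apply/differentiable_continuous/derivable1_diffP.
  by have [] := dQ x ax.
rewrite (@continuous_FTC2 R _ Q)//.
- rewrite -EFinB lee_fin.
  have := Qle a (lexx _); have := Qle b (ltW ab); rewrite !ler_norml.
  by move=> /andP[_ P1] /andP[P2 _]; lra.
- apply: continuous_subspaceT; apply: (@lipschitz_continuous _ (4 * L)) => s t.
  rewrite (_ : _ - _ = (f (s + r) - f (t + r)) + (f (s - r) - f (t - r))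
    - 2 * (f s - f t)); last by ring.
  rewrite (le_trans (ler_normB _ _))// (le_trans (lerD (ler_normD _ _) (lexx _)))//.
  have := fL (s + r) (t + r); have := fL (s - r) (t - r); have := fL s t.
  rewrite (_ : s + r - (t + r) = s - t); last by ring.
  rewrite (_ : s - r - (t - r) = s - t); last by ring.
  by rewrite normrM ger0_norm//; lra.
- split.
  + by move=> t /[!in_itv]/= /andP[/ltW at_ _]; have [] := dQ t at_.
  + by apply: cvg_at_right_filter; exact: cont_Q.
  + by apply: cvg_at_left_filter; apply: cont_Q; exact: ltW.
- move=> t /[!in_itv]/= /andP[/ltW at_ _]; rewrite derive1E.
  by have [] := dQ t at_.
Qed.

End second_difference_line.

Section tonelli_bound.
Local Open Scope ereal_scope.
Context d1 d2 (T1 : measurableType d1) (T2 : measurableType d2) (R : realType).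
Variable m1 : {sigma_finite_measure set T1 -> \bar R}.
Variable m2 : {sigma_finite_measure set T2 -> \bar R}.
Variables (A : set T1) (B : set T2) (f : T1 * T2 -> \bar R) (K : R).
Hypotheses (mA : measurable A) (mB : measurable B) (mf : measurable_fun setT f).
Hypotheses (f0 : forall z, 0 <= f z).

Let fAB := f \_ (A `*` B).

Let mfAB : measurable_fun setT fAB.
Proof.
apply/(measurable_restrict _ _ measurableT); first exact: measurableX.
exact: measurable_funTS.
Qed.

Let fAB0 z : 0 <= fAB z.
Proof. by rewrite /fAB patchE; case: ifPn. Qed.

Lemma tonelli_bound1 : (forall x, A x -> \int[m2]_(y in B) f (x, y) <= K%:E) ->
  \int[m1 \x m2]_(z in A `*` B) f z <= K%:E * m1 A.
Proof.
move=> fK; rewrite integral_mkcond -/fAB fubini_tonelli1//.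
rewrite -integral_cst// [leRHS]integral_mkcond; apply: ge0_le_integral => //.
- by move=> x _; exact: integral_ge0.
- exact: measurable_fun_fubini_tonelli_F.
- by apply/(measurable_restrict _ _ measurableT).
- move=> x _; rewrite /fubini_F [leRHS]patchE; case: ifPn => [/set_mem Ax|xA].
    apply: le_trans (fK x Ax); rewrite [leRHS]integral_mkcond.
    rewrite le_eqVlt; apply/orP; left; apply/eqP/eq_integral => y _.
    rewrite /fAB !patchE; congr (if _ then _ else _).
    by rewrite in_setX /= mem_set.
  rewrite integral0_eq// => y _; rewrite /fAB patchE ifF//.
  by rewrite in_setX (negbTE xA).
Qed.

Lemma tonelli_bound2 : (forall y, B y -> \int[m1]_(x in A) f (x, y) <= K%:E) ->
  \int[m1 \x m2]_(z in A `*` B) f z <= K%:E * m2 B.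
Proof.
move=> fK; rewrite integral_mkcond -/fAB fubini_tonelli1// fubini_tonelli//.
rewrite -integral_cst// [leRHS]integral_mkcond; apply: ge0_le_integral => //.
- by move=> x _; exact: integral_ge0.
- exact: measurable_fun_fubini_tonelli_G.
- by apply/(measurable_restrict _ _ measurableT).
- move=> y _; rewrite [leRHS]patchE; case: ifPn => [/set_mem By|yB].
    apply: le_trans (fK y By); rewrite [leRHS]integral_mkcond.
    rewrite le_eqVlt; apply/orP; left; apply/eqP/eq_integral => x _.
    rewrite /fAB !patchE; congr (if _ then _ else _).
    by rewrite in_setX /= andbC mem_set.
  rewrite integral0_eq// => x _; rewrite /fAB patchE ifF//.
  by rewrite in_setX (negbTE yB) andbF.
Qed.

End tonelli_bound.

Section borel_row_vectors.
Context {R : realType} {n : nat}.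
Implicit Types (A : set 'rV[R]_n).

Lemma open_measurable_rV A : open A -> measurable A.
Proof. exact: sub_sigma_algebra. Qed.

Lemma closed_measurable_rV A : closed A -> measurable A.
Proof.
move=> cA; rewrite -[A]setCK; apply: measurableC; apply: open_measurable_rV.
exact: closed_openC.
Qed.

Lemma compact_closed_rV A : compact A -> closed A.
Proof. exact: (compact_closed (@norm_hausdorff _ _)). Qed.

Lemma compact_measurable_rV A : compact A -> measurable A.
Proof. by move=> /compact_closed_rV/closed_measurable_rV. Qed.

Lemma continuous_measurable_rV (f : 'rV[R]_n -> R) : continuous f ->
  measurable_fun setT (f : _ -> measurableTypeR R).
Proof.
move=> cf; apply: (measurability _ (RGenOpens.measurableE R)).
move=> _ [_ [a [b ->]] <-]; rewrite setTI; apply: sub_sigma_algebra.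
by apply: open_comp; [move=> x _; exact: cf|exact: interval_open].
Qed.

Lemma measurable_shift_rV (v : 'rV[R]_n) :
  measurable_fun setT (fun x : 'rV[R]_n => x + v).
Proof.
apply: Defs.measurable_funM => i j; under eq_fun do rewrite mxE.
by apply: measurable_funD; [exact: measurable_coord|exact: measurable_cst].
Qed.

End borel_row_vectors.

Section second_difference_cube.
Context {R : realType}.
Local Notation leb := (@lebesgue_measure R).

Definition cube n (a : 'rV[R]_n) (s : R) : set 'rV[R]_n :=
  [set x | forall i, x 0 i \in `[a 0 i, a 0 i + s]].

Lemma measurable_cube n (a : 'rV[R]_n) s : measurable (cube a s).
Proof.
rewrite (_ : cube a s = \bigcap_(i : 'I_n) ((fun x : 'rV[R]_n => x 0 i) @^-1`
    `[a 0 i, a 0 i + s])); last first.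
  by apply/seteqP; split => x Bx i => [_|]; exact: Bx.
apply: fin_bigcap_measurable => [|i _]; first exact: finite_finset.
by rewrite -[X in measurable X]setTI; exact: measurable_coord.
Qed.

Lemma lebesgue_cube n (a : 'rV[R]_n) s : 0 <= s ->
  lebesgue_rV n (cube a s) = (s ^+ n)%:E.
Proof.
move=> s0.
rewrite (_ : cube a s = [set x | forall i, x 0 i \in `[a 0 i, (a + const_mx s) 0 i]]).
  rewrite lebesgue_rV_box => [|i]; last by rewrite !mxE lerDl.
  congr EFin; rewrite -[in RHS](card_ord n) -prodr_const; apply: eq_bigr => i _.
  by rewrite !mxE addrAC subrr add0r.
by apply/seteqP; split => x xs i; have := xs i; rewrite !mxE.
Qed.

Definition second_diff n (f : 'rV[R]_n -> R) v x := f (x + v) + f (x - v) - 2 * f x.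

Lemma measurable_second_diff n (f : 'rV[R]_n -> R) v :
  measurable_fun setT f -> measurable_fun setT (second_diff f v).
Proof.
move=> mf; apply: measurable_funB; last exact: measurable_funM.
by apply: measurable_funD; apply: (measurableT_comp mf);
  exact: measurable_shift_rV.
Qed.

Lemma consrV_axis n (v : 'rV[R]_n) (t s : R) :
  consrV (v, t) + s *: delta_mx 0 ord0 = consrV (v, t + s).
Proof.
apply/rowP => i; rewrite !mxE /fcons; case: unliftP => [k ->|->] /=.
  by rewrite ?eqxx /= mulr0 addr0.
by rewrite ?eqxx /= mulr1.
Qed.

Lemma consrV_axis_lift n (v : 'rV[R]_n) (t s : R) k :
  consrV (v, t) + s *: delta_mx 0 (lift ord0 k) = consrV (v + s *: delta_mx 0 k, t).
Proof.
apply/rowP => i; rewrite !mxE /fcons; case: unliftP => [j ->|->] /=.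
  by rewrite !mxE ?eqxx /= (inj_eq lift_inj).
by rewrite ?eqxx /= mulr0 addr0.
Qed.

(** By Tonelli's theorem only the integral along the [j]-th axis matters. *)
Lemma integral_second_difference n (j : 'I_n) (f : 'rV[R]_n -> R) L r a s :
  0 < r -> 0 < s -> measurable_fun setT f ->
  (forall x t, `|f (x + t *: delta_mx 0 j) - f x| <= L * `|t|) ->
  (forall x, 0 <= second_diff f (r *: delta_mx 0 j) x) ->
  (\int[lebesgue_rV n]_(x in cube a s) (second_diff f (r *: delta_mx 0 j) x)%:E
   <= (4 * L * r ^+ 2 * s ^+ n.-1)%:E)%E.
Proof.
move=> r0 s0.
elim: n j f a => [[]//|n IH] j f a mf fL f0.
have mD := measurable_second_diff (r *: delta_mx 0 j) mf.
pose a' : 'rV[R]_n := (unconsrV a).1.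
have /= push := @ge0_integral_pushforward _ _ _ _ R (@consrV R n)
  (@measurable_consrV R n) (lebesgue_rV n \x leb)%E (cube a s)
  (EFin \o second_diff f (r *: delta_mx 0 j)).
rewrite [leLHS]push; last 3 first.
- exact: measurable_cube.
- by apply/measurable_EFinP; exact: measurable_funTS.
- by move=> x _; rewrite lee_fin.
rewrite (_ : _ @^-1` _ = cube a' s `*` `[a 0 ord0, a 0 ord0 + s]); last first.
  apply/seteqP; split => [[v t] /= H|[v t] /= [Bv ti] i].
    split => [i|]; last by have := H ord0; rewrite mxE /fcons unlift_none.
    by have := H (lift ord0 i); rewrite !mxE /fcons liftK.
  rewrite mxE /fcons; case: unliftP => [k ->|->] //=.
  by have := Bv k; rewrite !mxE.
pose Dc := EFin \o second_diff f (r *: delta_mx 0 j) \o @consrV R n.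
have mDc : measurable_fun setT Dc.
  apply: measurableT_comp; last exact: measurable_consrV.
  exact/measurable_EFinP.
have Dc0 z : (0 <= Dc z)%E by rewrite lee_fin.
rewrite {}/Dc in mDc Dc0.
case: (unliftP ord0 j) => [k jE|jE]; rewrite {}jE in fL f0 mD mDc Dc0 *.
- apply: le_trans.
    apply: (@tonelli_bound2 _ _ _ _ _ _ _ _ _ _ (4 * L * r ^+ 2 * s ^+ n.-1)) => //.
      exact: measurable_cube.
    move=> t _ /=.
    have E x : second_diff f (r *: delta_mx 0 (lift ord0 k)) (consrV (x, t)) =
        second_diff (fun v => f (consrV (v, t))) (r *: delta_mx 0 k) x.
      by rewrite /second_diff -!scaleNr !consrV_axis_lift.
    under eq_integral do rewrite E.
    apply: IH => [|x u|x].
    + apply: (measurableT_comp mf); apply: (measurableT_comp (@measurable_consrV R n)).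
      exact: measurable_pair2.
    + by rewrite -consrV_axis_lift.
    + by rewrite -E.
  have mI : leb `[a 0 ord0, a 0 ord0 + s] = s%:E.
    by rewrite lebesgue_measure_itv/= lte_fin ltrDl s0 -EFinB addrAC subrr add0r.
  rewrite [X in (_ * X <= _)%E](_ : _ = s%:E)//.
  rewrite -EFinM lee_fin -[X in X <= _]mulrA -exprSr prednK//.
  exact: leq_ltn_trans (leq0n k) (ltn_ord k).
- apply: le_trans.
    apply: (@tonelli_bound1 _ _ _ _ _ _ _ _ _ _ (4 * L * r ^+ 2)) => //.
      exact: measurable_cube.
    move=> v _ /=.
    have E t : second_diff f (r *: delta_mx 0 ord0) (consrV (v, t)) =
        f (consrV (v, t + r)) + f (consrV (v, t - r)) - 2 * f (consrV (v, t)).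
      by rewrite /second_diff -!scaleNr !consrV_axis.
    under eq_integral do rewrite E.
    apply: (@integral_second_difference_line R (fun t => f (consrV (v, t)))) => //.
      by rewrite ltrDl.
    move=> t u; have := fL (consrV (v, u)) (t - u).
    by rewrite consrV_axis (addrC u) subrK.
  by rewrite (lebesgue_cube _ (ltW s0)).
Qed.

End second_difference_cube.

Section bounded_density.
Context {R : realType} {n : nat}.
Variables (rho : probability 'rV[R]_n R) (M : R).
Hypothesis rho_leb : rho `<< lebesgue_rV n.
Hypothesis rhoM : 'N[lebesgue_rV n]_+oo[density rho]%E = M%:E.

Lemma density_le : \forall x \ae (lebesgue_rV n), (density rho x <= M%:E)%E.
Proof.
have leb0 : (0 < lebesgue_rV n [set: 'rV[R]_n])%E.
  rewrite lt0e measure_ge0 andbT; apply/eqP => leb0.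
  move/null_content_dominatesP : rho_leb => /(_ _ measurableT leb0).
  by rewrite probability_setT => /eqP; rewrite onee_eq0.
have := rhoM; rewrite unlock leb0 => H.
have /ess_supP : (ess_sup (lebesgue_rV n) (abse \o density rho) <= M%:E)%E by rewrite H.
by apply: filterS => x; apply: le_trans; exact: lee_abs.
Qed.

(** Radon-Nikodym; the essential supremum bounds the density almost everywhere. *)
Lemma integral_bounded_density (E : set 'rV[R]_n) (f : 'rV[R]_n -> \bar R) :
  measurable E -> measurable_fun E f -> (forall x, 0 <= f x)%E ->
  (\int[rho]_(x in E) f x <= M%:E * \int[lebesgue_rV n]_(x in E) f x)%E.
Proof.
move=> mE mf f0.
have M0 : (0 <= M)%R by rewrite -lee_fin -rhoM Lnorm_ge0.
have d0 := Radon_Nikodym_SigmaFinite.f_ge0 rho_leb.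
have md : measurable_fun E (density rho).
  apply: measurable_funTS; apply: measurable_int.
  exact: Radon_Nikodym_SigmaFinite.f_integrable.
rewrite -(Radon_Nikodym_SigmaFinite.change_of_variables rho_leb f0 mE mf).
rewrite -ge0_integralZl//.
apply: ae_ge0_le_integral => //.
- by move=> x _; rewrite mule_ge0.
- exact: emeasurable_funM.
- by move=> x _; rewrite mule_ge0.
- by apply: emeasurable_funM => //; exact: measurable_cst.
- apply: filterS density_le => x dM _.
  by rewrite muleC lee_wpmul2r.
Qed.

Lemma integral_second_difference_density (S : set 'rV[R]_n) (j : 'I_n)
    (f : 'rV[R]_n -> R) L r a s :
  measurable S -> S `<=` cube a s -> 0 < r -> 0 < s -> measurable_fun setT f ->
  (forall x t, `|f (x + t *: delta_mx 0 j) - f x| <= L * `|t|) ->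
  (forall x, 0 <= second_diff f (r *: delta_mx 0 j) x) ->
  (\int[rho]_(x in S) (second_diff f (r *: delta_mx 0 j) x)%:E
   <= (M * (4 * L * s ^+ n.-1) * r ^+ 2)%:E)%E.
Proof.
move=> mS Sa r0 s0 mf fL f0.
have mD : measurable_fun setT (EFin \o second_diff f (r *: delta_mx 0 j)).
  by apply/measurable_EFinP; exact: measurable_second_diff.
have M0 : 0 <= M by rewrite -lee_fin -rhoM Lnorm_ge0.
pose Df := EFin \o second_diff f (r *: delta_mx 0 j).
have D0 x : (0 <= Df x)%E by rewrite lee_fin.
apply: le_trans (integral_bounded_density mS (measurable_funTS mD) D0) _.
rewrite -mulrA EFinM lee_wpmul2l// mulrAC.
apply: le_trans (integral_second_difference a r0 s0 mf fL f0).
apply: ge0_subset_integral => //; first exact: measurable_cube.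
exact: measurable_funTS.
Qed.

End bounded_density.

(** * Means of bounded functions *)

Section bounded_measurable.
Context d {T : measurableType d} {R : realType}.
Variable P : probability T R.
Implicit Types (D : set T) (f g : T -> R).

Definition bounded_measurable D f :=
  measurable_fun D f /\ exists K, forall x, D x -> `|f x| <= K.

Lemma bounded_measurable_integrable D f : measurable D ->
  bounded_measurable D f -> P.-integrable D (EFin \o f).
Proof.
move=> mD [mf [K fK]]; apply: measurable_bounded_integrable => //.
  by rewrite (le_lt_trans (probability_le1 P mD))// ltry.
exists K; split; first exact: num_real.
by move=> x Kx y Dy /=; rewrite (le_trans (fK y Dy))// ltW.
Qed.

Lemma bounded_measurable_cst D (r : R) : bounded_measurable D (fun=> r).
Proof. by split; [exact: measurable_cst|exists `|r|]. Qed.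

Lemma bounded_measurableD D f g : bounded_measurable D f -> bounded_measurable D g ->
  bounded_measurable D (fun x => f x + g x).
Proof.
move=> [mf [K fK]] [mg [L gL]]; split; first exact: measurable_funD.
by exists (K + L) => x Dx; rewrite (le_trans (ler_normD _ _))// lerD ?fK ?gL.
Qed.

Lemma bounded_measurableZ D f (r : R) : bounded_measurable D f ->
  bounded_measurable D (fun x => r * f x).
Proof.
move=> [mf [K fK]]; split; first exact: measurable_funM.
by exists (`|r| * K) => x Dx; rewrite normrM ler_wpM2l ?fK.
Qed.

Lemma bounded_measurableN D f : bounded_measurable D f ->
  bounded_measurable D (fun x => - f x).
Proof.
move=> /(bounded_measurableZ (-1)); congr bounded_measurable.
by apply/funext => x; rewrite mulN1r.
Qed.

Lemma bounded_measurableB D f g : bounded_measurable D f -> bounded_measurable D g ->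
  bounded_measurable D (fun x => f x - g x).
Proof. by move=> bf bg; apply: bounded_measurableD => //; exact: bounded_measurableN. Qed.

Lemma bounded_measurable_sum D m (f : 'I_m -> T -> R) :
  (forall i, bounded_measurable D (f i)) ->
  bounded_measurable D (fun x => \sum_i f i x).
Proof.
move=> bf; elim: m f bf => [|m IH] f bf.
  rewrite (_ : (fun _ => _) = fun=> 0); first exact: bounded_measurable_cst.
  by apply/funext => x; rewrite big_ord0.
rewrite (_ : (fun _ => _) =
  (fun x => f ord0 x + (fun x => \sum_i f (lift ord0 i) x) x)); last first.
  by apply/funext => x; rewrite big_ord_recl.
by apply: bounded_measurableD => //; exact: IH.
Qed.

Section integral.
Variable D : set T.
Hypotheses (mD : measurable D) (PD : P D = 1%E).

Lemma mean_cst (r : R) : \int[P]_(x in D) r = r.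
Proof.
have E : fine (P D) = 1 by rewrite PD.
by rewrite Rintegral_cst// -[RHS]mulr1 -E.
Qed.

Lemma meanD f g : bounded_measurable D f -> bounded_measurable D g ->
  \int[P]_(x in D) (f x + g x) = \int[P]_(x in D) f x + \int[P]_(x in D) g x.
Proof. by move=> *; rewrite RintegralD//; exact: bounded_measurable_integrable. Qed.

Lemma meanB f g : bounded_measurable D f -> bounded_measurable D g ->
  \int[P]_(x in D) (f x - g x) = \int[P]_(x in D) f x - \int[P]_(x in D) g x.
Proof. by move=> *; rewrite RintegralB//; exact: bounded_measurable_integrable. Qed.

Lemma meanZ f r : bounded_measurable D f ->
  \int[P]_(x in D) (r * f x) = r * \int[P]_(x in D) f x.
Proof. by move=> *; rewrite RintegralZl//; exact: bounded_measurable_integrable. Qed.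

Lemma le_mean f g : bounded_measurable D f -> bounded_measurable D g ->
  (forall x, D x -> f x <= g x) ->
  \int[P]_(x in D) f x <= \int[P]_(x in D) g x.
Proof.
by move=> *; apply: le_Rintegral => //; exact: bounded_measurable_integrable.
Qed.

Lemma mean_sum m (f : 'I_m -> T -> R) : (forall i, bounded_measurable D (f i)) ->
  \int[P]_(x in D) (\sum_i f i x) = \sum_i \int[P]_(x in D) f i x.
Proof.
move=> bf; elim: m f bf => [|m IH] f bf.
  rewrite big_ord0; under eq_Rintegral do rewrite big_ord0.
  exact: mean_cst.
rewrite big_ord_recl -IH// -meanD//; last exact: bounded_measurable_sum.
by apply: eq_Rintegral => x _; rewrite big_ord_recl.
Qed.

Lemma mean_EFin f : bounded_measurable D f ->
  (\int[P]_(x in D) (f x)%:E = (\int[P]_(x in D) f x)%:E)%E.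
Proof.
move=> bf; rewrite fineK//; apply: integrable_fin_num => //.
exact: bounded_measurable_integrable.
Qed.

Lemma mean_bounded_convergence (f_ : nat -> T -> R) f N K :
  (forall k, measurable_fun D (f_ k)) -> measurable_fun D f ->
  (forall k x, D x -> `|f_ k x| <= K) -> P N = 0%E -> measurable N ->
  (forall x, D x -> ~ N x -> f_ k x @[k --> \oo] --> f x) ->
  \int[P]_(x in D) f_ k x @[k --> \oo] --> \int[P]_(x in D) f x.
Proof.
move=> mf_ mf fK N0 mN fcvg.
have [|||||intf _ H] := @dominated_convergence _ _ _ P D mD
    (fun k => EFin \o f_ k) (EFin \o f) (cst K%:E).
- by move=> k; exact/measurable_EFinP.
- exact/measurable_EFinP.
- exists N; split => // x /= /not_implyP[Dx nf]; apply: contrapT => Nx; apply: nf.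
  by apply: cvg_EFin; [exact: nearW|exact: fcvg].
- exact: (bounded_measurable_integrable mD (bounded_measurable_cst D K)).
- by apply: aeW => x k Dx; rewrite lee_fin fK.
by apply: fine_cvg; rewrite fineK; [exact: H|exact: integrable_fin_num].
Qed.

End integral.
End bounded_measurable.

Section compact_domains.
Context {R : realType} {n : nat}.
Implicit Types (A : set 'rV[R]_n) (f : 'rV[R]_n -> R).

Lemma continuous_bounded_measurable A f : compact A -> continuous f ->
  bounded_measurable A f.
Proof.
move=> cA cf; split.
  by apply: measurable_funTS; exact: continuous_measurable_rV.
have /compact_bounded[K [_ HK]] : compact (f @` A).
  by apply: continuous_compact => //; exact: continuous_subspaceT.
exists (K + 1) => x Ax; apply: (HK (K + 1)); first by rewrite ltrDl.
by exists x.
Qed.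

Lemma enorm_lipschitz_continuous f (L : R) :
  (forall x y, `|f x - f y| <= L * enorm (x - y)) -> continuous f.
Proof.
move=> fL x; apply/continuous_enormP => e e0.
have L1 : 0 < `|L| + 1 by rewrite ltr_pwDr.
exists (e / (`|L| + 1)) => [|y]; first by rewrite divr_gt0.
rewrite ltr_pdivlMr// mulrC; apply: le_lt_trans.
by rewrite (le_trans (fL _ _))// ler_wpM2r// (le_trans (ler_norm _))// lerDl.
Qed.

Lemma compact_net A (e : R) : compact A -> 0 < e ->
  exists s : seq 'rV[R]_n, forall x, A x -> exists2 y, y \in s & enorm (x - y) < e.
Proof.
rewrite compact_cover => cA e0.
pose B (y : 'rV[R]_n) : set 'rV[R]_n := [set x | enorm (x - y) < e].
have oB y : open (B y).
  have cont : continuous (fun x : 'rV[R]_n => enorm (x - y)).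
    apply: (@enorm_lipschitz_continuous _ 1) => x z; rewrite mul1r.
    rewrite (le_trans (ler_dist_enorm _ _))// opprB addrA subrK.
    exact: lexx.
  rewrite (_ : B y = (fun x : 'rV[R]_n => enorm (x - y)) @^-1` [set t | t < e])//.
  by apply: open_comp => [x _|]; [exact: cont|exact: open_lt].
have [|D' _ cov] := cA 'rV[R]_n setT B (fun y _ => oB y).
  by move=> x _; exists x => //; rewrite /B /= subrr enorm0.
exists (finmap.enum_fset D') => x /cov[y /= yD yx]; exists y => //.
Qed.

End compact_domains.

Lemma ultrafilter_cvg {R : realType} (F : set_system nat) (a : nat -> R) (B : R) :
  UltraFilter F -> (forall k, `|a k| <= B) -> exists r : R, a k @[k --> F] --> r.
Proof.
move=> UF aB; have PF := @ultra_proper _ _ UF.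
have [|r [_ clr]] := @segment_compact R (- B) B (a @ F) _.
  by apply: (@filterE _ F) => k; rewrite /= in_itv /= -ler_norml.
exists r => N Nr; have [//|FN] := in_ultra_setVsetC (a @^-1` N) UF.
have [t [Nt]] := clr (~` N) N FN Nr.
by [].
Qed.

(** Bounded Lipschitz functions separate probability measures: the indicator
    of an open set is the increasing limit of [min 1 (k d)], where [d] is the
    distance to its complement. *)
Section lipschitz_separation.
Context {R : realType} {n : nat}.
Implicit Types (W : set 'rV[R]_n) (x y : 'rV[R]_n).

Definition distance_to (C : set 'rV[R]_n) x := inf [set enorm (x - a) | a in C].

Section distance.
Variables (C : set 'rV[R]_n) (c0 : 'rV[R]_n).
Hypothesis Cc0 : C c0.

Let hinf x : has_inf [set enorm (x - a) | a in C].
Proof.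
split; first by exists (enorm (x - c0)), c0.
by exists 0 => _ [a _ <-].
Qed.

Lemma distance_to_ge0 x : 0 <= distance_to C x.
Proof.
apply: lb_le_inf; first by case: (hinf x).
by move=> _ [a _ <-].
Qed.

Lemma distance_to_lipschitz x y :
  `|distance_to C x - distance_to C y| <= enorm (x - y).
Proof.
have H a b : distance_to C a <= distance_to C b + enorm (a - b).
  rewrite -lerBlDr; apply: lb_le_inf; first by case: (hinf b).
  move=> _ [z Cz <-]; rewrite lerBlDr addrC (le_trans _ (ler_enormB _ _ _))//.
  by apply: ge_inf; [case: (hinf a)|exists z].
by rewrite ler_distl H andbT lerBlDr enormB H.
Qed.

Lemma distance_to_eq0 x : C x -> distance_to C x = 0.
Proof.
move=> Cx; apply/eqP; rewrite eq_le distance_to_ge0 andbT.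
by apply: ge_inf; [case: (hinf x)|exists x; rewrite ?subrr ?enorm0].
Qed.

Lemma distance_to_gt0 x : closed C -> ~ C x -> 0 < distance_to C x.
Proof.
move=> cC nCx; have /nbhs_enormP[d d0 dP] : nbhs x (~` C).
  by apply: open_nbhs_nbhs; split => //; exact: closed_openC.
apply: lt_le_trans d0 _; apply: lb_le_inf; first by case: (hinf x).
move=> _ [a Ca <-]; rewrite leNgt; apply/negP; rewrite enormB => /dP.
by [].
Qed.

End distance.

Lemma probability_eq_lipschitz (P Q : probability 'rV[R]_n R) :
  (forall (v : 'rV[R]_n -> R) k, 0 <= k ->
    (forall x y, `|v x - v y| <= k * enorm (x - y)) ->
    (forall x, 0 <= v x <= 1) -> \int[P]_x v x = \int[Q]_x v x) ->
  forall A, measurable A -> P A = Q A.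
Proof.
move=> PQ.
have PQopen W : open W -> P W = Q W.
  move=> oO; have [compl0|/set0P[c0 cO]] := eqVneq (~` W) set0.
    by rewrite (_ : W = setT) ?probability_setT// -[W]setCK compl0 setC0.
  pose d := distance_to (~` W).
  pose v k x := Num.min 1 (k%:R * d x).
  have d0 x : 0 <= d x by exact: (distance_to_ge0 cO).
  have v01 k x : 0 <= v k x <= 1.
    by rewrite /v le_min ler01 mulr_ge0//= ge_min lexx.
  have vlip k x y : `|v k x - v k y| <= k%:R * enorm (x - y).
    have H a b : v k a <= v k b + k%:R * enorm (a - b).
      rewrite /v addr_minl le_min !ge_min; apply/andP; split; apply/orP.
        by left; rewrite lerDl mulr_ge0.
      right; rewrite -mulrDr ler_wpM2l// -lerBlDl (le_trans (ler_norm _))//.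
      exact: (distance_to_lipschitz cO).
    by rewrite ler_distl H andbT lerBlDr enormB H.
  have mv k : measurable_fun setT (v k).
    by apply: continuous_measurable_rV; exact: enorm_lipschitz_continuous (vlip k).
  have mO : measurable W := open_measurable_rV oO.
  have lim (T : probability 'rV[R]_n R) :
      \int[T]_x v k x @[k --> \oo] --> fine (T W).
    rewrite (_ : fine (T W) = \int[T]_x \1_W x); last first.
      by rewrite /Rintegral integral_indic// setIT.
    apply: (@mean_bounded_convergence _ _ _ T setT measurableT v (\1_W) set0 1) => //.
    - by move=> k x _; have /andP[v0 v1] := v01 k x; rewrite ger0_norm.
    - move=> x _ _; rewrite indicE; case: (pselect (W x)) => Ox.
        rewrite mem_set//; apply: cvg_near_cst.
        have dx : 0 < d x.
          apply: (distance_to_gt0 cO); first exact: open_closedC.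
          by move=> /(_ Ox).
        near=> k; rewrite /v min_l// -ler_pdivrMr// div1r.
        by near: k; exact: nbhs_infty_ger.
      rewrite memNset//; apply: cvg_near_cst; apply: nearW => k.
      by rewrite /v /d (distance_to_eq0 cO)// mulr0 min_r.
  have PQv k : \int[P]_x v k x = \int[Q]_x v k x by apply: (PQ _ k%:R).
  have limP := lim P; have limQ := lim Q.
  rewrite -(fineK (fin_num_measure P W mO)) -(fineK (fin_num_measure Q W mO)).
  congr EFin; apply: (cvg_unique (@Rhausdorff R) limP).
  by move: limQ; under eq_fun do rewrite -PQv.
move=> A mA; apply: (@measure_unique _ _ _ (@open 'rV[R]_n) (fun=> setT)) => //.
- by move=> U V oU oV; exact: openI.
- by move=> ?; exact: openT.
- by rewrite bigcup_const//; exists 0%N.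
- by move=> k; exact: le_lt_trans (probability_le1 P measurableT) (ltry _).
Unshelve. all: by end_near. Qed.

End lipschitz_separation.

Section full_measure.
Context d {T : measurableType d} {R : realType}.
Variables (P : probability T R) (D : set T).
Hypotheses (mD : measurable D) (PD : P D = 1%E).

Lemma full_measureC : P (~` D) = 0%E.
Proof. by rewrite probability_setC// PD subee. Qed.

Lemma full_measureI A : measurable A -> P (D `&` A) = P A.
Proof.
move=> mA; rewrite -[in RHS](setIT A) -(setUv D) setIUr measureU.
- rewrite [X in (_ + X)%E](_ : _ = 0%E) ?adde0 1?setIC//.
  apply: subset_measure0 full_measureC; last by move=> x [].
    by apply: measurableI => //; exact: measurableC.
  exact: measurableC.
- exact: measurableI.
- by apply: measurableI => //; exact: measurableC.
- by rewrite setIACA setICr setI0.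
Qed.

Lemma mean_negligible N f : measurable N -> P N = 0%E -> bounded_measurable D f ->
  \int[P]_(x in D) f x = \int[P]_(x in D `\` N) f x.
Proof.
move=> mN N0 bf; rewrite /Rintegral (@negligible_integral _ _ _ P D N)//.
exact: bounded_measurable_integrable.
Qed.

End full_measure.

Section transported_mean.
Context d {X : measurableType d} {R : realType} {n : nat}.
Implicit Types (S : set X) (Y : set 'rV[R]_n) (T : X -> 'rV[R]_n).
Implicit Types (v : 'rV[R]_n -> R).

Lemma measurable_fun_rV S T : measurable S ->
  (forall j, measurable_fun S (fun x => T x 0 j)) -> measurable_fun S T.
Proof.
move=> mS mT; pose g x : 'rV[R]_n := \row_j ((fun x => T x 0 j) \_ S) x.
apply: (@eq_measurable_fun _ _ _ _ S g).
  by move=> x xS; apply/rowP => j; rewrite mxE patchE xS.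
apply: measurable_funTS; apply: Defs.measurable_funM => i j.
under eq_fun do rewrite mxE; apply/(measurable_restrictT _ mS); exact: mT.
Qed.

Lemma measurable_enormB S T T' : measurable S -> measurable_fun S T ->
  measurable_fun S T' -> measurable_fun S (fun x => enorm (T x - T' x)).
Proof.
move=> mS mT mT'.
have ce : continuous (@enorm R n).
  apply: (@enorm_lipschitz_continuous _ _ _ 1) => x y.
  by rewrite mul1r ler_dist_enorm.
apply: (measurableT_comp (continuous_measurable_rV ce)).
apply: measurable_fun_rV => // j.
rewrite (_ : (fun x => _) = (fun x => T x 0 j - T' x 0 j)); last first.
  by apply/funext => x; rewrite !mxE.
by apply: measurable_funB; apply: (measurableT_comp (measurable_coord 0 j)).
Qed.

Lemma mean_setT (P : probability X R) S (f : X -> R) : measurable S -> P S = 1%E ->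
  bounded_measurable setT f -> \int[P]_x f x = \int[P]_(x in S) f x.
Proof.
move=> mS PS bv; rewrite (@mean_negligible _ _ _ P setT _ (~` S))//.
- by rewrite setTD setCK.
- exact: measurableC.
- exact: full_measureC.
Qed.

Lemma mean_transport (rho : probability X R) (mu : probability 'rV[R]_n R) S Y T y0 v :
  measurable S -> measurable Y -> Y y0 -> rho S = 1%E -> measurable_fun S T ->
  (forall x, S x -> Y (T x)) ->
  (forall A, measurable A -> rho (S `&` T @^-1` A) = mu A) ->
  continuous v -> (exists K, forall y, Y y -> `|v y| <= K) ->
  \int[rho]_(x in S) v (T x) = \int[mu]_(y in Y) v y.
Proof.
move=> mS mY Yy0 rhoS mT TY Tmu cv [K vK].
pose T' x := if x \in S then T x else y0.
have mT' : measurable_fun setT T'.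
  rewrite -(setUv S); apply/measurable_funU => //; first exact: measurableC.
  split; first by apply: eq_measurable_fun mT => x xS; rewrite /T' xS.
  apply: (eq_measurable_fun (fun=> y0)); last exact: measurable_cst.
  by move=> x; rewrite inE => nSx; rewrite /T' memNset.
have T'Y x : Y (T' x).
  by rewrite /T'; case: ifPn => // /set_mem; exact: TY.
have mv : measurable_fun setT v by exact: continuous_measurable_rV.
have bvT : bounded_measurable setT (v \o T').
  by split; [exact: measurableT_comp|exists K => x _; exact: vK].
have T'mu A : measurable A -> rho (T' @^-1` A) = mu A.
  move=> mA; rewrite -Tmu// -(@full_measureI _ _ _ rho S)//; last first.
    by rewrite -[X in measurable X]setTI; exact: mT'.
  congr (rho _); apply/seteqP; split => x [Sx] /=; rewrite /T' mem_set//.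
transitivity (\int[rho]_x v (T' x)).
  rewrite (@mean_setT rho S (v \o T'))//.
  by apply: eq_Rintegral => x xS; rewrite /= /T' xS.
rewrite /Rintegral; congr fine.
have -> : (\int[mu]_(y in Y) (v y)%:E = \int[pushforward rho T']_(y in Y) (v y)%:E)%E.
  apply: eq_measure_integral => A mA AY.
  by apply/esym; exact: T'mu.
rewrite integral_pushforward//.
- by congr integral; apply/seteqP; split => x _ //=; exact: T'Y.
- by apply/measurable_EFinP.
- apply: (@integrableS _ _ _ rho setT) => //.
    by rewrite -[X in measurable X]setTI; exact: mT'.
  exact: bounded_measurable_integrable.
Qed.

End transported_mean.

(** * Potentials and their conjugates *)

Section potentials.
Context {R : realType} {n m : nat}.
Variables (c : 'rV[R]_n -> R) (l0 : R) (l : 'I_m -> R) (Y : set 'rV[R]_n).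
Variables (y0 : 'rV[R]_n) (G D : R).
Hypotheses (Yy0 : Y y0) (l0_gt0 : 0 < l0) (l_gt0 : forall i, 0 < l i).
Hypothesis cG : forall z w, `|c z - c w| <= G * enorm (z - w).
Hypothesis G0 : 0 <= G.
Hypothesis YD : forall y y', Y y -> Y y' -> enorm (y - y') <= D.
Implicit Types (x v : 'rV[R]_n) (y : 'I_m -> 'rV[R]_n).
Implicit Types (u : 'I_m -> 'rV[R]_n -> R).

Definition average x y := l0 *: x + \sum_i l i *: y i.

Definition tuples : set ('I_m -> 'rV[R]_n) := [set y | forall i, Y (y i)].

Definition value u x y := c (average x y) - \sum_i u i (y i).

(** The [c]-conjugate of the family [u]: the least potential for the first
    marginal that is admissible together with [u] in the dual problem. *)
Definition conjugate u x := sup [set value u x y | y in tuples].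

Definition gap u x y := conjugate u x - value u x y.

Definition bounded_potentials u := exists K, forall i (b : 'rV[R]_n), Y b -> `|u i b| <= K.

Lemma averageD x v y : average (x + v) y = average x y + l0 *: v.
Proof. by rewrite /average scalerDr addrAC. Qed.

Lemma averageB x y y' :
  average x y - average x y' = \sum_i l i *: (y i - y' i).
Proof.
rewrite /average opprD addrACA subrr add0r -sumrB.
by apply: eq_bigr => i _; rewrite scalerBr.
Qed.

Lemma tuples_cst : tuples (fun=> y0).
Proof. by []. Qed.

Section bounded.
Variable u : 'I_m -> 'rV[R]_n -> R.
Hypothesis bu : bounded_potentials u.

Lemma value_bounded x : exists K, forall y, tuples y -> `|value u x y| <= K.
Proof.
have [K uK] := bu.
exists (`|c (l0 *: x)| + G * \sum_i l i * (D + enorm y0) + \sum_(i < m) K) => y Ay.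
rewrite (le_trans (ler_normB _ _))// lerD//; last first.
  by rewrite (le_trans (ler_norm_sum _ _ _))//; apply: ler_sum => i _; exact: uK.
rewrite -[X in `|X|](subrK (c (l0 *: x))) addrC (le_trans (ler_normD _ _))//.
rewrite lerD2l (le_trans (cG _ _))// ler_wpM2l//.
rewrite /average addrC addKr (le_trans (ler_enorm_sum _))//.
apply: ler_sum => i _; rewrite enormZ gtr0_norm// ler_pM2l//.
rewrite -[X in enorm X](subrK y0) (le_trans (ler_enormD _ _))// lerD2r.
exact: YD.
Qed.

Lemma value_le_conjugate x y : tuples y -> value u x y <= conjugate u x.
Proof.
move=> Ay; have [K vK] := value_bounded x.
apply: (@sup_image_ub _ _ tuples (value u x) K) => // a /vK.
exact/le_trans/ler_norm.
Qed.

Lemma conjugate_le x d : (forall y, tuples y -> value u x y <= d) ->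
  conjugate u x <= d.
Proof. by move=> H; exact: (sup_image_le tuples_cst). Qed.

Lemma conjugate_adherent x e : 0 < e ->
  exists2 y, tuples y & conjugate u x - e < value u x y.
Proof.
move=> e0; have [K vK] := value_bounded x.
apply: (@sup_image_adherent _ _ tuples (value u x) (fun=> y0) K) => // a /vK.
exact/le_trans/ler_norm.
Qed.

Lemma gap_ge0 x y : tuples y -> 0 <= gap u x y.
Proof. by move=> Ay; rewrite subr_ge0; exact: value_le_conjugate. Qed.

Lemma conjugate_lipschitz x x' :
  `|conjugate u x - conjugate u x'| <= l0 * G * enorm (x - x').
Proof.
have H a b : conjugate u a <= conjugate u b + l0 * G * enorm (a - b).
  apply: conjugate_le => y Ay; rewrite {1}(_ : a = b + (a - b)); last first.
    by rewrite addrC subrK.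
  rewrite {1}/value averageD.
  apply: (@le_trans _ _ (value u b y + l0 * G * enorm (a - b))); last first.
    by rewrite lerD2r value_le_conjugate.
  rewrite /value [leRHS]addrAC lerD2r -lerBlDl (le_trans (ler_norm _))//.
  rewrite (le_trans (cG _ _))// [X in enorm X]addrC addKr enormZ gtr0_norm//.
  by rewrite mulrCA mulrA.
by rewrite ler_distl H andbT lerBlDr (enormB x) H.
Qed.

Lemma conjugate_second_diff x v : (forall z w, 0 <= second_diff c w z) ->
  0 <= second_diff (conjugate u) v x.
Proof.
move=> c0; rewrite subr_ge0 mulrC -ler_pdivlMr//; apply: conjugate_le => y Ay.
rewrite ler_pdivlMr//.
have := lerD (value_le_conjugate (x + v) Ay) (value_le_conjugate (x - v) Ay).
apply: le_trans; rewrite /value !averageD scalerN.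
by have := c0 (average x y) (l0 *: v); rewrite /second_diff; lra.
Qed.

End bounded.

Lemma conjugate_perturb u u' (d : 'I_m -> R) x : bounded_potentials u' ->
  (forall i (b : 'rV[R]_n), Y b -> u' i b <= u i b + d i) ->
  conjugate u x <= conjugate u' x + \sum_i d i.
Proof.
move=> bu' uu'; apply: conjugate_le => y Ay.
rewrite -lerBlDr (le_trans _ (value_le_conjugate bu' _ Ay))//.
rewrite /value -addrA lerD2l -opprD lerN2 -big_split; apply: ler_sum => i _.
exact/uu'/Ay.
Qed.

Definition lipschitz_potentials u :=
  forall i (a b : 'rV[R]_n), `|u i a - u i b| <= l i * G * enorm (a - b).

Lemma value_lipschitz u x y y' : lipschitz_potentials u ->
  value u x y' <= value u x y + 2 * G * \sum_i l i * enorm (y i - y' i).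
Proof.
move=> uL; rewrite -lerBlDl.
rewrite (_ : _ - _ = (c (average x y') - c (average x y)) +
  \sum_i (u i (y i) - u i (y' i))); last by rewrite /value sumrB; ring.
rewrite -mulrA mulrDl !mul1r lerD//.
  rewrite (le_trans (ler_norm _))// (le_trans (cG _ _))// ler_wpM2l//.
  rewrite averageB (le_trans (ler_enorm_sum _))//.
  by apply: ler_sum => i _; rewrite enormZ gtr0_norm// enormB.
rewrite mulr_sumr; apply: ler_sum => i _; rewrite (le_trans (ler_norm _))//.
by rewrite (le_trans (uL _ _ _))// -mulrA mulrCA.
Qed.

Lemma gap_le u x y : \sum_i l i <= 1 -> lipschitz_potentials u ->
  tuples y -> gap u x y <= 2 * G * D.
Proof.
move=> l1 uL Ay; rewrite lerBlDl; apply: conjugate_le => y' Ay'.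
have D0 : 0 <= D by rewrite (le_trans _ (YD Yy0 Yy0)).
rewrite (le_trans (value_lipschitz x y y' uL))// lerD2l ler_wpM2l ?mulr_ge0//.
rewrite (@le_trans _ _ (\sum_i l i * D))//; last first.
  by rewrite -mulr_suml ler_piMl.
by apply: ler_sum => i _; rewrite ler_pM2l// YD.
Qed.

(** * Consequences of uniform convexity *)

Variables (S Z : set 'rV[R]_n) (p : 'rV[R]_n -> 'rV[R]_n) (kappa tau : R).
Hypothesis average_in : forall x y, S x -> tuples y -> Z (average x y).
Hypothesis c_tangent : forall z w, Z z -> c z + dot (p z) (w - z) <= c w.
Hypothesis c_lower : forall z w, Z z -> Z w ->
  c z + dot (p z) (w - z) + kappa / 2 * enorm (w - z) ^+ 2 <= c w.
Hypothesis c_upper : forall z w, Z z -> Z w ->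
  c w <= c z + dot (p z) (w - z) + tau * enorm (w - z) ^+ 2.
Hypotheses (kappa_gt0 : 0 < kappa) (tau_ge0 : 0 <= tau).
Hypothesis c_midpoint : forall z w, 0 <= second_diff c w z.
Section stability.
Variable u : 'I_m -> 'rV[R]_n -> R.
Hypothesis bu : bounded_potentials u.

(** The tangent of [c] at the average, restricted to the affine dependence of the
    average on [x], supports [conjugate u] up to the gap. *)
Lemma approximate_subgradient x v y : S x -> tuples y ->
  conjugate u x - gap u x y + l0 * dot (p (average x y)) v <= conjugate u (x + v).
Proof.
move=> Sx Ay; rewrite subKr.
rewrite (le_trans _ (value_le_conjugate bu _ Ay))// /value averageD addrAC lerD2r.
have := c_tangent (average x y + l0 *: v) (average_in Sx Ay).
by rewrite [X in dot _ X]addrC addKr dotZr.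
Qed.

(** [y] and [y'] provide two approximate subgradients of the convex function
    [conjugate u] at [x]; the one is used in the direction [v], the other one
    in the direction [-v]. *)
Lemma subgradient_gap x v y y' : S x -> tuples y -> tuples y' ->
  l0 * `|dot (p (average x y) - p (average x y')) v| <=
  second_diff (conjugate u) v x + (gap u x y + gap u x y').
Proof.
move=> Sx.
have H a b : tuples a -> tuples b ->
    l0 * dot (p (average x a) - p (average x b)) v <=
    second_diff (conjugate u) v x + (gap u x a + gap u x b).
  move=> Aa Ab; have := approximate_subgradient v Sx Aa.
  have := approximate_subgradient (- v) Sx Ab.
  by rewrite /second_diff dotBl dotNr; lra.
move=> Ay Ay'; rewrite -[X in X * `|_|]gtr0_norm// -normrM ler_norml H// andbT.
rewrite lerNl -mulrN -dotNl opprB [gap u x y + _]addrC.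
exact: H.
Qed.

Lemma strongly_monotone z w : Z z -> Z w ->
  kappa * enorm (z - w) ^+ 2 <= dot (p z - p w) (z - w).
Proof.
move=> Zz Zw; have := c_lower Zz Zw; have := c_lower Zw Zz.
by rewrite (enormB w z) -(opprB z w) dotNr dotBl; lra.
Qed.

(** The gradients of [c] at the two averages differ little along every axis, by
    [subgradient_gap]; strong monotonicity of the gradient bounds the distance of
    the averages. *)
Lemma average_stability x y y' r : S x -> tuples y -> tuples y' -> 0 < r ->
  kappa * l0 * r * enorm (average x y - average x y') <=
  \sum_(j < n) second_diff (conjugate u) (r *: delta_mx 0 j) x +
  n%:R * (gap u x y + gap u x y').
Proof.
move=> Sx Ay Ay' r0; set z := average x y; set w := average x y'.
set q := p z - p w; set g := gap u x y + gap u x y'.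
apply: (@le_trans _ _ (\sum_(j < n) l0 * r * `|q 0 j|)); last first.
  rewrite mulr_natl -[n in _ *+ n]card_ord -sumr_const -big_split /=.
  apply: ler_sum => j _.
  have := subgradient_gap (r *: delta_mx 0 j) Sx Ay Ay'.
  by rewrite dotZr dot_delta normrM (gtr0_norm r0) mulrA.
rewrite -mulr_sumr -!mulrA [X in X <= _]mulrCA ler_pM2l// mulrCA ler_pM2l//.
have [->|zw] := eqVneq (enorm (z - w)) 0; first by rewrite mulr0 sumr_ge0.
have zw0 : 0 < enorm (z - w) by rewrite lt_def zw enorm_ge0.
rewrite -(ler_pM2r zw0) -mulrA -expr2.
have Zz : Z z by exact: average_in.
have Zw : Z w by exact: average_in.
rewrite (le_trans (strongly_monotone Zz Zw))// mulr_suml.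
rewrite (le_trans (ler_norm _))// (le_trans (ler_norm_sum _ _ _))//.
apply: ler_sum => j _; rewrite normrM ler_wpM2l//.
exact: le_coord_enorm.
Qed.

(** Exchanging the entries [y i] and [y' i] leaves the sum of the potentials
    unchanged, so the swapped tuples cannot have a much larger total cost;
    uniform convexity bounds the displacement of the averages. *)
Lemma coordinate_stability x y y' i : S x -> tuples y -> tuples y' ->
  kappa / 2 * (l i * enorm (y i - y' i)) ^+ 2 <=
  tau * enorm (average x y - average x y') ^+ 2 + (gap u x y + gap u x y').
Proof.
move=> Sx Ay Ay'.
pose a k := if k == i then y' i else y k; pose b k := if k == i then y i else y' k.
have Aa : tuples a by move=> k; rewrite /a; case: ifP.
have Ab : tuples b by move=> k; rewrite /b; case: ifP.
set z := average x y; set w := average x y'; set d := l i *: (y' i - y i).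
have swap q q' : tuples q -> (forall k, k != i -> q k = q' k) ->
    average x q = average x q' + l i *: (q i - q' i) /\
    \sum_k u k (q k) = \sum_k u k (q' k) + (u i (q i) - u i (q' i)).
  move=> _ qq'; split.
    rewrite addrC -[LHS](subrK (average x q')) averageB (bigD1 i)//= big1 ?addr0//.
    by move=> k ki; rewrite qq'// subrr scaler0.
  rewrite (bigD1 i)//= [in RHS](bigD1 i)//= addrAC addrCA subrr addr0 addrC.
  by rewrite [RHS]addrC; congr (_ + _); apply: eq_bigr => k ki; rewrite qq'.
have [za ua] : average x a = z + d /\
    \sum_k u k (a k) = \sum_k u k (y k) + (u i (y' i) - u i (y i)).
  have [|E1 E2] := swap a y Aa; first by move=> k ki; rewrite /a (negbTE ki).
  by rewrite E1 E2 /a eqxx.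
have [wb ub] : average x b = w - d /\
    \sum_k u k (b k) = \sum_k u k (y' k) - (u i (y' i) - u i (y i)).
  have [|E1 E2] := swap b y' Ab; first by move=> k ki; rewrite /b (negbTE ki).
  by rewrite E1 E2 /b eqxx -scalerN !opprB.
have Zz : Z z by exact: average_in.
have Zw : Z w by exact: average_in.
have Zzd : Z (z + d) by rewrite -za; exact: average_in.
have Zwd : Z (w - d) by rewrite -wb; exact: average_in.
have ga := value_le_conjugate bu x Aa.
have gb := value_le_conjugate bu x Ab.
have L1 := c_lower Zz Zzd; have L2 := c_lower Zz Zwd; have U1 := c_upper Zz Zw.
move: ga gb L1 L2 U1; rewrite /gap /value za wb -/z -/w ua ub.
rewrite [z + d]addrC addrK (_ : w - d - z = (w - z) - d); last by rewrite addrAC.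
rewrite (dotBr (w - z)) (enormB z w) (_ : l i * _ = enorm d); last first.
  by rewrite enormZ gtr0_norm// (enormB (y i)).
have : 0 <= kappa / 2 * enorm (w - z - d) ^+ 2.
  by rewrite mulr_ge0 ?sqr_ge0// divr_ge0// ltW.
lra.
Qed.

End stability.

(** * The dual functional and its minimisers *)

Hypotheses (cS : compact S) (cY : compact Y).
Variables (rho : probability 'rV[R]_n R) (A : R).
Hypothesis rhoS : rho S = 1%E.

(** The density bound enters only through this estimate. *)
Hypothesis rho_second_diff : forall (f : 'rV[R]_n -> R) L j r,
  (forall x x', `|f x - f x'| <= L * enorm (x - x')) ->
  (forall x v, 0 <= second_diff f v x) -> 0 < r ->
  (\int[rho]_(x in S) (second_diff f (r *: delta_mx 0 j) x)%:E
    <= (A * L * r ^+ 2)%:E)%E.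

Let mS : measurable S := compact_measurable_rV cS.
Let mY : measurable Y := compact_measurable_rV cY.

Section one_problem.
Variable mu : 'I_m -> probability 'rV[R]_n R.
Hypothesis muY : forall i, mu i Y = 1%E.

(** The objective of the Kantorovich dual problem, where the first potential has
    been eliminated: the best choice for it is [conjugate u]. *)
Definition dual u : R :=
  \int[rho]_(x in S) conjugate u x + \sum_i \int[mu i]_(y in Y) u i y.

Definition continuous_potentials u := forall i, continuous (u i).

Lemma lipschitz_continuous_potentials u : lipschitz_potentials u -> continuous_potentials u.
Proof. by move=> uL i; apply: (@enorm_lipschitz_continuous _ _ _ (l i * G)). Qed.

Lemma continuous_bounded_potentials u : continuous_potentials u -> bounded_potentials u.
Proof.
move=> cu; have H i : exists K, forall a : 'rV[R]_n, Y a -> `|u i a| <= K.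
  by have [_] := continuous_bounded_measurable cY (cu i).
pose K i := sval (cid (H i)); have K0 i : 0 <= K i.
  by rewrite (le_trans _ (svalP (cid (H i)) _ Yy0)).
exists (\sum_i K i) => i y Yy; rewrite (le_trans (svalP (cid (H i)) _ Yy))//.
by rewrite (bigD1 i)//= lerDl sumr_ge0.
Qed.

Lemma continuous_conjugate u : continuous_potentials u -> continuous (conjugate u).
Proof.
move=> /continuous_bounded_potentials bu.
apply: (@enorm_lipschitz_continuous _ _ _ (l0 * G)) => x y.
exact: conjugate_lipschitz.
Qed.

Lemma bounded_measurable_conjugate u : continuous_potentials u ->
  bounded_measurable S (conjugate u).
Proof.
by move=> cu; apply: continuous_bounded_measurable => //; exact: continuous_conjugate.
Qed.

Lemma dual_perturb u u' (d : R) : continuous_potentials u -> continuous_potentials u' ->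
  (forall i (a : 'rV[R]_n), Y a -> `|u i a - u' i a| <= d) ->
  dual u <= dual u' + 2 * m%:R * d.
Proof.
move=> cu cu' uu'; have bu' := continuous_bounded_potentials cu'.
have sumd : \sum_(i < m) d = m%:R * d.
  by rewrite sumr_const card_ord mulr_natl.
rewrite (_ : dual u' + _ = (\int[rho]_(x in S) (conjugate u' x + m%:R * d)) +
   \sum_i (\int[mu i]_(y in Y) (u' i y + d))).
  apply: lerD.
    apply: le_mean => //.
    - exact: bounded_measurable_conjugate.
    - apply: bounded_measurableD; first exact: bounded_measurable_conjugate.
      exact: bounded_measurable_cst.
    - move=> x _; rewrite -sumd.
      apply: conjugate_perturb => // i y Yy.
      by have := uu' i y Yy; rewrite ler_norml => /andP[]; lra.
  apply: ler_sum => i _; apply: le_mean => //.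
  - exact: continuous_bounded_measurable.
  - apply: bounded_measurableD; first exact: continuous_bounded_measurable.
    exact: bounded_measurable_cst.
  - by move=> y Yy; have := uu' i y Yy; rewrite ler_norml => /andP[]; lra.
rewrite meanD//; [|exact: bounded_measurable_conjugate|exact: bounded_measurable_cst].
rewrite mean_cst//.
under [in RHS]eq_bigr => i _.
  rewrite meanD//; [|exact: continuous_bounded_measurable|exact: bounded_measurable_cst].
  rewrite mean_cst//.
  over.
rewrite big_split /= sumd /dual; ring.
Qed.

(** Compactness: pointwise limits along an ultrafilter exist for all points at
    once, and equicontinuity makes the convergence uniform on [Y]. *)
Lemma lipschitz_cluster (u_ : nat -> 'I_m -> 'rV[R]_n -> R) :
  (forall k, lipschitz_potentials (u_ k)) -> (forall k i, u_ k i y0 = 0) ->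
  exists u, [/\ lipschitz_potentials u, forall i, u i y0 = 0 & forall e N, 0 < e ->
    exists2 k, (N <= k)%N & forall i (a : 'rV[R]_n), Y a -> `|u_ k i a - u i a| <= e].
Proof.
move=> uL u0.
have [F [UF oF]] := ultraFilterLemma (_ : ProperFilter (nbhs \oo)).
have PF := @ultra_proper _ _ UF.
have cvg_u i (y : 'rV[R]_n) : exists r : R, u_ k i y @[k --> F] --> r.
  apply: (@ultrafilter_cvg _ _ _ (l i * G * enorm (y - y0))) => // k.
  by have := uL k i y y0; rewrite u0 subr0.
pose u i (y : 'rV[R]_n) := sval (cid (cvg_u i y)).
have ucvg i (y : 'rV[R]_n) : u_ k i y @[k --> F] --> u i y by exact: (svalP (cid (cvg_u i y))).
have uLip : lipschitz_potentials u.
  move=> i a b; rewrite leNgt; apply/negP => lt_ab.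
  have H : `|u_ k i a - u_ k i b| @[k --> F] --> `|u i a - u i b|.
    by apply: cvg_norm; exact: cvgB.
  have Hk : \forall k \near F, l i * G * enorm (a - b) < `|u_ k i a - u_ k i b|.
    exact: (H _ (lt_nbhsr lt_ab)).
  have [k /= lt_k] := filter_ex Hk.
  by have := uL k i a b; rewrite leNgt lt_k.
exists u; split => //.
  move=> i; have := ucvg i y0.
  rewrite (_ : (fun k => _) = (fun=> 0 : R)); last by apply/funext => k; exact: u0.
  by move=> H; apply: (cvg_unique (@Rhausdorff R) H); exact: cvg_cst.
move=> e N e0.
have GL : 0 < (\sum_i l i) * G + 1.
  by rewrite ltr_pwDr// mulr_ge0// sumr_ge0// => i _; rewrite ltW.
pose r := e / 3 / ((\sum_i l i) * G + 1).
have r0 : 0 < r by rewrite !divr_gt0.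
have [s sP] := compact_net cY r0.
have near_s : \forall k \near F, forall i (y : 'rV[R]_n), y \in s -> `|u_ k i y - u i y| <= e / 3.
  elim: (s) => [|z s' IH]; first by apply: filterE.
  have : \forall k \near F, forall i, `|u_ k i z - u i z| <= e / 3.
    apply: filter_forall => i; have /cvgrPdist_le := ucvg i z.
    move=> /(_ (e / 3)); rewrite divr_gt0// => /(_ isT).
    by apply: filterS => k; rewrite distrC.
  apply: filterS2 IH => k ks kz i y; rewrite inE => /predU1P[->|ys].
    exact: kz.
  exact: ks.
have FN : F [set k | (N <= k)%N] by apply: oF; exact: nbhs_infty_ge.
have [k [sk Nk]] := filter_ex (filterI near_s FN).
exists k => // i y Yy; have [z zs yz] := sP y Yy.
rewrite (_ : _ - _ = (u_ k i y - u_ k i z) + (u_ k i z - u i z) + (u i z - u i y));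
  last by ring.
have ly : l i * G * enorm (y - z) <= e / 3.
  have lG : l i * G <= (\sum_i l i) * G + 1.
    rewrite ler_wpDr// ler_wpM2r// (bigD1 i)//= lerDl sumr_ge0// => j _.
    exact: ltW.
  rewrite (le_trans (ler_wpM2r _ lG))//.
  by rewrite -ler_pdivlMl// mulrC ltW.
have := sk i z zs; have := uL k i y z; have := uLip i z y.
rewrite (enormB z y) => P1 P2 P3.
rewrite (le_trans (ler_normD _ _))// (le_trans (lerD (ler_normD _ _) (lexx _)))//.
by lra.
Qed.

Lemma dual_shift u (d : 'I_m -> R) : continuous_potentials u ->
  dual (fun i (b : 'rV[R]_n) => u i b - d i) = dual u.
Proof.
move=> cu; have cud : continuous_potentials (fun i (b : 'rV[R]_n) => u i b - d i).
  by move=> i b; apply: (continuousB (cu i b)); exact: cst_continuous.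
have bu := continuous_bounded_potentials cu.
have bud := continuous_bounded_potentials cud.
have E x : conjugate (fun i (b : 'rV[R]_n) => u i b - d i) x = conjugate u x + \sum_i d i.
  apply/eqP; rewrite eq_le; apply/andP; split.
    by apply: conjugate_perturb => // i b _; rewrite subrK.
  rewrite -lerBrDr -sumrN.
  by apply: conjugate_perturb => // i b _.
rewrite /dual; under eq_Rintegral do rewrite E.
rewrite meanD//; [|exact: bounded_measurable_conjugate|exact: bounded_measurable_cst].
rewrite mean_cst//.
under [X in _ + X = _]eq_bigr => i _.
  rewrite meanB//; [|exact: continuous_bounded_measurable|exact: bounded_measurable_cst].
  rewrite mean_cst//.
  over.
by rewrite sumrB; ring.
Qed.

Lemma continuous_cost_average y : continuous (fun x => c (average x y)).
Proof.
apply: (@enorm_lipschitz_continuous _ _ _ (G * l0)) => a b.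
rewrite (le_trans (cG _ _))// -mulrA ler_wpM2l//.
rewrite (_ : average a y - average b y = l0 *: (a - b)).
  by rewrite enormZ gtr0_norm.
by rewrite /average opprD addrACA subrr addr0 scalerBr.
Qed.

Lemma dual_lower_bound : exists B, forall u, lipschitz_potentials u ->
  (forall i, u i y0 = 0) -> B <= dual u.
Proof.
exists (\int[rho]_(x in S) c (average x (fun=> y0)) + \sum_i - (l i * G * D)).
move=> u uL u0; have cu := lipschitz_continuous_potentials uL.
have bu := continuous_bounded_potentials cu.
apply: lerD.
  apply: le_mean => //.
  - apply: continuous_bounded_measurable => //; exact: continuous_cost_average.
  - exact: bounded_measurable_conjugate.
  - move=> x _; rewrite (le_trans _ (value_le_conjugate bu x tuples_cst))//.
    by rewrite /value big1 ?subr0.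
apply: ler_sum => i _.
rewrite -[X in X <= _](@mean_cst _ _ _ (mu i) Y)//; apply: le_mean => //.
- exact: bounded_measurable_cst.
- exact: continuous_bounded_measurable.
- move=> y Yy; rewrite lerNl -[X in X <= _]addr0 -(u0 i) addrC.
  rewrite (le_trans (ler_norm _))// (le_trans (uL _ _ _))//.
  by rewrite ler_wpM2l ?YD// mulr_ge0// ltW.
Qed.

(** By [dual_shift] the potentials may be normalised to vanish at [y0], which makes
    the Lipschitz ones a compact family. *)
Lemma dual_minimizer : exists2 u, lipschitz_potentials u &
  forall u', lipschitz_potentials u' -> dual u <= dual u'.
Proof.
pose N : set ('I_m -> 'rV[R]_n -> R) :=
  [set u | lipschitz_potentials u /\ forall i, u i y0 = 0].
have [B NB] := dual_lower_bound.
have N0 : N (fun _ _ => 0).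
  by split => // i a b; rewrite subrr normr0 !mulr_ge0// ltW.
have infN : has_inf (dual @` N).
  split; first by exists (dual (fun _ _ => 0)), (fun _ _ => 0).
  by exists B => _ [u [uL u0] <-]; exact: NB.
pose a := inf (dual @` N).
have adh k : exists u, N u /\ dual u < a + k.+1%:R^-1.
  have [|_ [u Nu <-] ua] := @inf_adherent _ (dual @` N) k.+1%:R^-1 _ infN.
    by rewrite invr_gt0.
  by exists u.
pose u_ k := sval (cid (adh k)).
have uN k : N (u_ k) by have [] := svalP (cid (adh k)).
have ua k : dual (u_ k) < a + k.+1%:R^-1 by have [] := svalP (cid (adh k)).
have [u [uL u0 ucl]] := lipschitz_cluster (fun k => (uN k).1) (fun k => (uN k).2).
have uinf : dual u <= a.
  apply/ler_addgt0Pr => e e0.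
  have e2 : 0 < e / 2 by rewrite divr_gt0.
  have [k0 _ Hk] := near_infty_natSinv_lt (PosNum e2).
  have M0 : 0 < 2 * m%:R + 1 :> R by rewrite ltr_pwDr// mulr_ge0.
  have [|k kN uk] := ucl (e / 2 / (2 * m%:R + 1)) k0; first by rewrite divr_gt0.
  have H : dual u <= dual (u_ k) + 2 * m%:R * (e / 2 / (2 * m%:R + 1)).
    apply: dual_perturb.
    - exact: lipschitz_continuous_potentials.
    - exact/lipschitz_continuous_potentials/(uN k).1.
    - by move=> i b Yb; rewrite distrC uk.
  have H2 : 2 * m%:R * (e / 2 / (2 * m%:R + 1)) <= e / 2.
    by rewrite mulrA ler_pdivrMr// [leRHS]mulrC ler_wpM2r ?lerDl// ltW.
  have := ua k; have := Hk k kN; rewrite /= => P1 P2.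
  rewrite (le_trans H)// (le_trans (lerD (ltW P2) H2))// -addrA lerD2l.
  by rewrite [leRHS]splitr lerD2r ltW.
exists u => // u' uL'.
have cu' := lipschitz_continuous_potentials uL'.
rewrite -(dual_shift (fun i => u' i y0) cu') (le_trans uinf)//.
apply: ge_inf; first by case: infN.
exists (fun i (b : 'rV[R]_n) => u' i b - u' i y0) => //; split => [i x y|i]; last exact: subrr.
by rewrite opprB addrA subrK.
Qed.

(** * Improving one potential *)

Definition upd (T : Type) (f : 'I_m -> T) i a : 'I_m -> T :=
  fun k => if k == i then a else f k.

Lemma upd_same T (f : 'I_m -> T) i a : upd f i a i = a.
Proof. by rewrite /upd eqxx. Qed.

Lemma upd_other T (f : 'I_m -> T) i a k : k != i -> upd f i a k = f k.
Proof. by rewrite /upd => /negbTE ->. Qed.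

Lemma upd_id T (f : 'I_m -> T) i : upd f i (f i) = f.
Proof. by apply/funext => k; rewrite /upd; case: eqP => [->|]. Qed.

Lemma tuples_upd y i b : tuples y -> Y b -> tuples (upd y i b).
Proof. by move=> Ay Yb k; rewrite /upd; case: eqP. Qed.

Lemma sum_upd (f : 'I_m -> R) i a : \sum_k upd f i a k = \sum_k f k + (a - f i).
Proof.
rewrite (bigD1 i)//= [in RHS](bigD1 i)//= upd_same.
rewrite (eq_bigr f) => [|k ki]; last by rewrite upd_other.
by ring.
Qed.

Lemma value_upd u i (f : 'rV[R]_n -> R) x y :
  value (upd u i f) x y = value u x y - (f (y i) - u i (y i)).
Proof.
rewrite /value -addrA -opprD -sum_upd; congr (_ - _); apply: eq_bigr => k _.
by rewrite /upd; case: eqP => [->|].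
Qed.

Lemma value_upd_tuple u i x y a b : u i = (fun=> 0) ->
  value u x (upd y i a) <= value u x (upd y i b) + l i * G * enorm (a - b).
Proof.
move=> ui; rewrite /value addrAC.
rewrite (_ : \sum_k u k (upd y i a k) = \sum_k u k (upd y i b k)); last first.
  by apply: eq_bigr => k _; rewrite /upd; case: eqP => [->|//]; rewrite ui.
rewrite lerD2r -lerBlDl (le_trans (ler_norm _))// (le_trans (cG _ _))//.
rewrite averageB (bigD1 i)//= !upd_same big1 => [|k ki].
  by rewrite addr0 enormZ gtr0_norm// mulrCA mulrA.
by rewrite !upd_other// subrr scaler0.
Qed.

(** The least [f] such that replacing [u i] by [f] does not increase
    [conjugate u] on [S]. *)
Definition ctransform u i b := sup [set value (upd u i (fun=> 0)) z.1 (upd z.2 i b)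
  - conjugate u z.1 | z in S `*` tuples].

Section ctransform.
Variables (u : 'I_m -> 'rV[R]_n -> R) (i : 'I_m).
Hypothesis cu : continuous_potentials u.

Let S_neq0 : S !=set0.
Proof.
apply/set0P/eqP => S0; move: rhoS; rewrite S0 measure0.
by move=> /esym/eqP; rewrite onee_eq0.
Qed.

Let term b z := value (upd u i (fun=> 0)) z.1 (upd z.2 i b) - conjugate u z.1.

Let term_le b z : Y b -> tuples z.2 -> term b z <= u i b.
Proof.
move=> Yb Az; rewrite /term value_upd upd_same sub0r opprK lerBlDr addrC lerD2l.
by apply: value_le_conjugate; [exact: continuous_bounded_potentials|exact: tuples_upd].
Qed.

Let term_lip a b z : term a z <= term b z + l i * G * enorm (a - b).
Proof. by rewrite /term [leRHS]addrAC lerD2r value_upd_tuple// upd_same. Qed.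

Let term_bounded b z : tuples z.2 -> term b z <= u i y0 + l i * G * enorm (b - y0).
Proof.
by move=> Az; rewrite (le_trans (term_lip b y0 z))// lerD2r term_le.
Qed.

Let ub b z : (S `*` tuples) z -> term b z <= ctransform u i b.
Proof.
move=> [Sz Az]; apply: (@sup_image_ub _ _ (S `*` tuples) (term b)
  (u i y0 + l i * G * enorm (b - y0))) => // t [_ At].
exact: term_bounded.
Qed.

Let least b d : (forall z, (S `*` tuples) z -> term b z <= d) -> ctransform u i b <= d.
Proof.
move=> H; have [x Sx] := S_neq0.
exact: (@sup_image_le _ _ (S `*` tuples) (term b) (x, fun=> y0)
  (conj Sx tuples_cst) _ H).
Qed.

Lemma ctransform_lipschitz a b :
  `|ctransform u i a - ctransform u i b| <= l i * G * enorm (a - b).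
Proof.
have H d e : ctransform u i d <= ctransform u i e + l i * G * enorm (d - e).
  by apply: least => z Az; rewrite (le_trans (term_lip d e z))// lerD2r ub.
by rewrite ler_distl H andbT lerBlDr (enormB a) H.
Qed.

Lemma continuous_upd (f : 'rV[R]_n -> R) : continuous f ->
  continuous_potentials (upd u i f).
Proof. by move=> cf k; rewrite /upd; case: eqP => // _; exact: cu. Qed.

Lemma dual_ctransform : dual (upd u i (ctransform u i)) <= dual u.
Proof.
have cc : continuous (ctransform u i).
  by apply: (@enorm_lipschitz_continuous _ _ _ (l i * G)); exact: ctransform_lipschitz.
have cuc := continuous_upd cc.
apply: lerD.
  apply: le_mean => //; [exact: bounded_measurable_conjugate..|].
  move=> x Sx; apply: conjugate_le => y Ay.
  have : term (y i) (x, y) <= ctransform u i (y i) by apply: ub.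
  by rewrite /term /= upd_id !value_upd; lra.
apply: ler_sum => k _; apply: le_mean => //; [exact: continuous_bounded_measurable..|].
move=> y Yy; rewrite /upd; case: eqP => // ->.
by apply: least => z [_ Az]; exact: term_le.
Qed.

End ctransform.

(** A minimiser among Lipschitz potentials cannot be improved by any continuous
    change of one potential, because [ctransform] makes the changed potential
    Lipschitz again without increasing the dual functional. *)
Lemma dual_minimizer_coordinate u i (f : 'rV[R]_n -> R) : lipschitz_potentials u ->
  (forall u', lipschitz_potentials u' -> dual u <= dual u') -> continuous f ->
  dual u <= dual (upd u i f).
Proof.
move=> uL umin cf; have cu := lipschitz_continuous_potentials uL.
have cuf : continuous_potentials (upd u i f) by exact: continuous_upd.
rewrite (le_trans _ (dual_ctransform i cuf))//; apply: umin => k a b.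
rewrite /upd; case: eqP => // ->; exact: ctransform_lipschitz.
Qed.

(** * Uniqueness of the maximising tuple *)

Definition axis_second_diff u (r : R) x :=
  \sum_(j < n) second_diff (conjugate u) (r *: delta_mx 0 j) x.

Lemma continuous_second_diff (f : 'rV[R]_n -> R) v : continuous f ->
  continuous (second_diff f v).
Proof.
move=> cf x.
have cs w : {for x, continuous (fun x => f (x + w))}.
  apply/continuous_enormP => e e0.
  have /continuous_enormP/(_ e e0)[d d0 dP] := cf (x + w).
  by exists d => // b bd; apply: dP; rewrite opprD addrACA subrr addr0.
have c2 : {for x, continuous (fun x => 2 * f x)}.
  by apply: continuousM (cf x); exact: cst_continuous.
exact: (continuousB (continuousD (cs v) (cs (- v))) c2).
Qed.

Section regular.
Variable u : 'I_m -> 'rV[R]_n -> R.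
Hypothesis uL : lipschitz_potentials u.

Let cu := lipschitz_continuous_potentials uL.
Let bu := continuous_bounded_potentials cu.

Let sd_bm r j :
  bounded_measurable S (second_diff (conjugate u) (r *: delta_mx 0 j)).
Proof.
apply: continuous_bounded_measurable => //; apply: continuous_second_diff.
exact: continuous_conjugate.
Qed.

Lemma axis_second_diff_bounded_measurable r :
  bounded_measurable S (axis_second_diff u r).
Proof. by apply: bounded_measurable_sum => j; exact: sd_bm. Qed.

Lemma axis_second_diff_ge0 r x : 0 <= axis_second_diff u r x.
Proof. by apply: sumr_ge0 => j _; exact: conjugate_second_diff. Qed.

Lemma mean_axis_second_diff r : 0 < r ->
  \int[rho]_(x in S) axis_second_diff u r x <= n%:R * A * (l0 * G) * r ^+ 2.
Proof.
move=> r0; rewrite mean_sum//.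
rewrite -!mulrA mulr_natl -[n in _ *+ n]card_ord -sumr_const.
apply: ler_sum => j _; rewrite -lee_fin -mean_EFin//.
rewrite [l0 * _]mulrA [A * _]mulrA; apply: rho_second_diff => //.
  by move=> x x'; exact: conjugate_lipschitz.
by move=> x v; exact: conjugate_second_diff.
Qed.

(** In the limit of small increments, the slopes of [conjugate u] on the two
    sides of [x] agree along all axes. *)
Definition regular : set 'rV[R]_n := [set x |
  forall q : nat, exists k : nat,
    k.+1%:R * axis_second_diff u k.+1%:R^-1 x < q.+1%:R^-1].

Let measurable_asd r : measurable_fun setT (axis_second_diff u r).
Proof.
apply: measurable_sum => j; apply: continuous_measurable_rV.
by apply: continuous_second_diff; exact: continuous_conjugate.
Qed.

Let measurable_slope k : measurable_fun setT (fun x =>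
  k.+1%:R * axis_second_diff u k.+1%:R^-1 x).
Proof. by apply: measurable_funM => //; exact: measurable_asd. Qed.

Lemma measurable_regular : measurable regular.
Proof.
rewrite (_ : regular = \bigcap_q \bigcup_k ((fun x =>
    k.+1%:R * axis_second_diff u k.+1%:R^-1 x) @^-1` `]-oo, (q.+1%:R^-1 : R)[)).
  apply: bigcapT_measurable => q; apply: bigcup_measurable => k _.
  by rewrite -[X in measurable X]setTI; apply: measurable_slope.
apply/seteqP; split => x /= H.
  by move=> q _; have [k Hk] := H q; exists k => //=; rewrite in_itv.
by move=> q; have [k _] := H q I; rewrite /= in_itv /= => Hk; exists k.
Qed.

(** Second differences with step [r] have mean [O(r^2)], so the slopes they define
    have mean [O(r)]. *)
Lemma rho_nonregular : rho (S `\` regular) = 0%E.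
Proof.
pose B q : set 'rV[R]_n := S `&` [set x | forall k,
  q.+1%:R^-1 <= k.+1%:R * axis_second_diff u k.+1%:R^-1 x].
have mB q : measurable (B q).
  apply: measurableI => //.
  rewrite (_ : [set x | _] = \bigcap_k ((fun x =>
    k.+1%:R * axis_second_diff u k.+1%:R^-1 x) @^-1` `[(q.+1%:R^-1 : R), +oo[)).
    apply: bigcapT_measurable => k.
    by rewrite -[X in measurable X]setTI; apply: measurable_slope.
  apply/seteqP; split => x /= H.
    by move=> k _; rewrite /= in_itv /= andbT.
  by move=> k; have := H k I; rewrite /= in_itv /= andbT.
have B0 q : rho (B q) = 0%E.
  pose K := n%:R * A * (l0 * G).
  have fB : rho (B q) \is a fin_num by exact: fin_num_measure.
  (* Markov's inequality for the increment [1 / (k + 1)] *)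
  have H k : q.+1%:R^-1 * fine (rho (B q)) <= K * k.+1%:R^-1.
    pose f x := k.+1%:R * axis_second_diff u k.+1%:R^-1 x.
    have bf : bounded_measurable S f.
      by apply: bounded_measurableZ; exact: axis_second_diff_bounded_measurable.
    have f0 x : 0 <= f x by rewrite mulr_ge0// axis_second_diff_ge0.
    rewrite -lee_fin EFinM fineK// -integral_cst//.
    apply: (@le_trans _ _ (\int[rho]_(x in S) (f x)%:E)%E).
      apply: (@le_trans _ _ (\int[rho]_(x in B q) (f x)%:E)%E).
        apply: ge0_le_integral => //.
        - by move=> x _; rewrite lee_fin.
        - apply/measurable_EFinP; apply: (measurable_funS mS); last exact: bf.1.
          by move=> x [].
        - by move=> x [_ /(_ k)]; rewrite lee_fin.
      apply: ge0_subset_integral => //.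
      - by apply/measurable_EFinP; exact: bf.1.
      - by move=> x _; rewrite lee_fin.
      - by move=> x [].
    rewrite mean_EFin// lee_fin /f meanZ//; last first.
      exact: axis_second_diff_bounded_measurable.
    rewrite (le_trans (ler_wpM2l _ (mean_axis_second_diff _)))//.
    rewrite -/K mulrCA le_eqVlt; apply/orP; left; apply/eqP.
    have : k.+1%:R != 0 :> R by rewrite pnatr_eq0.
    by move: (k.+1%:R) => t t0; field.
  have le0 : fine (rho (B q)) <= 0.
    apply/ler_addgt0Pr => e e0; rewrite add0r.
    pose t := q.+1%:R * `|K|; have t0 : 0 <= t by rewrite mulr_ge0.
    have [k tk] : exists k : nat, t / e < k.+1%:R.
      exists (Num.truncn (t / e)); exact: truncnS_gt.
    have := H k; rewrite ler_pdivrMl// => /le_trans; apply.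
    rewrite mulrA ler_pdivrMr//.
    move: tk; rewrite ltr_pdivrMr// [_ * e]mulrC => /ltW; apply: le_trans.
    by rewrite ler_wpM2l// ler_norm.
  by rewrite -(fineK fB); congr EFin; apply/eqP; rewrite eq_le le0 fine_ge0.
have sub : S `\` regular `<=` \bigcup_q B q.
  move=> x [Sx /existsNP[q /forallNP Hq]]; exists q => //; split => // k.
  by rewrite leNgt; apply/negP; exact: Hq.
have mN : measurable (S `\` regular) := measurableD mS measurable_regular.
apply/(negligibleP _ mN); apply: negligibleS sub _.
by apply: negligible_bigcup => q; apply/(negligibleP _ (mB q)); exact: B0.
Qed.

End regular.

(** * Transport maps and weak duality *)

Definition cost_mean (T : 'I_m -> 'rV[R]_n -> 'rV[R]_n) : R :=
  \int[rho]_(x in S) c (average x (T ^~ x)).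

Definition S_maps (T : 'I_m -> 'rV[R]_n -> 'rV[R]_n) :=
  forall i, measurable_fun S (T i) /\ forall x, S x -> Y (T i x).

Lemma measurable_average T : S_maps T ->
  measurable_fun S (fun x => average x (T ^~ x)).
Proof.
move=> mT; apply: measurable_fun_rV => // j.
rewrite (_ : (fun x => _) =
    (fun x : 'rV[R]_n => l0 * x 0 j + \sum_i l i * T i x 0 j)); last first.
  apply/funext => x; rewrite !mxE summxE; congr (_ + _).
  by apply: eq_bigr => i _; rewrite mxE.
apply: measurable_funD.
  by apply: measurable_funM => //; apply: measurable_funTS; exact: measurable_coord.
apply: measurable_sum => i; apply: measurable_funM => //.
by apply: (measurableT_comp (measurable_coord 0 j)); exact: (mT i).1.
Qed.

Lemma cost_bounded_measurable T : S_maps T ->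
  bounded_measurable S (fun x => c (average x (T ^~ x))).
Proof.
move=> mT; have cc : continuous c by exact: enorm_lipschitz_continuous cG.
split.
  apply: (measurableT_comp (continuous_measurable_rV cc)).
  exact: measurable_average.
have [_ [K HK]] := continuous_bounded_measurable cS
  (@continuous_cost_average (fun=> y0)).
exists (K + G * \sum_i l i * D) => x Sx.
rewrite -[X in `|X|](subrK (c (average x (fun=> y0)))) addrC.
rewrite (le_trans (ler_normD _ _))// lerD ?HK// (le_trans (cG _ _))// ler_wpM2l//.
rewrite averageB (le_trans (ler_enorm_sum _))//; apply: ler_sum => i _.
by rewrite enormZ gtr0_norm// ler_pM2l// YD//; exact: (mT i).2.
Qed.

Lemma potential_bounded_measurable T u : S_maps T -> continuous_potentials u ->
  bounded_measurable S (fun x => \sum_i u i (T i x)).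
Proof.
move=> mT cu; have [K uK] := continuous_bounded_potentials cu.
apply: bounded_measurable_sum => i; split.
  apply: (measurableT_comp (continuous_measurable_rV (cu i))).
  exact: (mT i).1.
by exists K => x Sx; apply: uK; exact: (mT i).2.
Qed.

Lemma gap_bounded_measurable T u : S_maps T -> continuous_potentials u ->
  bounded_measurable S (fun x => gap u x (T ^~ x)).
Proof.
move=> mT cu; apply: bounded_measurableB; first exact: bounded_measurable_conjugate.
apply: bounded_measurableB; first exact: cost_bounded_measurable.
exact: potential_bounded_measurable.
Qed.

(** Weak duality, with its defect: the left-hand side is nonnegative. *)
Lemma mean_gap T u : S_maps T -> continuous_potentials u ->
  \int[rho]_(x in S) gap u x (T ^~ x) =
  \int[rho]_(x in S) conjugate u x + \sum_i \int[rho]_(x in S) u i (T i x)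
    - cost_mean T.
Proof.
move=> mT cu; have bc := cost_bounded_measurable mT.
have bp := potential_bounded_measurable mT cu.
rewrite /gap /value meanB//; last 2 first.
- exact: bounded_measurable_conjugate.
- exact: bounded_measurableB.
rewrite meanB// mean_sum//; first by rewrite /cost_mean; ring.
move=> i; split.
  by apply: (measurableT_comp (continuous_measurable_rV (cu i))); exact: (mT i).1.
have [K uK] := continuous_bounded_potentials cu.
by exists K => x Sx; apply: uK; exact: (mT i).2.
Qed.

Section maximising_tuple.
Variable u : 'I_m -> 'rV[R]_n -> R.
Hypothesis uL : lipschitz_potentials u.

Let cu := lipschitz_continuous_potentials uL.
Let bu := continuous_bounded_potentials cu.

(** At a regular point, [average_stability] forces the averages of nearly
    maximising tuples to agree, and then [coordinate_stability] their entries. *)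
Lemma regular_wellposed x e : S x -> regular u x -> 0 < e ->
  exists2 d, 0 < d & forall y y', tuples y -> tuples y' ->
    gap u x y <= d -> gap u x y' <= d -> forall i, l i * enorm (y i - y' i) <= e.
Proof.
move=> Sx regx e0.
pose q := Num.min 1 (kappa / (4 * (tau + 1))).
have t1 : 0 < tau + 1 by rewrite ltr_pwDr.
have q0 : 0 < q by rewrite lt_min ltr01 divr_gt0// mulr_gt0.
have tq : tau * q ^+ 2 <= kappa / 4.
  have q1 : q <= 1 by rewrite ge_min lexx.
  have q2 : q <= kappa / (4 * (tau + 1)) by rewrite ge_min lexx orbT.
  have q3 : q ^+ 2 <= q by rewrite expr2 ler_piMl// ltW.
  rewrite (le_trans (ler_wpM2l tau_ge0 (le_trans q3 q2)))//.
  rewrite mulrA ler_pdivrMr ?mulr_gt0//.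
  have -> : kappa / 4 * (4 * (tau + 1)) = (tau + 1) * kappa by field.
  by rewrite ler_pM2r// lerDl.
pose z := e * q; have z0 : 0 < z by rewrite mulr_gt0.
pose a := kappa * l0 * z / 2; have a0 : 0 < a by rewrite divr_gt0// !mulr_gt0.
have [p0 _ /(_ p0 (leqnn p0))/= pa] := near_infty_natSinv_lt (PosNum a0).
have [k Hk] := regx p0.
pose d1 := kappa * e ^+ 2 / 8; pose d2 := a / (2 * (n%:R + 1) * k.+1%:R).
have d10 : 0 < d1 by rewrite divr_gt0// mulr_gt0// exprn_gt0.
have d20 : 0 < d2 by rewrite divr_gt0// !mulr_gt0// ltr_pwDr.
exists (Num.min d1 d2) => [|y y' Ay Ay']; first by rewrite lt_min d10.
rewrite !le_min => /andP[g1 g2] /andP[g1' g2'] i.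
set w := average x y; set w' := average x y'.
have ww : enorm (w - w') <= z.
  have k0 : 0 < k.+1%:R^-1 :> R by rewrite invr_gt0.
  have := average_stability bu Sx Ay Ay' k0.
  rewrite -/(axis_second_diff u k.+1%:R^-1 x) -/w -/w' => H.
  have {}H : kappa * l0 * enorm (w - w') <=
      k.+1%:R * axis_second_diff u k.+1%:R^-1 x +
      k.+1%:R * (n%:R * (gap u x y + gap u x y')).
    rewrite -mulrDr -ler_pdivrMl//; apply: le_trans H.
    by rewrite le_eqVlt; apply/orP; left; apply/eqP; ring.
  have H2 : k.+1%:R * (n%:R * (gap u x y + gap u x y')) <= a.
    apply: (@le_trans _ _ (k.+1%:R * ((n%:R + 1) * (2 * d2)))).
      rewrite ler_wpM2l//; apply: ler_pM => //.
      - by rewrite addr_ge0 ?gap_ge0.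
      - by rewrite lerDl.
      - lra.
    rewrite /d2 le_eqVlt; apply/orP; left; apply/eqP.
    have n1 : n%:R + 1 != 0 :> R by rewrite gt_eqF// ltr_pwDr.
    have k1 : k.+1%:R != 0 :> R by rewrite pnatr_eq0.
    by move: (k.+1%:R) (n%:R + 1) n1 k1 => s t *; field; apply/andP.
  have : kappa * l0 * enorm (w - w') <= kappa * l0 * z.
    rewrite (le_trans H)// (le_trans (lerD (ltW (lt_trans Hk pa)) H2))//.
    by rewrite /a; lra.
  by rewrite ler_pM2l// mulr_gt0.
have := coordinate_stability bu i Sx Ay Ay'; rewrite -/w -/w' => H.
have zz : tau * enorm (w - w') ^+ 2 <= kappa / 4 * e ^+ 2.
  apply: (@le_trans _ _ (tau * z ^+ 2)).
    by rewrite ler_wpM2l// lerXn2r// nnegrE// ltW.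
  by rewrite /z exprMn mulrCA mulrC ler_wpM2r// sqr_ge0.
have : kappa / 2 * (l i * enorm (y i - y' i)) ^+ 2 <= kappa / 2 * e ^+ 2.
  rewrite (le_trans H)// (le_trans (lerD zz (lerD g1 g1')))//.
  by rewrite /d1; lra.
rewrite ler_pM2l ?divr_gt0// ler_pXn2r// nnegrE ?(ltW e0)//.
by rewrite mulr_ge0// (ltW (l_gt0 i)).
Qed.

(** A cluster point of a maximising sequence; all nearly maximising tuples are
    close to it. *)
Lemma regular_maximiser x : S x -> regular u x ->
  exists y, [/\ tuples y, gap u x y = 0 & forall e, 0 < e ->
    exists2 d, 0 < d & forall y', tuples y' -> gap u x y' <= d ->
      forall i, l i * enorm (y' i - y i) <= e].
Proof.
move=> Sx regx.
have adh k : exists y, tuples y /\ gap u x y < k.+1%:R^-1.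
  have k0 : 0 < k.+1%:R^-1 :> R by rewrite invr_gt0.
  have [y Ay yk] := conjugate_adherent bu x k0.
  by exists y; split => //; rewrite ltrBlDl -ltrBlDr.
pose y_ k := sval (cid (adh k)).
have Ay k : tuples (y_ k) by have [] := svalP (cid (adh k)).
have gy k : gap u x (y_ k) < k.+1%:R^-1 by have [] := svalP (cid (adh k)).
have clu i : exists2 a, Y a & forall e N, 0 < e ->
    exists2 k, (N <= k)%N & enorm (y_ k i - a) < e.
  have [|a [Ya acl]] := cY (F := (fun k => y_ k i) @ \oo) _.
    by apply: (@filterE _ \oo) => k; exact: Ay.
  exists a => // e N e0.
  have Nk : \forall k \near \oo, (N <= k)%N by exact: nbhs_infty_ge.
  have B : nbhs a [set b | enorm (b - a) < e] by apply/nbhs_enormP; exists e.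
  have [|b [[k /= Nk' <-] bk]] := acl [set y_ k i | k in [set k | (N <= k)%N]] _ _ B.
    by apply: filterS Nk => k Nk; exists k.
  by exists k.
pose y i := sval (cid2 (clu i)).
have Yy : tuples y by move=> i; rewrite /y; case: cid2.
have ycl i e N : 0 < e -> exists2 k, (N <= k)%N & enorm (y_ k i - y i) < e.
  by rewrite /y; case: cid2 => a ? /= H; exact: H.
have small e : 0 < e -> exists N : nat, N.+1%:R^-1 < e :> R.
  by move=> e0; have [N _ /(_ N (leqnn N))] := near_infty_natSinv_lt (PosNum e0); exists N.
have key e : 0 < e -> exists2 d, 0 < d & forall y', tuples y' ->
    gap u x y' <= d -> forall i, l i * enorm (y' i - y i) <= e.
  move=> e0; have e2 : 0 < e / 2 by rewrite divr_gt0.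
  have [d d0 dP] := regular_wellposed Sx regx e2.
  exists d => // y' Ay' gy' i; have [N Nd] := small _ d0.
  have [|k Nk yk] := ycl i (e / 2 / l i) N; first by rewrite divr_gt0.
  have gk : gap u x (y_ k) <= d.
    rewrite (le_trans (ltW (gy k)))// (le_trans _ (ltW Nd))//.
    by rewrite lef_pV2 ?posrE// ler_nat.
  rewrite (le_trans (ler_wpM2l (ltW (l_gt0 i)) (ler_enormB _ (y_ k i) _)))//.
  rewrite mulrDr [leRHS]splitr lerD//; first exact: dP.
  by move: yk; rewrite ltr_pdivlMr// mulrC => /ltW.
exists y; split => //.
apply/eqP; rewrite eq_le gap_ge0// andbT.
apply/ler_addgt0Pr => e e0; rewrite add0r.
pose M := 2 * G * m%:R + 1.
have M0 : 0 < M by rewrite ltr_pwDr// !mulr_ge0.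
have eM : 0 < e / 2 / M by rewrite !divr_gt0.
have [d d0 dP] := key _ eM.
have md : 0 < Num.min d (e / 2) by rewrite lt_min d0 divr_gt0.
have [N] := small _ md; rewrite lt_min => /andP[Nd Ne].
have gN := gy N.
have close := dP _ (Ay N) (le_trans (ltW gN) (ltW Nd)).
have H := value_lipschitz x y (y_ N) uL.
have H2 : 2 * G * \sum_i l i * enorm (y i - y_ N i) <= e / 2.
  apply: (@le_trans _ _ (2 * G * \sum_(i < m) e / 2 / M)).
    rewrite ler_wpM2l ?mulr_ge0//; apply: ler_sum => i _.
    by rewrite enormB.
  rewrite sumr_const card_ord -[_ *+ m]mulr_natl.
  rewrite (_ : _ * (m%:R * _) = 2 * G * m%:R * (e / 2) / M); last by ring.
  by rewrite ler_pdivrMr// [leRHS]mulrC ler_wpM2r ?divr_ge0 ?(ltW e0)// /M lerDl.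
have {H2}H := le_trans H (lerD (lexx _) H2).
have := lt_trans gN Ne; rewrite /gap; move: H.
by move: (conjugate u x) (value u x y) (value u x (y_ N)) => *; lra.
Qed.

End maximising_tuple.

(** * The optimal map attached to a dual minimiser *)

Section optimal_map.
Variable u : 'I_m -> 'rV[R]_n -> R.
Hypothesis uL : lipschitz_potentials u.

Let cu := lipschitz_continuous_potentials uL.
Let bu := continuous_bounded_potentials cu.

Let good := S `&` regular u.

Let good_maximiser x y := [/\ good x, tuples y, gap u x y = 0 & forall e, 0 < e ->
  exists2 d, 0 < d & forall y', tuples y' -> gap u x y' <= d ->
    forall i, l i * enorm (y' i - y i) <= e].

(** The value [y0] outside of the good points makes all [argmax x] belong to
    [tuples]. *)
Definition argmax x : 'I_m -> 'rV[R]_n :=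
  match pselect (exists y, good_maximiser x y) with
  | left H => sval (cid H)
  | right _ => fun=> y0
  end.

Let argmaxP x : good x -> good_maximiser x (argmax x).
Proof.
move=> gx; rewrite /argmax; case: pselect => [H|[]]; first exact: (svalP (cid H)).
by have [Sx rx] := gx; have [y [Ay g0 Hy]] := regular_maximiser uL Sx rx; exists y.
Qed.

Lemma argmax_tuple x : tuples (argmax x).
Proof.
rewrite /argmax; case: pselect => [H|_]; last exact: tuples_cst.
by have [] := svalP (cid H).
Qed.

Lemma argmax_gap x : good x -> gap u x (argmax x) = 0.
Proof. by move=> /argmaxP[]. Qed.

Let argmax_bad x : ~ good x -> argmax x = fun=> y0.
Proof.
move=> ngx; rewrite /argmax; case: pselect => // H; exfalso; apply: ngx.
by have [] := svalP (cid H).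
Qed.

Definition perturbed i (v : 'rV[R]_n -> R) k :=
  upd u i (fun b => u i b + k.+1%:R^-1 * v b).

Definition perturbation_quotient i (v : 'rV[R]_n -> R) k x :=
  k.+1%:R * (conjugate (perturbed i v k) x - conjugate u x).

Section derivative.
Variables (i : 'I_m) (v : 'rV[R]_n -> R) (B K : R).
Hypotheses (vB : forall b, Y b -> `|v b| <= B) (K0 : 0 <= K).
Hypothesis vK : forall a b, `|v a - v b| <= K * enorm (a - b).

Local Notation w := (perturbed i v).
Local Notation q := (perturbation_quotient i v).

Lemma continuous_perturbation k : continuous_potentials (w k).
Proof.
apply: continuous_upd => // b.
have cv : {for b, continuous (fun a => k.+1%:R^-1 * v a)}.
  apply: continuousM; first exact: cst_continuous.
  exact: enorm_lipschitz_continuous vK b.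
exact: continuousD (@cu i b) cv.
Qed.

Let bw k := continuous_bounded_potentials (@continuous_perturbation k).

Lemma perturbation_quotient_bounded k x : `|q k x| <= B.
Proof.
pose d := upd (fun=> 0) i (k.+1%:R^-1 * B).
have sumd : \sum_j d j = k.+1%:R^-1 * B.
  by rewrite sum_upd big1 ?add0r ?subr0.
have tB b : Y b -> `|k.+1%:R^-1 * v b| <= k.+1%:R^-1 * B.
  by move=> Yb; rewrite normrM ger0_norm ?invr_ge0// ler_wpM2l ?invr_ge0// vB.
have H1 : conjugate (w k) x <= conjugate u x + k.+1%:R^-1 * B.
  rewrite -sumd; apply: conjugate_perturb => // j b Yb.
  rewrite /perturbed /d /upd; case: eqP => [->|]; last by rewrite addr0.
  have := tB b Yb; rewrite ler_norml.
  by move: (_^-1 * v b) (_^-1 * B) => ? ? /andP[]; lra.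
have H2 : conjugate u x <= conjugate (w k) x + k.+1%:R^-1 * B.
  rewrite -sumd; apply: conjugate_perturb => // j b Yb.
  rewrite /perturbed /d /upd; case: eqP => [->|]; last by rewrite addr0.
  have := tB b Yb; rewrite ler_norml.
  by move: (_^-1 * v b) (_^-1 * B) => ? ? /andP[]; lra.
rewrite /perturbation_quotient normrM ger0_norm// mulrC -ler_pdivlMr// mulrC ler_norml.
by move: (_^-1 * B) H1 H2 => ? ? ?; apply/andP; split; lra.
Qed.

(** Nearly maximising tuples for the perturbed problem converge to the
    maximising one (envelope theorem). *)
Lemma perturbation_quotient_cvg x : good x ->
  q k x @[k --> \oo] --> - v (argmax x i).
Proof.
move=> gx; have [_ Ty g0 close] := argmaxP gx; set T := argmax x in Ty g0 close *.
have B0 : 0 <= B by rewrite (le_trans _ (vB Yy0)).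
have phiE : conjugate u x = value u x T.
  by apply/eqP; rewrite -subr_eq0; apply/eqP.
apply/cvgrPdist_le => e e0.
have e2 : 0 < e / 2 by rewrite divr_gt0.
have K1 : 0 < K + 1 by rewrite ltr_pwDr.
have e1 : 0 < l i * (e / 2 / (K + 1)) by rewrite mulr_gt0// divr_gt0.
have [d d0 dP] := close _ e1.
have C0 : 0 < 2 * B + e / 2 by rewrite ltr_wpDl// mulr_ge0.
have dC : 0 < d / (2 * B + e / 2) by rewrite divr_gt0.
have [N _ HN] := near_infty_natSinv_lt (PosNum dC).
exists N => // k /= Nk.
have {HN} /= := HN k Nk; set t := k.+1%:R^-1; move=> td.
have t0 : 0 < t by rewrite invr_gt0.
have tk : k.+1%:R * t = 1 by rewrite mulfV// pnatr_eq0.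
have {td}td : t * (2 * B + e / 2) <= d by rewrite -ler_pdivlMr// ltW.
have valw y : value (w k) x y = value u x y - t * v (y i).
  by rewrite value_upd; congr (_ - _); rewrite addrAC subrr add0r.
have low : value u x T - t * v (T i) <= conjugate (w k) x.
  by rewrite -valw; exact: value_le_conjugate.
have te : 0 < t * (e / 2) by rewrite mulr_gt0.
have [y Ay Hy] := conjugate_adherent (bw k) x te.
rewrite valw in Hy.
have up := value_le_conjugate bu x Ay.
have vy : `|v (y i)| <= B by apply: vB; exact: Ay.
have vT : `|v (T i)| <= B by apply: vB; exact: Ty.
have gy : gap u x y <= d.
  apply: le_trans td; rewrite /gap phiE.
  have P1 : - (t * B) <= t * v (y i).
    by rewrite -mulrN ler_pM2l//; move: vy; rewrite ler_norml => /andP[].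
  have P2 : t * v (T i) <= t * B.
    by rewrite ler_pM2l//; move: vT; rewrite ler_norml => /andP[].
  by rewrite mulrDr; lra.
have yT : `|v (y i) - v (T i)| <= e / 2.
  rewrite (le_trans (vK _ _))// (@le_trans _ _ ((K + 1) * enorm (y i - T i)))//.
    by rewrite ler_wpM2r// lerDl.
  have := dP y Ay gy i; rewrite ler_pM2l// => H.
  by rewrite -ler_pdivlMl// mulrC.
have qlow : - v (T i) <= q k x.
  rewrite /perturbation_quotient -ler_pdivrMl// -/t mulrN phiE.
  by move: low; lra.
have qup : q k x <= - v (T i) + e.
  rewrite /perturbation_quotient -ler_pdivlMl// -/t phiE.
  have P1 : t * (v (T i) - v (y i)) <= t * (e / 2).
    by rewrite ler_pM2l//; move: yT; rewrite ler_norml => /andP[]; lra.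
  rewrite phiE in up; rewrite mulrBr in P1.
  rewrite mulrDr mulrN.
  have -> : t * e = t * (e / 2) + t * (e / 2) by rewrite -mulrDr -splitr.
  by move: Hy up P1; lra.
by rewrite ler_distl; apply/andP; split; lra.
Qed.

Lemma measurable_perturbation_quotient k : measurable_fun setT (q k).
Proof.
apply: measurable_funM => //; apply: measurable_funB.
  by apply: continuous_measurable_rV; apply: continuous_conjugate; exact: continuous_perturbation.
by apply: continuous_measurable_rV; exact: continuous_conjugate.
Qed.

End derivative.

Let mgood : measurable good := measurableI _ _ mS (measurable_regular uL).

(** On the good points, each coordinate is a limit of the difference quotients for
    [v] equal to that coordinate. *)
Lemma measurable_argmax i : measurable_fun setT (fun x => argmax x i).
Proof.
apply: Defs.measurable_funM => i0 j; rewrite (ord1 i0).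
rewrite -(setUv good); apply/measurable_funU => //; first exact: measurableC.
have pB b : Y b -> `|(b : 'rV[R]_n) 0 j| <= enorm y0 + D.
  move=> Yb; rewrite (le_trans (le_coord_enorm _ _))//.
  by rewrite -[b](subrK y0) addrC (le_trans (ler_enormD _ _))// lerD2l YD.
have pK (a b : 'rV[R]_n) : `|a 0 j - b 0 j| <= 1 * enorm (a - b).
  by rewrite mul1r (le_trans _ (le_coord_enorm _ j))// !mxE.
split.
  rewrite (_ : (fun x => _) = (fun x => - (- argmax x i 0 j))); last first.
    by apply/funext => x; rewrite opprK.
  apply: measurableT_comp => //.
  apply: measurable_fun_cvg => [k|x gx].
    apply: measurable_funTS; exact: (measurable_perturbation_quotient i pK k).
  exact: (perturbation_quotient_cvg pB ler01 pK gx).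
apply: (eq_measurable_fun (fun=> y0 0 j)); last exact: measurable_cst.
by move=> x; rewrite inE => /argmax_bad ->.
Qed.

Section variation.
Hypothesis umin : forall u', lipschitz_potentials u' -> dual u <= dual u'.

(** First order condition for the perturbations of the [i]-th potential. *)
Lemma mean_argmax_le i (v : 'rV[R]_n -> R) B K : 0 <= K ->
  (forall b, Y b -> `|v b| <= B) ->
  (forall a b, `|v a - v b| <= K * enorm (a - b)) ->
  \int[rho]_(x in S) v (argmax x i) <= \int[mu i]_(y in Y) v y.
Proof.
move=> K0 vB vK; have cv := enorm_lipschitz_continuous vK.
have bv : bounded_measurable Y v by exact: continuous_bounded_measurable.
have mva : measurable_fun setT (fun x => v (argmax x i)).
  apply: (measurableT_comp (continuous_measurable_rV cv)).
  exact: measurable_argmax.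
have bva : bounded_measurable S (fun x => v (argmax x i)).
  split; first exact: measurable_funTS.
  by exists B => x _; apply: vB; exact: argmax_tuple.
have bq k : bounded_measurable S (perturbation_quotient i v k).
  split; first by apply: measurable_funTS; exact: (measurable_perturbation_quotient i vK).
  by exists B => x _; exact: perturbation_quotient_bounded.
have cw k := @continuous_perturbation i v K vK k.
have bcw k := bounded_measurable_conjugate (@cw k).
have bcu := bounded_measurable_conjugate cu.
have ge k : - (\int[mu i]_(y in Y) v y) <= \int[rho]_(x in S) perturbation_quotient i v k x.
  have Huf : continuous (fun b => u i b + k.+1%:R^-1 * v b).
    by have := @cw k i; rewrite /perturbed upd_same.
  have := dual_minimizer_coordinate i uL umin Huf.
  rewrite -/(perturbed i v k) /dual.
  rewrite (bigD1 i)//= [X in _ <= _ + X](bigD1 i)//= {2}/perturbed upd_same.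
  rewrite [X in _ <= _ + (_ + X)](eq_bigr (fun j => \int[mu j]_(y in Y) u j y)) =>
      [|j ji]; last first.
    by rewrite /perturbed upd_other.
  rewrite meanD//; last 2 first.
  - exact: continuous_bounded_measurable.
  - exact: bounded_measurableZ.
  rewrite meanZ//; move: (\sum_(j | _) _) => s H.
  rewrite /perturbation_quotient meanZ//; last exact: bounded_measurableB.
  rewrite meanB// -ler_pdivrMl// mulrN; move: H.
  by move: (_^-1 * _) (\int[rho]_(x in S) _) (\int[rho]_(x in S) _) => *; lra.
have cvg : \int[rho]_(x in S) perturbation_quotient i v k x @[k --> \oo] -->
    \int[rho]_(x in S) - v (argmax x i).
  apply: (@mean_bounded_convergence _ _ _ rho S mS _ _ (S `\` regular u) B) => //.
  - by move=> k; exact: (bq k).1.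
  - exact: (bounded_measurableN bva).1.
  - by move=> k x _; exact: perturbation_quotient_bounded.
  - exact: rho_nonregular.
  - by apply: measurableD => //; exact: measurable_regular.
  - move=> x Sx nx; apply: (perturbation_quotient_cvg vB K0 vK).
    by split => //; apply: contrapT => nr; apply: nx.
have : - (\int[mu i]_(y in Y) v y) <= \int[rho]_(x in S) - v (argmax x i).
  by apply: (cvgr_to_ge cvg); exact: nearW.
have -> : \int[rho]_(x in S) - v (argmax x i) = - (\int[rho]_(x in S) v (argmax x i)).
  rewrite -mulN1r -meanZ//; apply: eq_Rintegral => x _.
  by rewrite mulN1r.
by rewrite lerN2.
Qed.

(** The first order condition for [v] and for [- v]. *)
Lemma mean_argmax i (v : 'rV[R]_n -> R) B K : 0 <= K ->
  (forall b, Y b -> `|v b| <= B) ->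
  (forall a b, `|v a - v b| <= K * enorm (a - b)) ->
  \int[rho]_(x in S) v (argmax x i) = \int[mu i]_(y in Y) v y.
Proof.
move=> K0 vB vK; have cv := enorm_lipschitz_continuous vK.
have bv : bounded_measurable Y v by exact: continuous_bounded_measurable.
have bva : bounded_measurable S (fun x => v (argmax x i)).
  split.
    apply: measurable_funTS; apply: (measurableT_comp (continuous_measurable_rV cv)).
    exact: measurable_argmax.
  by exists B => x _; apply: vB; exact: argmax_tuple.
apply/eqP; rewrite eq_le (mean_argmax_le _ K0 vB vK)//=.
have := @mean_argmax_le i (fun b => -1 * v b) B K K0.
rewrite !meanZ// !mulN1r lerN2; apply.
- by move=> b Yb; rewrite normrM normrN1 mul1r vB.
- by move=> a b; rewrite -mulrBr normrM normrN1 mul1r.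
Qed.

(** The first order conditions identify the distributions of the entries of
    [argmax], since Lipschitz functions separate probability measures. *)
Lemma argmax_transport_maps : transport_maps rho S Y mu (fun i x => argmax x i).
Proof.
move=> i; split => [|x _|A0 mA0].
- by apply: measurable_funTS; exact: measurable_argmax.
- exact: argmax_tuple.
have mT := measurable_argmax i.
have mTA : measurable ((fun x => argmax x i) @^-1` A0).
  by rewrite -[X in measurable X]setTI; exact: mT.
pose Tm : {mfun _ >-> _} := HB.pack (fun x => argmax x i) (isMeasurableFun.Build _ _ _ _ _ mT).
rewrite full_measureI//.
apply: (@probability_eq_lipschitz _ _ (distribution rho Tm) (mu i)) => //.
move=> v K K0 vK v01; have cv := enorm_lipschitz_continuous vK.
have vB b : `|v b| <= 1 by have /andP[? ?] := v01 b; rewrite ger0_norm.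
have mv := continuous_measurable_rV cv.
rewrite [RHS](mean_setT mY (muY i))//; last by split => //; exists 1.
rewrite -(mean_argmax i K0 (fun b _ => vB b) vK).
rewrite -(@mean_setT _ _ _ rho S (fun x => v (argmax x i)))//; last first.
  by split; [exact: measurableT_comp|exists 1].
rewrite /Rintegral; congr fine; rewrite /distribution integral_pushforward//.
- exact/measurable_EFinP.
- rewrite preimage_setT; apply: bounded_measurable_integrable => //.
  by split; [exact: measurableT_comp|exists 1].
Qed.

Lemma mean_cost_argmax : cost_mean (fun i x => argmax x i) = dual u.
Proof.
have mT : S_maps (fun i x => argmax x i).
  move=> i; split => [|x _]; last exact: argmax_tuple.
  by apply: measurable_funTS; exact: measurable_argmax.
have gap0 : \int[rho]_(x in S) gap u x (fun i => argmax x i) = 0.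
  rewrite (@mean_negligible _ _ _ rho S mS (S `\` regular u))//.
  - rewrite (@eq_Rintegral _ _ _ _ _ (fun=> 0)).
      by rewrite Rintegral_cst ?mul0r//; do 2 apply: measurableD => //;
        exact: measurable_regular.
    move=> x; rewrite inE => -[Sx nx]; apply: argmax_gap; split => //.
    by apply: contrapT => nr; apply: nx.
  - by apply: measurableD => //; exact: measurable_regular.
  - exact: rho_nonregular.
  - exact: gap_bounded_measurable.
have := mean_gap mT cu; rewrite gap0 => /eqP; rewrite eq_sym subr_eq0 => /eqP <-.
congr (_ + _); apply: eq_bigr => i _.
have [K uK] := bu; apply: (@mean_argmax i (u i) K (l i * G)) => //.
- by rewrite mulr_ge0// ltW.
- by move=> b; exact: uK.
Qed.

End variation.

End optimal_map.

(** Strong duality: both the dual problem and the transport problem, posed over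
    maps and not only over couplings, are solved. *)
Lemma strong_duality : exists u, lipschitz_potentials u /\
  exists2 T, transport_maps rho S Y mu T & cost_mean T = dual u.
Proof.
have [u uL umin] := dual_minimizer; exists u; split => //.
exists (fun i x => argmax u x i); first exact: argmax_transport_maps.
exact: mean_cost_argmax.
Qed.

(** For maps with the prescribed marginals, the defect in weak duality is the
    defect in the dual functional. *)
Lemma mean_gap_transport T u : transport_maps rho S Y mu T ->
  lipschitz_potentials u ->
  \int[rho]_(x in S) gap u x (T ^~ x) = dual u - cost_mean T.
Proof.
move=> tT uL; have cu := lipschitz_continuous_potentials uL.
rewrite mean_gap//; last by move=> i; have [] := tT i.
congr (_ + _ - _); apply: eq_bigr => i _; have [mTi TY Tmu] := tT i.
apply: (mean_transport mS mY Yy0 rhoS mTi TY Tmu); first exact: cu.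
by have [K uK] := continuous_bounded_potentials cu; exists K => b; exact: uK.
Qed.

End one_problem.

(** * Stability of optimal maps *)

(** The choice [r = a / (2 P)]. *)
Lemma sqr_le_of_linear_bound (a P Q : R) : 0 <= a -> 0 <= P -> 0 <= Q ->
  (forall r, 0 < r -> a * r <= P * r ^+ 2 + Q) -> a ^+ 2 <= 4 * P * Q.
Proof.
move=> a0 P0 Q0 H; have [->|an0] := eqVneq a 0.
  by rewrite expr0n /= !mulr_ge0.
have a1 : 0 < a by rewrite lt_def an0.
have [P00|Pn0] := eqVneq P 0.
  have r0 : 0 < (Q + 1) / a by rewrite divr_gt0// ltr_pwDr.
  by have := H _ r0; rewrite P00 mul0r add0r mulrCA divff// mulr1; lra.
have P1 : 0 < P by rewrite lt_def Pn0.
have r0 : 0 < a / (2 * P) by rewrite divr_gt0// mulr_gt0.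
have := H _ r0.
have -> : P * (a / (2 * P)) ^+ 2 = a ^+ 2 / (4 * P) by field.
have -> : a * (a / (2 * P)) = 2 * (a ^+ 2 / (4 * P)) by field.
move=> H2; have : a ^+ 2 / (4 * P) <= Q by lra.
by rewrite ler_pdivrMr ?mulr_gt0// mulrC.
Qed.

Lemma sqrt_le_of_bounds (x a b : R) : 0 <= x -> x <= a -> x <= b ->
  x <= Num.sqrt (a * b).
Proof.
move=> x0 xa xb; have a0 := le_trans x0 xa; have b0 := le_trans x0 xb.
rewrite -(ler_pXn2r (n := 2))// ?nnegrE ?sqrtr_ge0// sqr_sqrtr ?mulr_ge0//.
by rewrite expr2 ler_pM.
Qed.

(** The inner fraction bounds the mean distance of the averages, the last square
    root the mean of the gaps, both in units of [Num.sqrt e]. *)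
Definition stability_constant := 2 / kappa *
  (tau * D * (Num.sqrt (8 * (n%:R * A * (l0 * G)) * n%:R * G) / (kappa * l0))
   + Num.sqrt (8 * G ^+ 2 * D)).

Section two_problems.
Variables (mu mu' : 'I_m -> probability 'rV[R]_n R) (e : R).
Hypotheses (muY : forall i, mu i Y = 1%E) (mu'Y : forall i, mu' i Y = 1%E).
Hypotheses (l_sum : \sum_i l i <= 1) (A0 : 0 <= A) (e0 : 0 <= e).
Hypothesis dual_close : forall u, lipschitz_potentials u ->
  `|dual mu u - dual mu' u| <= G * e.
Variables T T' : 'I_m -> 'rV[R]_n -> 'rV[R]_n.
Hypotheses (tT : transport_maps rho S Y mu T) (tT' : transport_maps rho S Y mu' T').
Hypothesis optT : forall T0, transport_maps rho S Y mu T0 ->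
  cost_mean T0 <= cost_mean T.
Hypothesis optT' : forall T0, transport_maps rho S Y mu' T0 ->
  cost_mean T0 <= cost_mean T'.

Let mT : S_maps T. Proof. by move=> i; have [] := tT i. Qed.
Let mT' : S_maps T'. Proof. by move=> i; have [] := tT' i. Qed.

(** A dual minimiser for [mu] has no gap along optimal maps for [mu], by strong
    duality, and by weak duality for [mu'] it is almost optimal for [mu']. *)
Lemma almost_optimal_potential : exists2 u, lipschitz_potentials u &
  \int[rho]_(x in S) (gap u x (T ^~ x) + gap u x (T' ^~ x)) <= 2 * G * e.
Proof.
have [u [uL [T0 tT0 T0E]]] := strong_duality muY.
have [u' [uL' [T0' tT0' T0E']]] := strong_duality mu'Y.
exists u => //; have cu := lipschitz_continuous_potentials uL.
rewrite meanD//; [|exact: gap_bounded_measurable..].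
rewrite (mean_gap_transport tT uL) (mean_gap_transport tT' uL).
have weak : 0 <= dual mu u' - cost_mean T.
  rewrite -(mean_gap_transport tT uL'); apply: Rintegral_ge0 => x Sx.
  apply: gap_ge0; last by move=> i; exact: (mT i).2.
  exact/continuous_bounded_potentials/lipschitz_continuous_potentials.
have := optT tT0; have := optT' tT0'; rewrite T0E T0E'.
have := dual_close uL; have := dual_close uL'.
by rewrite !ler_norml => /andP[? ?] /andP[? ?]; lra.
Qed.

(** [coordinate_stability] is integrated; the mean of the averages' distance is
    controlled by [average_stability] with the optimal step. Distances of averages
    are at most [D], so their squares are replaced by [D] times themselves. *)
Lemma maps_stability i :
  l i ^+ 2 * \int[rho]_(x in S) enorm (T i x - T' i x) ^+ 2 <=
  stability_constant * Num.sqrt e.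
Proof.
have [u uL gap_e] := almost_optimal_potential.
have cu := lipschitz_continuous_potentials uL.
have bu := continuous_bounded_potentials cu.
pose g x := gap u x (T ^~ x) + gap u x (T' ^~ x).
pose z x := enorm (average x (T ^~ x) - average x (T' ^~ x)).
have AT x : S x -> tuples (T ^~ x) by move=> Sx k; exact: (mT k).2.
have AT' x : S x -> tuples (T' ^~ x) by move=> Sx k; exact: (mT' k).2.
have D0 : 0 <= D by rewrite (le_trans _ (YD Yy0 Yy0)).
have bg : bounded_measurable S g.
  by apply: bounded_measurableD; exact: gap_bounded_measurable.
have g_ge0 x : S x -> 0 <= g x.
  by move=> Sx; rewrite addr_ge0// gap_ge0//; [exact: AT|exact: AT'].
have g_le x : S x -> g x <= 4 * G * D.
  move=> Sx; have := gap_le x l_sum uL (AT x Sx); have := gap_le x l_sum uL (AT' x Sx).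
  by rewrite /g; lra.
have zD x : S x -> z x <= D.
  move=> Sx; rewrite /z averageB (le_trans (ler_enorm_sum _))//.
  rewrite (@le_trans _ _ (\sum_i l i * D))//; last by rewrite -mulr_suml ler_piMl.
  apply: ler_sum => k _; rewrite enormZ gtr0_norm// ler_pM2l//.
  by apply: YD; [exact: AT|exact: AT'].
have bz : bounded_measurable S z.
  split; first by apply: measurable_enormB => //; exact: measurable_average.
  by exists D => x Sx; rewrite ger0_norm ?zD//; exact: enorm_ge0.
pose I := \int[rho]_(x in S) z x.
have I0 : 0 <= I by apply: Rintegral_ge0 => x _; exact: enorm_ge0.
pose J := \int[rho]_(x in S) g x.
have J0 : 0 <= J by apply: Rintegral_ge0.
pose P := n%:R * A * (l0 * G).
have P0 : 0 <= P by rewrite !mulr_ge0// ltW.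
have Je : J <= 2 * G * e by [].
have IJ r : 0 < r -> kappa * l0 * I * r <= P * r ^+ 2 + n%:R * J.
  move=> r0; rewrite mulrAC -meanZ//.
  apply: (@le_trans _ _ (\int[rho]_(x in S) (axis_second_diff u r x + n%:R * g x))).
    apply: le_mean => //.
    - exact: bounded_measurableZ.
    - apply: bounded_measurableD; last exact: bounded_measurableZ.
      exact: axis_second_diff_bounded_measurable.
    - move=> x Sx; apply: average_stability => //; [exact: AT|exact: AT'].
  rewrite meanD//; [|exact: axis_second_diff_bounded_measurable|exact: bounded_measurableZ].
  by rewrite meanZ// lerD2r; exact: mean_axis_second_diff.
have kl : 0 < kappa * l0 by rewrite mulr_gt0.
have I2 : I <= Num.sqrt (8 * P * n%:R * G) / (kappa * l0) * Num.sqrt e.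
  have klI : 0 <= kappa * l0 * I by rewrite mulr_ge0// ltW.
  have nJ : 0 <= n%:R * J by rewrite mulr_ge0.
  have H := sqr_le_of_linear_bound klI P0 nJ IJ.
  have PnG : 0 <= 8 * P * n%:R * G.
    by apply: mulr_ge0 => //; apply: mulr_ge0 => //; exact: mulr_ge0.
  rewrite mulrAC -sqrtrM// ler_pdivlMr// mulrC.
  rewrite -(ler_pXn2r (n := 2))// ?nnegrE ?sqrtr_ge0//.
  rewrite sqr_sqrtr ?(mulr_ge0 PnG)// (le_trans H)//.
  apply: (@le_trans _ _ (4 * P * (n%:R * (2 * G * e)))).
    by apply: ler_wpM2l; [exact: mulr_ge0|exact: ler_wpM2l].
  by rewrite le_eqVlt; apply/orP; left; apply/eqP; ring.
have J2 : J <= Num.sqrt (8 * G ^+ 2 * D) * Num.sqrt e.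
  have J4 : J <= 4 * G * D.
    rewrite -[leRHS](@mean_cst _ _ _ rho S)//; apply: le_mean => //.
    exact: bounded_measurable_cst.
  rewrite -sqrtrM ?mulr_ge0 ?sqr_ge0//.
  rewrite (_ : 8 * G ^+ 2 * D * e = (4 * G * D) * (2 * G * e)); last by ring.
  exact: sqrt_le_of_bounds.
have bd : bounded_measurable S (fun x => enorm (T i x - T' i x) ^+ 2).
  split.
    apply: measurable_funX; apply: measurable_enormB => //; first exact: (mT i).1.
    exact: (mT' i).1.
  exists (D ^+ 2) => x Sx; rewrite ger0_norm ?sqr_ge0// lerXn2r ?nnegrE//.
  by apply: YD; [exact: AT|exact: AT'].
rewrite -meanZ//.
have : kappa / 2 * \int[rho]_(x in S) (l i ^+ 2 * enorm (T i x - T' i x) ^+ 2) <=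
    tau * D * I + J.
  rewrite -[_ * I]meanZ// -meanZ//; last exact: bounded_measurableZ.
  rewrite -meanD//; last exact: bounded_measurableZ.
  apply: le_mean => //; [by do 2 apply: bounded_measurableZ| |].
    by apply: bounded_measurableD => //; exact: bounded_measurableZ.
  move=> x Sx; rewrite -exprMn.
  have := coordinate_stability bu i Sx (AT x Sx) (AT' x Sx).
  rewrite -/(z x) -/(g x) => /le_trans; apply; rewrite lerD2r.
  rewrite -mulrA ler_wpM2l// expr2 ler_wpM2r ?zD//; exact: enorm_ge0.
rewrite -ler_pdivlMl ?divr_gt0// invf_div => /le_trans; apply.
rewrite /stability_constant -[leRHS]mulrA.
rewrite ler_wpM2l ?divr_ge0// ?(ltW kappa_gt0)// mulrDl lerD//.
by rewrite -[leRHS]mulrA ler_wpM2l// mulr_ge0.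
Qed.

End two_problems.

End potentials.

(** * Wasserstein distance and Lipschitz functions *)

Section kantorovich_rubinstein.
Context {R : realType} {n : nat}.
Variables (mu nu : probability 'rV[R]_n R) (Y : set 'rV[R]_n) (y0 : 'rV[R]_n).
Hypotheses (cY : compact Y) (Yy0 : Y y0) (muY : mu Y = 1%E) (nuY : nu Y = 1%E).

Let mY : measurable Y := compact_measurable_rV cY.

Lemma lipschitz_mean_coupling (v : 'rV[R]_n -> R) K
    (gamma : probability ('rV[R]_n * 'rV[R]_n)%type R) : 0 <= K ->
  (forall a b, `|v a - v b| <= K * enorm (a - b)) -> couplings mu nu gamma ->
  (`| \int[mu]_(y in Y) v y - \int[nu]_(y in Y) v y |%:E <=
   K%:E * \int[gamma]_z (enorm (z.1 - z.2))%:E)%E.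
Proof.
move=> K0 vK cpl; have cv := enorm_lipschitz_continuous vK.
have [_ vB] := continuous_bounded_measurable cY cv.
pose Q := Y `*` Y; have mQ : measurable Q by exact: measurableX.
have m1 : measurable_fun Q (@fst 'rV[R]_n 'rV[R]_n) by apply: measurable_funTS.
have m2 : measurable_fun Q (@snd 'rV[R]_n 'rV[R]_n) by apply: measurable_funTS.
have g1 : gamma (Y `*` setT) = 1%E by have [-> _] := cpl _ mY.
have g2 : gamma (setT `*` Y) = 1%E by have [_ ->] := cpl _ mY.
have gQ : gamma Q = 1%E.
  rewrite /Q (_ : Y `*` Y = (Y `*` setT) `&` (setT `*` Y)); last first.
    by apply/seteqP; split => [z [? ?]|z [[? _] [_ ?]]].
  by rewrite full_measureI//; exact: measurableX.
have E1 : \int[gamma]_(z in Q) v z.1 = \int[mu]_(y in Y) v y.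
  apply: (mean_transport mQ mY Yy0 gQ m1) => //; first by move=> z [].
  move=> A mA; rewrite full_measureI//; last first.
    by rewrite -[X in measurable X]setTI; exact: measurable_fst.
  have [<- _] := cpl _ mA; congr (gamma _).
  by apply/seteqP; split => [z ?|z []].
have E2 : \int[gamma]_(z in Q) v z.2 = \int[nu]_(y in Y) v y.
  apply: (mean_transport mQ mY Yy0 gQ m2) => //; first by move=> z [].
  move=> A mA; rewrite full_measureI//; last first.
    by rewrite -[X in measurable X]setTI; exact: measurable_snd.
  have [_ <-] := cpl _ mA; congr (gamma _).
  by apply/seteqP; split => [z ?|z []].
have mv := continuous_measurable_rV cv.
have [B HB] := vB.
have b1 : bounded_measurable Q (fun z => v z.1).
  by split; [exact: (measurableT_comp mv m1)|exists B => z [? _]; exact: HB].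
have b2 : bounded_measurable Q (fun z => v z.2).
  by split; [exact: (measurableT_comp mv m2)|exists B => z [_ ?]; exact: HB].
rewrite -E1 -E2 -meanB//.
have bb := bounded_measurableB b1 b2.
have me : measurable_fun setT (fun z : 'rV[R]_n * 'rV[R]_n => (enorm (z.1 - z.2))%:E).
  apply/measurable_EFinP; apply: measurable_enormB => //.
rewrite EFin_normr_Rintegral//; last exact: bounded_measurable_integrable.
apply: (le_trans (le_abse_integral _ mQ _)); first by apply/measurable_EFinP; exact: bb.1.
rewrite -ge0_integralZl//; last by move=> z _; rewrite lee_fin.
apply: (@le_trans _ _ (\int[gamma]_(z in Q) (K%:E * (enorm (z.1 - z.2))%:E))%E).
  apply: ge0_le_integral => //.
  - by apply: measurableT_comp => //; apply/measurable_EFinP; exact: bb.1.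
  - by apply: measurable_funTS; exact: measurable_funeM.
  - by move=> z _; rewrite -EFinM lee_fin.
apply: ge0_subset_integral => //; first exact: measurable_funeM.
by move=> z _; rewrite -EFinM lee_fin mulr_ge0.
Qed.

(** The easy half of the Kantorovich-Rubinstein theorem: the Lipschitz condition
    is integrated against a coupling. *)
Lemma lipschitz_mean_W1 (v : 'rV[R]_n -> R) K : 0 < K ->
  (forall a b, `|v a - v b| <= K * enorm (a - b)) ->
  (`| \int[mu]_(y in Y) v y - \int[nu]_(y in Y) v y |%:E <= K%:E * W1 mu nu)%E.
Proof.
move=> K0 vK; rewrite muleC -lee_pdivrMr//.
apply: le_ereal_inf_tmp => _ [gamma cpl <-].
rewrite lee_pdivrMr// muleC.
exact: (lipschitz_mean_coupling (ltW K0) vK cpl).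
Qed.

Lemma W1_ge0 : (0 <= W1 mu nu)%E.
Proof.
by apply: le_ereal_inf_tmp => _ [gamma _ <-]; apply: integral_ge0 => z _; rewrite lee_fin.
Qed.

End kantorovich_rubinstein.

(** * The uniformly concave cost *)

Section extended_cost.
Context {R : realType} {n : nat}.
Variables (U K : set 'rV[R]_n) (h : 'rV[R]_n -> R) (x0 : 'rV[R]_n).
Variables (kappa tau D : R).
Hypotheses (oU : open U) (C2h : C2_on U h) (KU : conv_hull K `<=` U).
Hypotheses (Kx0 : K x0) (KD : forall a b, K a -> K b -> enorm (a - b) <= D).
Hypotheses (kappa0 : 0 < kappa) (kappa_tau : kappa <= tau).
Hypothesis hessianP : forall x v, U x ->
  - (tau * dot v v) <= bilin (hessian h x) v v <= - (kappa * dot v v).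

Let Z := conv_hull K.
Let p z := grad h x0 - grad h z.
Let g z := - h z + dot (grad h x0) z.

(** [- h], up to a linear term, extended from the convex hull to a convex
    Lipschitz function. The linear term makes the gradient vanish at [x0], so
    that it is bounded in terms of [tau] and [D] only; the bound is taken to be
    [tau * D + 1], which is positive also when [D] vanishes. *)
Definition extended_cost := tangent_sup Z g p.

Let Zx0 : Z x0 := conv_hull_sub Kx0.

Let segU z w (t : R) : Z z -> Z w -> 0 <= t <= 1 -> U (z + t *: (w - z)).
Proof. by move=> Zz Zw t01; apply: KU; exact: conv_hull_segment. Qed.

Let tau0 : 0 <= tau. Proof. by rewrite ltW// (lt_le_trans kappa0). Qed.

Let pD z : Z z -> enorm (p z) <= tau * D + 1.
Proof.
move=> Zz; rewrite /p enormB.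
have := grad_lipschitz oU C2h (ltW kappa0) hessianP (fun t => @segU x0 z t Zx0 Zz).
move=> /le_trans; apply; rewrite ler_wpDr// ler_wpM2l//.
by apply: conv_hull_ball Zz => a Ka; exact: KD.
Qed.

Let g_bounds z w : Z z -> Z w ->
  g z + dot (p z) (w - z) + kappa / 2 * enorm (w - z) ^+ 2 <= g w <=
  g z + dot (p z) (w - z) + tau * enorm (w - z) ^+ 2.
Proof.
move=> Zz Zw.
have := quadratic_bounds oU C2h (ltW kappa0) hessianP (fun t => @segU z w t Zz Zw).
rewrite (_ : z + (w - z) = w); last by rewrite addrC subrK.
by rewrite sqr_enorm /g /p (dotBl (grad h x0)) (dotBr w z (grad h x0)) => /andP[]; lra.
Qed.

Let g_tangent z w : Z z -> Z w -> g z + dot (p z) (w - z) <= g w.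
Proof.
move=> Zz Zw; have /andP[+ _] := g_bounds Zz Zw; apply: le_trans.
by rewrite lerDl mulr_ge0 ?sqr_ge0// divr_ge0// ltW.
Qed.

Lemma extended_costE z : conv_hull K z ->
  extended_cost z = - h z + dot (grad h x0) z.
Proof. by move=> Zz; exact: (tangent_supE Zx0 pD g_tangent). Qed.

Lemma extended_cost_lipschitz z w :
  `|extended_cost z - extended_cost w| <= (tau * D + 1) * enorm (z - w).
Proof. exact: (tangent_sup_lipschitz Zx0 pD g_tangent). Qed.

Lemma extended_cost_tangent z w : conv_hull K z ->
  extended_cost z + dot (grad h x0 - grad h z) (w - z) <= extended_cost w.
Proof.
move=> Zz; rewrite extended_costE//.
exact: (tangent_sup_ub Zx0 pD g_tangent).
Qed.

Lemma extended_cost_lower z w : conv_hull K z -> conv_hull K w ->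
  extended_cost z + dot (grad h x0 - grad h z) (w - z)
    + kappa / 2 * enorm (w - z) ^+ 2 <= extended_cost w.
Proof.
by move=> Zz Zw; rewrite !extended_costE//; have /andP[] := g_bounds Zz Zw.
Qed.

Lemma extended_cost_upper z w : conv_hull K z -> conv_hull K w ->
  extended_cost w <= extended_cost z + dot (grad h x0 - grad h z) (w - z)
    + tau * enorm (w - z) ^+ 2.
Proof.
by move=> Zz Zw; rewrite !extended_costE//; have /andP[] := g_bounds Zz Zw.
Qed.

Lemma extended_cost_convex z w : 0 <= second_diff extended_cost w z.
Proof.
by rewrite subr_ge0; exact: (tangent_sup_midpoint Zx0 pD g_tangent).
Qed.

End extended_cost.

(** * The barycentric problem *)

Lemma enorm_le_diam {R : realType} {n : nat} (K : set 'rV[R]_n) a b :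
  compact K -> K a -> K b -> enorm (a - b) <= diam K.
Proof.
move=> cK Ka Kb; apply: sup_ubound; last by exists a => //; exists b.
have [|_ [B KB]] := @continuous_bounded_measurable _ _ _ (@enorm R n) cK.
  apply: (@enorm_lipschitz_continuous _ _ _ 1) => x y.
  by rewrite mul1r ler_dist_enorm.
exists (B + B) => _ [x Kx [y Ky <-]]; rewrite (le_trans (ler_enormD _ _))// enormN.
by apply: lerD; rewrite -[leLHS]ger0_norm// KB.
Qed.

Section second_difference_mean.
Context {R : realType} {n : nat}.
Variables (rho : probability 'rV[R]_n R) (M : R) (S : set 'rV[R]_n).
Variables (x0 : 'rV[R]_n) (D : R).
Hypotheses (rho_leb : rho `<< lebesgue_rV n).
Hypothesis rhoM : 'N[lebesgue_rV n]_+oo[density rho]%E = M%:E.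
Hypotheses (cS : compact S) (SD : forall x, S x -> enorm (x - x0) <= D) (D0 : 0 <= D).

Lemma density_bound_ge0 : 0 <= M.
Proof. by rewrite -lee_fin -rhoM Lnorm_ge0. Qed.

(** [S] lies in a cube of side [2 * D + 1]; the summand [1] keeps the side
    positive when [D] vanishes. *)
Definition second_diff_constant := M * (4 * (2 * D + 1) ^+ n.-1).

Lemma second_diff_constant_ge0 : 0 <= second_diff_constant.
Proof.
rewrite /second_diff_constant mulr_ge0 ?density_bound_ge0//.
by rewrite mulr_ge0// exprn_ge0// addr_ge0// mulr_ge0.
Qed.

Lemma mean_second_difference (f : 'rV[R]_n -> R) L j r :
  (forall x x', `|f x - f x'| <= L * enorm (x - x')) ->
  (forall x v, 0 <= second_diff f v x) -> 0 < r ->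
  (\int[rho]_(x in S) (second_diff f (r *: delta_mx 0 j) x)%:E
    <= (second_diff_constant * L * r ^+ 2)%:E)%E.
Proof.
move=> fL f0 r0; pose a := x0 - const_mx D.
have s0 : 0 < 2 * D + 1 by rewrite ltr_pwDr// mulr_ge0.
rewrite (_ : second_diff_constant * L = M * (4 * L * (2 * D + 1) ^+ n.-1)); last first.
  by rewrite /second_diff_constant; ring.
apply: (@integral_second_difference_density _ _ _ _ rho_leb rhoM _ _ _ _ _ a) => //.
- exact: compact_measurable_rV.
- move=> x Sx i; have := le_trans (le_coord_enorm (x - x0) i) (SD Sx).
  by rewrite in_itv /= !mxE ler_norml => /andP[]; lra.
- by apply: continuous_measurable_rV; exact: enorm_lipschitz_continuous fL.
- move=> x t; rewrite (le_trans (fL _ _))// [x + _]addrC addrK enormZ enorm_delta.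
  by rewrite mulr1.
Qed.

End second_difference_mean.

Section linear_cost.
Context {R : realType} {n m : nat}.
Variables (S Y : set 'rV[R]_n) (y0 w : 'rV[R]_n) (l0 : R) (l : 'I_m -> R).
Variables (rho : probability 'rV[R]_n R) (mu : 'I_m -> probability 'rV[R]_n R).
Hypotheses (cS : compact S) (cY : compact Y) (Yy0 : Y y0) (rhoS : rho S = 1%E).

Let cdot : continuous (dot w).
Proof.
apply: (@enorm_lipschitz_continuous _ _ _ (enorm w)) => x y.
by rewrite -dotBr normr_dot.
Qed.

Let mS := compact_measurable_rV cS.
Let mY := compact_measurable_rV cY.

Let dotT_bounded T i : transport_maps rho S Y mu T ->
  bounded_measurable S (fun x => dot w (T i x)).
Proof.
move=> /(_ i)[mT TY _]; split.
  exact: (measurableT_comp (continuous_measurable_rV cdot) mT).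
have [_ [B HB]] := continuous_bounded_measurable cY cdot.
by exists B => x Sx; apply: HB; exact: TY.
Qed.

Let dot_average T x : dot w (average l0 l x (T ^~ x)) =
  l0 * dot w x + \sum_i l i * dot w (T i x).
Proof.
rewrite dotDr dotZr dot_sumr; congr (_ + _).
by apply: eq_bigr => i _; rewrite dotZr.
Qed.

Lemma dot_average_bounded_measurable T : transport_maps rho S Y mu T ->
  bounded_measurable S (fun x => dot w (average l0 l x (T ^~ x))).
Proof.
move=> tT; rewrite (_ : (fun x => _) =
  (fun x => l0 * dot w x + \sum_i l i * dot w (T i x))); last first.
  by apply/funext => x; exact: dot_average.
apply: bounded_measurableD.
  by apply: bounded_measurableZ; exact: continuous_bounded_measurable.
by apply: bounded_measurable_sum => i; apply: bounded_measurableZ; exact: dotT_bounded.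
Qed.

Lemma mean_dot_average T : transport_maps rho S Y mu T ->
  \int[rho]_(x in S) dot w (average l0 l x (T ^~ x)) =
  l0 * \int[rho]_(x in S) dot w x + \sum_i l i * \int[mu i]_(y in Y) dot w y.
Proof.
move=> tT; under eq_Rintegral do rewrite dot_average.
have bS : bounded_measurable S (dot w) by exact: continuous_bounded_measurable.
have bT i := bounded_measurableZ (l i) (dotT_bounded i tT).
rewrite meanD//; [|exact: bounded_measurableZ|exact: bounded_measurable_sum].
congr (_ + _); first by rewrite meanZ.
rewrite mean_sum//; apply: eq_bigr => i _.
have [mT TY Tmu] := tT i; rewrite meanZ//; last exact: dotT_bounded.
congr (_ * _); apply: (mean_transport mS mY Yy0 rhoS mT TY Tmu cdot).
by have [] := continuous_bounded_measurable cY cdot.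
Qed.

End linear_cost.

Section barycentric_problem.
Context {R : realType} {m n : nat}.
Variables (lam : 'I_m.+1 -> R) (S Y U : set 'rV[R]_n) (h : 'rV[R]_n -> R).
Variables (rho : probability 'rV[R]_n R) (kappa tau M : R) (x0 y0 : 'rV[R]_n).
Hypotheses (lam_gt0 : forall i, 0 < lam i) (lam_sum : \sum_i lam i = 1).
Hypotheses (cS : compact S) (cY : compact Y) (Sx0 : S x0) (Yy0 : Y y0).
Hypotheses (oU : open U) (hullU : conv_hull (S `|` Y) `<=` U) (C2h : C2_on U h).
Hypotheses (kappa0 : 0 < kappa) (kappa_tau : kappa <= tau).
Hypothesis hessianP : forall x v, U x ->
  - (tau * dot v v) <= bilin (hessian h x) v v <= - (kappa * dot v v).
Hypotheses (rhoS : rho S = 1%E) (rho_leb : rho `<< lebesgue_rV n).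
Hypothesis rhoM : 'N[lebesgue_rV n]_+oo[density rho]%E = M%:E.

Let K := S `|` Y.
Let D := diam K.
Let G := tau * D + 1.
Let l : 'I_m -> R := fun i => lam (lift ord0 i).
Let c := extended_cost K h x0.
Let l_gt0 i : 0 < l i. Proof. exact: lam_gt0. Qed.
Let avg := @average R n m (lam ord0) l.

Let KD a b : K a -> K b -> enorm (a - b) <= D.
Proof. by apply: enorm_le_diam; exact: compactU. Qed.

Let Kx0 : K x0. Proof. by left. Qed.

Let D_ge0 : 0 <= D.
Proof. by rewrite (le_trans _ (KD Kx0 Kx0)). Qed.

Let tau_ge0 : 0 <= tau. Proof. by rewrite ltW// (lt_le_trans kappa0). Qed.

Let G_gt0 : 0 < G. Proof. by rewrite ltr_pwDr// mulr_ge0. Qed.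

Let average_family x y :
  \sum_i lam i *: fcons x y i = avg x y.
Proof.
rewrite big_ord_recl /fcons unlift_none; congr (_ + _).
by apply: eq_bigr => i _; rewrite liftK.
Qed.

Let average_hull x y : S x -> tuples Y y -> conv_hull K (avg x y).
Proof.
move=> Sx Ay; rewrite -average_family; apply: conv_hull_sum => // i.
by rewrite /fcons; case: unliftP => [j|] _ /=; [right; exact: Ay|left].
Qed.

Let c_lipschitz := extended_cost_lipschitz oU C2h hullU Kx0 KD kappa0 kappa_tau hessianP.

Let YD y y' : Y y -> Y y' -> enorm (y - y') <= D.
Proof. by move=> Yy Yy'; apply: KD; right. Qed.

Section transport_to.
Variables (mu : 'I_m -> probability 'rV[R]_n R) (T : 'I_m -> 'rV[R]_n -> 'rV[R]_n).
Hypothesis tT : transport_maps rho S Y mu T.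

Let linear_part : R := lam ord0 * \int[rho]_(x in S) dot (grad h x0) x +
  \sum_i l i * \int[mu i]_(y in Y) dot (grad h x0) y.

(** The linear part of the cost has the same mean for all transport maps. *)
Lemma mm_objectiveE : mm_objective rho S (bary_cost lam h) T =
  (linear_part - cost_mean c (lam ord0) l S rho T)%:E.
Proof.
have TS : S_maps Y S T by move=> i; have [] := tT i.
have bd := dot_average_bounded_measurable (grad h x0) (lam ord0) l cS cY tT.
have bc := cost_bounded_measurable Yy0 (lam_gt0 ord0) l_gt0
  c_lipschitz (ltW G_gt0) YD cS TS.
rewrite /linear_part -(mean_dot_average _ _ _ cS cY Yy0 rhoS tT) -meanB//; last first.
  exact: compact_measurable_rV.
rewrite -mean_EFin; [|exact: compact_measurable_rV|exact: bounded_measurableB].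
apply: eq_integral => x /set_mem Sx; rewrite /bary_cost average_family.
rewrite /c (extended_costE oU C2h hullU Kx0 KD kappa0 kappa_tau hessianP); last first.
  by apply: average_hull => // i; exact: (TS i).2.
by rewrite opprD opprK addrCA subrr addr0.
Qed.

End transport_to.

Lemma optimal_cost_mean mu T T' : mm_optimal_maps rho S Y mu (bary_cost lam h) T ->
  transport_maps rho S Y mu T' ->
  cost_mean c (lam ord0) l S rho T' <= cost_mean c (lam ord0) l S rho T.
Proof.
move=> [tT optT] tT'; have := optT T' tT'.
by rewrite (mm_objectiveE tT) (mm_objectiveE tT') lee_fin lerD2l lerN2.
Qed.

Definition maps_constant : R := @stability_constant R n (lam ord0) G D kappa tau
  (@second_diff_constant R n M D).

Lemma maps_constant_ge0 : 0 <= maps_constant.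
Proof.
rewrite /maps_constant /stability_constant mulr_ge0//.
  by rewrite divr_ge0// ltW.
apply: addr_ge0; last exact: sqrtr_ge0.
apply: mulr_ge0; first exact: mulr_ge0.
by apply: divr_ge0; [exact: sqrtr_ge0|rewrite mulr_ge0// ltW].
Qed.

Variables (mu mu' : 'I_m -> probability 'rV[R]_n R).
Hypotheses (muY : forall i, mu i Y = 1%E) (mu'Y : forall i, mu' i Y = 1%E).

Let W : \bar R := (\sum_i (l i)%:E * W1 (mu i) (mu' i))%E.

Let term_ge0 i : (0 <= (l i)%:E * W1 (mu i) (mu' i))%E.
Proof. by rewrite mule_ge0 ?W1_ge0// lee_fin ltW. Qed.

Let W_ge0 : (0 <= W)%E.
Proof. exact: sume_ge0. Qed.

Let dual_close e u : W = e%:E -> lipschitz_potentials l G u ->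
  `|dual c (lam ord0) l Y S rho mu u - dual c (lam ord0) l Y S rho mu' u| <= G * e.
Proof.
move=> We uL; rewrite /dual opprD addrACA subrr add0r -sumrB.
rewrite (le_trans (ler_norm_sum _ _ _))// -lee_fin EFinM -We -sumEFin.
rewrite ge0_sume_distrr//.
apply: lee_sum => i _; rewrite muleA -EFinM [G * _]mulrC.
apply: (lipschitz_mean_W1 cY Yy0) => //; first exact: mulr_gt0.
Qed.

Variables T T' : 'I_m -> 'rV[R]_n -> 'rV[R]_n.
Hypothesis optT : mm_optimal_maps rho S Y mu (bary_cost lam h) T.
Hypothesis optT' : mm_optimal_maps rho S Y mu' (bary_cost lam h) T'.

(** One square root comes from [maps_stability], the other one from the
    definition of the norm in [L^2]. *)
Lemma weighted_L2norm_le e i : W = e%:E ->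
  ((l i)%:E * L2norm rho S (fun x => T i x - T' i x)%R <=
   (Num.sqrt maps_constant)%:E * e%:E `^ 4^-1)%E.
Proof.
move=> We; have mS := compact_measurable_rV cS.
have e0 : 0 <= e by rewrite -lee_fin -We.
have l_sum : \sum_j l j <= 1.
  by rewrite -lam_sum big_ord_recl lerDr ltW.
have H := maps_stability Yy0 (lam_gt0 ord0) l_gt0
  c_lipschitz (ltW G_gt0) YD average_hull
  (extended_cost_tangent oU C2h hullU Kx0 KD kappa0 kappa_tau hessianP)
  (extended_cost_lower oU C2h hullU Kx0 KD kappa0 kappa_tau hessianP)
  (extended_cost_upper oU C2h hullU Kx0 KD kappa0 kappa_tau hessianP)
  kappa0 tau_ge0
  (extended_cost_convex oU C2h hullU Kx0 KD kappa0 kappa_tau hessianP)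
  cS cY rhoS
  (mean_second_difference rho_leb rhoM cS (fun x Sx => KD (or_introl Sx) Kx0) D_ge0)
  muY mu'Y l_sum (second_diff_constant_ge0 rhoM D_ge0) e0
  (fun u => @dual_close e u We) optT.1 optT'.1
  (fun T0 => optimal_cost_mean optT) (fun T0 => optimal_cost_mean optT') i.
have [[mTi TY _] [mT'i T'Y _]] := (optT.1 i, optT'.1 i).
have bd : bounded_measurable S (fun x => enorm (T i x - T' i x) ^+ 2).
  split; first by apply: measurable_funX; exact: measurable_enormB.
  exists (D ^+ 2) => x Sx; rewrite ger0_norm ?sqr_ge0// lerXn2r ?nnegrE//.
  by apply: YD; [exact: TY|exact: T'Y].
have I0 : 0 <= \int[rho]_(x in S) enorm (T i x - T' i x) ^+ 2.
  by apply: Rintegral_ge0 => x _; exact: sqr_ge0.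
rewrite /L2norm mean_EFin// !poweR_EFin -!EFinM lee_fin.
rewrite (_ : 4^-1 = 2^-1 * 2^-1); last by field.
rewrite powRrM !powR12_sqrt ?powR_ge0//.
rewrite -[l i]gtr0_norm// -sqrtr_sqr -!sqrtrM ?sqr_ge0 ?maps_constant_ge0//.
exact: ler_wsqrtr.
Qed.

Lemma sum_weighted_L2norm_le :
  (\sum_(i < m) (l i)%:E * L2norm rho S (fun x => T i x - T' i x)%R
   <= (m%:R * Num.sqrt maps_constant + 1)%:E * W `^ 4^-1)%E.
Proof.
have C_gt0 : 0 < m%:R * Num.sqrt maps_constant + 1.
  by rewrite ltr_pwDr// mulr_ge0// sqrtr_ge0.
case WE : W W_ge0 => [e| |//] W0; last first.
  by rewrite poweRyr ?invr_eq0 ?pnatr_eq0// gt0_muley ?lte_fin// leey.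
rewrite (le_trans (lee_sum _ (fun i _ => weighted_L2norm_le i WE)))//.
rewrite !poweR_EFin -!EFinM sumEFin lee_fin.
rewrite sumr_const card_ord -[leLHS]mulr_natl mulrA ler_wpM2r ?powR_ge0//.
by rewrite lerDl.
Qed.

End barycentric_problem.

(* There are N = m.+1 marginals; index 1 of the text is ord0 and the indices
   2, ..., N are the lift ord0 i for i : 'I_m. *)
Theorem corollary4p3 (R : realType) (m n : nat) (lam1 D kappa tau M : R) :
  (3 <= m.+1)%N -> (0 < n)%N -> 0 < kappa -> kappa <= tau ->
  exists C : R, 0 < C /\
  forall (lam : 'I_m.+1 -> R) (S Y U : set 'rV[R]_n) (h : 'rV[R]_n -> R)
         (rho : probability 'rV[R]_n R),
    (forall i, 0 < lam i) -> \sum_i lam i = 1 -> lam ord0 = lam1 ->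
    compact S -> compact Y -> diam (S `|` Y) = D ->
    open U -> closure (conv_hull (S `|` Y)) `<=` U ->
    C2_on U h ->
    (forall x, U x -> form_le (- tau)%:M (hessian h x) /\
                      form_le (hessian h x) (- kappa)%:M) ->
    rho S = 1%E -> rho `<< lebesgue_rV n ->
    'N[lebesgue_rV n]_+oo[density rho]%E = M%:E ->
  forall mu mu' : 'I_m -> probability 'rV[R]_n R,
    (forall i, mu i Y = 1%E) -> (forall i, mu' i Y = 1%E) ->
  forall T T' : 'I_m -> 'rV[R]_n -> 'rV[R]_n,
    mm_optimal_maps rho S Y mu (bary_cost lam h) T ->
    mm_optimal_maps rho S Y mu' (bary_cost lam h) T' ->
    (\sum_(i < m) (lam (lift ord0 i))%:E *
                  L2norm rho S (fun x => T i x - T' i x)%R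
     <= C%:E * (\sum_(i < m) (lam (lift ord0 i))%:E * W1 (mu i) (mu' i))
               `^ 4^-1)%E.
Proof.
move=> m2 n0 kappa0 kappa_tau.
pose K : R := stability_constant (n := n) lam1 (tau * D + 1) D kappa tau
  (second_diff_constant (n := n) M D).
exists (m%:R * Num.sqrt K + 1); split.
  by rewrite ltr_pwDr// mulr_ge0// sqrtr_ge0.
move=> lam S Y U h rho lam_gt0 lam_sum lam1E cS cY DE oU KU C2h hess rhoS rho_leb.
move=> rhoM mu mu' muY mu'Y T T' optT optT'; rewrite /K -lam1E -DE.
have nonempty (P : probability 'rV[R]_n R) A : P A = 1%E -> A !=set0.
  move=> PA; apply/set0P/eqP => A0; move: PA.
  by rewrite A0 measure0 => /esym/eqP; rewrite onee_eq0.
have [x0 Sx0] := nonempty _ _ rhoS.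
have [y0 Yy0] := nonempty _ _ (muY (Ordinal (m2 : (1 < m)%N))).
have hullU : conv_hull (S `|` Y) `<=` U.
  by apply: subset_trans KU; exact: subset_closure.
have hessianP x v : U x ->
    - (tau * dot v v) <= bilin (hessian h x) v v <= - (kappa * dot v v).
  move=> /hess[/(_ v) lo /(_ v) hi]; move: lo hi.
  by rewrite -!/(bilin _ v v) !bilin_scalar !mulNr => -> ->.
exact: (sum_weighted_L2norm_le lam_gt0 lam_sum cS cY Sx0 Yy0 oU hullU C2h
  kappa0 kappa_tau hessianP rhoS rho_leb rhoM muY mu'Y optT optT').
Qed.
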